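(* For every $\beta>0$ the following holds. There exist positive constants $C_1, C_2, D_1, D_2$ not depending on $\beta$, and positive constants $C^{l}(\beta), C^{u}(\beta), D^{l}(\beta), D^{u}(\beta), C_R(\beta), D_R(\beta)$ depending only on $\beta$, such that \[ C^{l}(\beta)\mathrm{e}^{-C_1x^2} \le \pi(Q_1(\infty) < -x) \le C^{u}(\beta)\mathrm{e}^{-C_2x^2} \quad\text{for all } x \ge C_R(\beta), \] \[ D^{l}(\beta)\mathrm{e}^{-D_1\beta y} \le \pi(Q_2(\infty) > y) \le D^{u}(\beta)\mathrm{e}^{-D_2\beta y}\quad\text{for all } y \ge D_R(\beta). \]
   Context: Fix $\beta>0$. For an initial state $(x,y)$ with $x\le 0$, $y\ge 0$, let $(Q_1,Q_2)$ be the continuous process on $[0,\infty)$ solving \[ Q_1(t) = x + \sqrt{2}W(t) - \beta t + \int_0^t(-Q_1(s)+Q_2(s))\,ds - L(t),\qquad Q_2(t) = y + L(t) - \int_0^t Q_2(s)\,ds, \] where $W$ is a standard Brownian motion and $L$ is the unique nondecreasing nonnegative càdlàg process with $L(0)=0$ such that $Q_1(t)\le 0$ for all $t$ and $\int_0^\infty \mathbf{1}_{[Q_1(t)<0]}\,dL(t)=0$. This is a Markov process which is ergodic with a unique stationary distribution $\pi$ on $(-\infty,0]\times(0,\infty)$; $(Q_1(\infty),Q_2(\infty))$ denotes a random vector with law $\pi$. *)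

(* Defs.v *)
From HB Require Import structures.
From mathcomp Require Import all_boot all_order all_algebra.
From mathcomp Require Import all_classical all_reals all_analysis.
Set Implicit Arguments. Unset Strict Implicit. Unset Printing Implicit Defensive.
Import Order.TTheory GRing.Theory Num.Theory.
Import numFieldNormedType.Exports.
Local Open Scope classical_set_scope.
Local Open Scope ring_scope.

(* Pathwise solution (Q1,Q2,L) on [0,oo) of the reflected system driven by the
   continuous path w, with initial state (x,y) and drift parameter beta:
   Q1(t) = x + sqrt 2 w(t) - beta t + int_0^t (-Q1 + Q2) ds - L(t),
   Q2(t) = y + L(t) - int_0^t Q2 ds,
   L(0) = 0, L nondecreasing, nonnegative, cadlag (right-continuous; left
   limits are automatic for nondecreasing functions), Q1 <= 0, and
   int 1_[Q1 < 0] dL = 0, written out as: L is constant on every compact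
   interval [s,t] of [0,oo) on which Q1 < 0. *)
Definition reflected_sol (R : realType) (beta x y : R) (w q1 q2 L : R -> R)
  : Prop :=
  (forall t, 0 <= t ->
        q1 t = x + Num.sqrt 2 * w t - beta * t
               + Rintegral lebesgue_measure `[0, t] (fun s => - q1 s + q2 s)
               - L t) /\
      (forall t, 0 <= t ->
        q2 t = y + L t - Rintegral lebesgue_measure `[0, t] q2) /\
      {within `[0, +oo[, continuous q1} /\
      {within `[0, +oo[, continuous q2} /\
      L 0 = 0 /\
      (forall s t, 0 <= s -> s <= t -> L s <= L t) /\
      (forall t, 0 <= t -> 0 <= L t) /\
      (forall t, 0 <= t -> L u @[u --> t^'+] --> L t) /\
      (forall t, 0 <= t -> q1 t <= 0) /\
      forall s t, 0 <= s -> s <= t ->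
        (forall u, s <= u -> u <= t -> q1 u < 0) -> L s = L t.

(* Standard Brownian motion on [0,oo): W 0 = 0, continuous paths, and
   independent Gaussian increments: for 0 <= s_0 < s_1 < ... < s_n the
   increments W(s_{i+1}) - W(s_i) are independent N(0, s_{i+1} - s_i)
   (normal_prob m sigma has standard deviation sigma). *)
Definition brownian_motion (d : measure_display) (Omega : measurableType d)
  (R : realType) (P : probability Omega R) (W : R -> Omega -> R) : Prop :=
  [/\ forall t, measurable_fun setT (W t),
      forall w, W 0 w = 0,
      forall w, {within `[0, +oo[, continuous (fun t => W t w)} &
      forall (n : nat) (s : nat -> R) (B : nat -> set R),
        0 <= s 0%N -> (forall i, s i < s i.+1) -> (forall i, measurable (B i)) ->
        P (\bigcap_(i in `I_n) [set w | B i (W (s i.+1) w - W (s i) w)])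
        = (\prod_(i < n) normal_prob 0 (Num.sqrt (s i.+1 - s i)) (B i))%E].

(* Independence of the initial state (X,Y) from the process W (product rule on
   the generating pi-system of sigma(W)). *)
Definition indep_init (d : measure_display) (Omega : measurableType d)
  (R : realType) (P : probability Omega R) (X Y : Omega -> R)
  (W : R -> Omega -> R) : Prop :=
  forall (n : nat) (s : nat -> R) (B : nat -> set R) (A : set (R * R)%type),
    measurable A -> (forall i, measurable (B i)) -> (forall i, 0 <= s i) ->
    P ([set w | A (X w, Y w)] `&` \bigcap_(i in `I_n) [set w | B i (W (s i) w)])
    = (P [set w | A (X w, Y w)] * P (\bigcap_(i in `I_n) [set w | B i (W (s i) w)]))%E.

Definition stationary_dist (R : realType) (beta : R)
  (pi : probability (R * R)%type R) : Prop :=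
  pi [set p | p.1 <= 0 /\ 0 < p.2] = 1%E /\
  forall (d : measure_display) (Omega : measurableType d)
    (P : probability Omega R) (W : R -> Omega -> R) (X Y : Omega -> R)
    (Q1 Q2 L : R -> Omega -> R),
    brownian_motion P W ->
    measurable_fun setT X -> measurable_fun setT Y ->
    (forall A : set (R * R)%type, measurable A ->
       P [set w | A (X w, Y w)] = pi A) ->
    indep_init P X Y W ->
    (forall w, reflected_sol beta (X w) (Y w) (fun t => W t w)
                 (fun t => Q1 t w) (fun t => Q2 t w) (fun t => L t w)) ->
    forall t, 0 <= t -> forall A : set (R * R)%type, measurable A ->
      P [set w | A (Q1 t w, Q2 t w)] = pi A.

(* Main.v *)
(* Stationarity may be tested with any Brownian motion, so one
   constructs a Brownian motion W on [0, 1[ (Levy's midpoint displacement from an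
   i.i.d. Gaussian sequence read off the binary digits of a uniform variable)
   which comes with events A_h, P(not A_h) <= 4 exp(- h^2 / 4), on which W has the
   modulus of continuity 7 (h + 8) (3/4)^n at scale 2^-n over [0, 1]; Brownian
   scaling transports this to any time horizon.  The reflected system is solved
   path by path (Picard iteration), and the solution started from pi on a
   product space has law pi at every time.  That the law at time t is that of a
   measurable map is free: the hypothesis also applies to a probability altered
   arbitrarily on non-measurable sets.

   With u = - Q1, z = Q2, the four bounds follow from pathwise estimates.
   - u(1) <= u(0) / 2 + beta + osc(W), hence F(x) <= F(3x/2) + 4 exp(- (x/160)^2)
     for the tail F of u, which is iterated.
   - Q1(t) <= z(0) + sqrt 2 W(t) + t sqrt 2 osc(W) for small t, and a Gaussian
     lower tail for W(t).
   - z(T) >= z(0) - u(0) + sqrt 2 W(T) - beta T with T = y / beta.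
   - z(T) <= max(z(0) - beta T, N) + (error), so that for theta = beta / 60^2 and
     T large X = exp(theta Q2) satisfies E min(X, M) <= E min(X / 2, M) + C for
     every M, whence pi(X > a) <= 2 C / a. *)
Require Import Defs.
From HB Require Import structures.
From mathcomp Require Import all_boot all_order all_algebra.
From mathcomp Require Import all_classical all_reals all_analysis.
From mathcomp Require Import measurable_realfun.
From mathcomp Require Import ring lra zify.
Set Implicit Arguments. Unset Strict Implicit. Unset Printing Implicit Defensive.
Import Order.TTheory GRing.Theory Num.Theory.
Import numFieldNormedType.Exports.
Local Open Scope classical_set_scope.
Local Open Scope ring_scope.

(** Of [pi] one knows only its support and its invariance: no moment is finite a priori. Each tail
    bound is therefore a comparison of [pi] with itself across one fixed time, through a pathwise
    inequality between the two end states on an event of the driver whose probability is controlled.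
    For [Q2] the exponential is truncated at [M] because a contraction of its mean says nothing when
    that mean is infinite; after truncation the two means are finite and can be subtracted.

    Bounding the oscillation of the driver on the whole horizon would not control [Q2] from above:
    once [Q1] has reached 0, the integral of [- Q1] must stay small up to the end. It does, because
    a large [Q2] pushes [Q1] back to 0 faster than the noise takes it away, and this compares the
    noise with a linear drift over short time gaps as well as long ones. Hence a driver with an
    explicit modulus of continuity at arbitrarily fine dyadic scales.

    Independence of the Gaussian sums and of the midpoint refinements rests on rotation invariance
    of the planar Gaussian law. *)

(** * Affine substitution and rotation of Gaussian integrals *)

Definition image_measure (d d' : measure_display) (T : measurableType d)
  (T' : measurableType d') (R : realFieldType)
  (m : {measure set T -> \bar R}) (f : T -> T') (mf : measurable_fun setT f)
  : {measure set T' -> \bar R} :=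
  measure_function_pushforward__canonical__measure_function_Measure m mf.

(** The density and the Radon-Nikodym derivative have the same integral over every measurable set,
    so they agree almost everywhere; the change of variables for the derivative then applies to the
    density. *)
Lemma integral_normal_prob (R : realType) (s : R) (f : R -> \bar R) :
  (normal_prob 0 s).-integrable setT f ->
  (\int[normal_prob 0 s]_x f x =
   \int[lebesgue_measure]_x (f x * (normal_pdf 0 s x)%:E))%E.
Proof.
move=> intf; have dom := normal_prob_dominates 0 s.
have mf : measurable_fun setT f by exact: measurable_int intf.
have mp : measurable_fun setT (fun x => (normal_pdf 0 s x)%:E).
  by apply/measurable_EFinP; exact: measurable_normal_pdf.
pose nu := charge_of_finite_measure (normal_prob 0 s).
have dom' : nu `<< @lebesgue_measure R by [].
have iRN := Radon_Nikodym_integrable dom'.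
have mRN := measurable_int _ iRN.
rewrite -(Radon_Nikodym_change_of_variables dom measurableT intf).
apply: ae_eq_integral => //; [exact: emeasurable_funM|exact: emeasurable_funM|].
apply: ae_eqe_mul2l; apply: integral_ae_eq => // A _ mA.
by rewrite -(Radon_Nikodym_integral dom' mA).
Qed.

Section affine_substitution.
Context (R : realType).
Notation mu := (@lebesgue_measure R).
Local Open Scope ereal_scope.

(** The measure [c] times the pushforward of [mu] by the affine map gives each half-open interval
    its length, so it is [mu] by uniqueness. *)
Lemma lebesgue_measure_affine (c b : R) (A : set R) : (0 < c)%R ->
  measurable A -> mu ((fun x => c * x + b)%R @^-1` A) = (c^-1)%:E * mu A.
Proof.
move=> c0 mA.
have mphi : @measurable_fun _ _ (measurableTypeR R) (measurableTypeR R) setT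
      (fun x : R => (c * x + b)%R).
  by apply: measurable_funD => //; exact: measurable_funM.
pose nu := mscale (NngNum (ltW c0)) (image_measure mu mphi).
have nuE B : nu B = c%:E * mu ((fun x => c * x + b)%R @^-1` B) by [].
have E : forall B, measurable B -> mu B = nu B.
  apply: lebesgue_measure_unique => _ [[x y]] _ <-.
  rewrite [RHS](nuE _).
  rewrite (_ : (fun x : R => c * x + b)%R @^-1` _ =
      `](c^-1 * (x - b))%R, (c^-1 * (y - b))%R]%classic); last first.
    apply/seteqP; split => u /=; rewrite !in_itv/=.
      move=> /andP[h1 h2]; apply/andP; split.
        by rewrite ltr_pdivrMl// ltrBlDr.
      by rewrite ler_pdivlMl// lerBrDr.
    move=> /andP[h1 h2]; apply/andP; split.
      by move: h1; rewrite ltr_pdivrMl// ltrBlDr.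
    by move: h2; rewrite ler_pdivlMl// lerBrDr.
  rewrite !lebesgue_measure_itv/= !lte_fin ltr_pM2l ?invr_gt0// ltrD2r.
  case: ifPn => [xy|]; last by rewrite mule0.
  by rewrite -!EFinD -EFinM; congr EFin; field; rewrite gt_eqF.
rewrite (E A)// nuE muleA -EFinM.
by rewrite mulVf ?gt_eqF// mul1e.
Qed.

Lemma ge0_integral_affine (c b : R) (f : R -> \bar R) : (0 < c)%R ->
  measurable_fun setT f -> (forall x, 0 <= f x) ->
  \int[mu]_x f x = c%:E * \int[mu]_x f (c * x + b)%R.
Proof.
move=> c0 mf f0.
have mphi : @measurable_fun _ _ (measurableTypeR R) (measurableTypeR R) setT
      (fun x : R => (c * x + b)%R).
  by apply: measurable_funD => //; exact: measurable_funM.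
pose nu := mscale (NngNum (ltW c0)) (image_measure mu mphi).
have nuE B : nu B = c%:E * mu ((fun x => c * x + b)%R @^-1` B) by [].
have E : forall B, measurable B -> mu B = nu B.
  move=> B mB; rewrite nuE.
  by rewrite lebesgue_measure_affine// muleA -EFinM mulfV ?gt_eqF// mul1e.
transitivity (\int[nu]_x f x).
  by apply: eq_measure_integral => A mA _; exact: E.
rewrite ge0_integral_mscale//=; congr (_ * _).
by rewrite ge0_integral_pushforward.
Qed.

End affine_substitution.

Section gaussian_rotation.
Context (R : realType).
Notation mu := (@lebesgue_measure R).
Notation N01 := (@normal_prob R 0 1).
Notation g := (@normal_pdf R 0 1).
Local Open Scope ereal_scope.

Lemma normal_pdf01E (x : R) : g x = (g 0 * expR (- (x ^+ 2 / 2)))%R.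
Proof.
rewrite normal_pdfE ?oner_eq0// /normal_fun !subr0 !expr1n expr0n/= oppr0 mul0r.
by rewrite expR0 mulr1 mulNr.
Qed.

Lemma normal_prob01E (A : set R) : measurable A ->
  N01 A = \int[mu]_x (\1_A x * g x)%:E.
Proof.
move=> mA; rewrite /normal_prob integral_mkcond; apply: eq_integral => x _.
by rewrite patchE indicE; case: ifP; rewrite ?mul1r ?mul0r.
Qed.

Lemma normal_prob01_prodE (C : set (R * R)) : measurable C ->
  (N01 \x N01) C = \int[mu]_x \int[mu]_y (\1_C (x, y) * g x * g y)%:E.
Proof.
move=> mC; rewrite /product_measure1/= integral_normal_prob; last first.
  apply/integrableP; split; first exact: measurable_fun_xsection.
  apply: (@le_lt_trans _ _ (\int[N01]_x (cst 1%E) x)).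
    apply: ge0_le_integral => //=.
    + by apply: measurableT_comp => //; exact: measurable_fun_xsection.
    + move=> x _; rewrite gee0_abs//.
      exact/probability_le1/measurable_xsection.
  by rewrite integral_cst// mul1e (le_lt_trans (probability_le1 _ _))// ltry.
apply: eq_integral => x _ /=.
rewrite normal_prob01E; last exact: measurable_xsection.
have mX : measurable_fun setT (fun y => (\1_(xsection C x) y * g y)%:E).
  apply/measurable_EFinP/measurable_funM; last exact: measurable_normal_pdf.
  exact/measurable_indic/measurable_xsection.
have X0 y : setT y -> 0 <= (\1_(xsection C x) y * g y)%:E.
  by move=> _; rewrite lee_fin mulr_ge0// normal_pdf_ge0.
have gx0 : 0 <= (g x)%:E by rewrite lee_fin normal_pdf_ge0.
rewrite -[LHS](ge0_integralZr mu measurableT mX X0 gx0).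
apply: eq_integral => y _; rewrite -EFinM; congr EFin.
rewrite mulrAC; congr (_ * _ * _)%R; rewrite !indicE; congr (_%:R).
by congr nat_of_bool; apply/idP/idP; rewrite !inE /xsection/= inE.
Qed.

(* Each of the two coordinates is changed by an affine substitution of one
   variable, with a Tonelli exchange in between. *)
Lemma normal_prob01_rotation (c s : R) (A B : set R) :
  (0 < c)%R -> (c ^+ 2 + s ^+ 2 = 1)%R -> measurable A -> measurable B ->
  (N01 \x N01) [set p | A (c * p.1 + s * p.2)%R /\ B (c * p.2 - s * p.1)%R] =
  N01 A * N01 B.
Proof.
move=> c0 cs mA mB.
have m1 : measurable_fun setT (fun p : R * R => c * p.1 + s * p.2)%R.
  by apply: measurable_funD; apply: measurable_funM.
have m2 : measurable_fun setT (fun p : R * R => c * p.2 - s * p.1)%R.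
  by apply: measurable_funB; apply: measurable_funM.
set C := [set p | _].
have mC : measurable C.
  have -> : C = (fun p : R * R => c * p.1 + s * p.2)%R @^-1` A `&`
                (fun p : R * R => c * p.2 - s * p.1)%R @^-1` B by [].
  by apply: measurableI; rewrite -[X in measurable X]setTI; [exact: m1|exact: m2].
have mAB : measurable (A `*` B) by exact: measurableX.
have mg (h : R * R -> R) : measurable_fun setT h ->
    measurable_fun setT (fun p => g (h p)).
  by move=> mh; apply: measurableT_comp => //; exact: measurable_normal_pdf.
have mI (D : set (R * R)) (h : R * R -> R * R) : measurable D ->
    measurable_fun setT h -> measurable_fun setT (fun p => \1_D (h p) : R).
  by move=> mD mh; apply: measurableT_comp => //; exact: measurable_indic.
transitivity ((N01 \x N01) (A `*` B)); last by exact: (product_measure1E N01 N01 mA mB).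
rewrite [LHS](normal_prob01_prodE mC) [RHS](normal_prob01_prodE mAB).
pose F1 (p : R * R) : \bar R := (\1_C p * g p.1 * g p.2)%:E.
have F1m : measurable_fun setT F1.
  apply/measurable_EFinP/measurable_funM; [apply: measurable_funM|exact: mg].
    exact: mI.
  exact: mg.
have F10 p : 0 <= F1 p by rewrite lee_fin !mulr_ge0// normal_pdf_ge0.
rewrite (@fubini_tonelli _ _ _ _ R mu mu F1 F1m F10).
(* For fixed [y] the new variable is [a = c x + s y]; the other rotated coordinate becomes
   [(y - s a) / c]. *)
under eq_integral => y _.
  rewrite (@ge0_integral_affine R c^-1 (- (s * y / c))%R); last 3 first.
  - by rewrite invr_gt0.
  - exact: measurableT_comp.
  - by move=> x; exact: F10.
  over.
pose F2 (p : R * R) : \bar R :=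
  (\1_(A `*` B) (p.1, (p.2 - s * p.1) / c) * (c^-1 *
   (g (c^-1 * p.1 - s * p.2 / c) * g p.2)))%:E%R.
have F2m : measurable_fun setT F2.
  apply/measurable_EFinP/measurable_funM.
    apply: mI => //; apply: measurable_fun_pair => //.
    by apply: measurable_funM => //; apply: measurable_funB => //; exact: measurable_funM.
  apply: measurable_funM => //; apply: measurable_funM; last exact: mg.
  apply: mg; apply: measurable_funB; first exact: measurable_funM.
  by apply: measurable_funM => //; exact: measurable_funM.
have F20 p : 0 <= F2 p.
  by rewrite lee_fin !mulr_ge0// ?normal_pdf_ge0// invr_ge0 ltW.
transitivity (\int[mu]_y \int[mu]_a F2 (a, y)).
  apply: eq_integral => y _; rewrite -ge0_integralZl//; last 2 first.
  - apply: (measurableT_comp F1m).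
    by apply: measurable_fun_pair => //; apply: measurable_funD => //; exact: measurable_funM.
  - by rewrite lee_fin invr_ge0 ltW.
  apply: eq_integral => a _; rewrite /F1 /F2 /= -EFinM; congr EFin.
  rewrite -mulrA mulrCA; congr (_ * _)%R; rewrite !indicE; congr (_%:R).
  have e1 : (c * (c^-1 * a - s * y / c) + s * y = a)%R by field; rewrite gt_eqF.
  have e2 : (c * y - s * (c^-1 * a - s * y / c) = (y - s * a) / c)%R.
    transitivity (((c ^+ 2 + s ^+ 2) * y - s * a) / c)%R; first by field; rewrite gt_eqF.
    by rewrite cs mul1r.
  by congr nat_of_bool; apply/idP/idP; rewrite !inE /C /= e1 e2.
rewrite -(@fubini_tonelli _ _ _ _ R mu mu F2 F2m F20).
apply: eq_integral => a _.
(* Now [y = c b + s a], so that [(y - s a) / c = b]. The factor [c] cancels the earlier [c^-1], and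
   the exponents agree by [c^2 + s^2 = 1]. *)
rewrite [LHS](@ge0_integral_affine R c (s * a)%R)//; last exact: measurableT_comp.
rewrite -ge0_integralZl//; last 2 first.
- apply: (measurableT_comp F2m); apply: measurable_fun_pair => //.
  by apply: measurable_funD => //; exact: measurable_funM.
- by rewrite lee_fin ltW.
apply: eq_integral => b _; rewrite /F2 /= -EFinM; congr EFin.
have -> : ((c * b + s * a - s * a) / c = b)%R by rewrite addrK mulrC mulKf// gt_eqF.
rewrite [LHS]mulrCA -[RHS]mulrA; congr (_ * _)%R; rewrite mulrA mulfV ?gt_eqF// mul1r.
have s2 : (s ^+ 2 = 1 - c ^+ 2)%R by rewrite -cs; ring.
have -> : (c^-1 * a - s * (c * b + s * a) / c = c * a - s * b)%R.
  transitivity ((a * (1 - s ^+ 2)) / c - s * b)%R; first by field; rewrite gt_eqF.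
  by rewrite s2; field; rewrite gt_eqF.
rewrite !(normal_pdf01E (_ + _)) (normal_pdf01E a) (normal_pdf01E b).
rewrite mulrACA [RHS]mulrACA -!expRD; congr (_ * expR _)%R.
transitivity (- ((c ^+ 2 + s ^+ 2) * (a ^+ 2 + b ^+ 2) / 2))%R; first by field.
by rewrite cs; field.
Qed.

End gaussian_rotation.

(** * Independent standard normal families and their rotations *)

Lemma prob_setI_full (R : realType) (d : measure_display) (T : measurableType d)
    (P : probability T R) (E D : set T) : measurable E -> measurable D ->
  P D = 1%E -> P (E `&` D) = P E.
Proof.
move=> mE mD PD; apply/eqP; rewrite eq_le; apply/andP; split.
  by apply: le_measure; rewrite ?inE//; exact: measurableI.
have ED : P (E `\` D) = 0%E.
  apply/eqP; rewrite eq_le; apply/andP; split; last exact: measure_ge0.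
  apply: (@le_trans _ _ (P (~` D))).
    by apply: le_measure; rewrite ?inE; [exact: measurableD|exact: measurableC|move=> w []].
  by rewrite probability_setC// PD subee.
rewrite -[leRHS]adde0 -ED -{1}(setUIDK E D); apply: measureU2.
  exact: measurableI.
exact: measurableD.
Qed.

Lemma measure_prod_ext (d1 d2 : measure_display) (T1 : measurableType d1)
    (T2 : measurableType d2) (R : realType)
    (m1 m2 : {measure set (T1 * T2) -> \bar R}) :
  (m1 setT < +oo)%E ->
  (forall A B, measurable A -> measurable B -> m1 (A `*` B) = m2 (A `*` B)) ->
  forall C, measurable C -> m1 C = m2 C.
Proof.
move=> m1oo m12 C mC.
pose G : set (set (T1 * T2)) :=
  [set C | exists A, measurable A /\ exists B, measurable B /\ C = A `*` B].
apply: (measure_unique G (fun=> setT)) => //.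
- rewrite measurable_prod_measurableType //; congr (<<s _ >>).
  rewrite predeqE; split => [[A mA [B mB <-]]|[A [mA [B [mB ->]]]]].
    by exists A; split => //; exists B.
  by exists A => //; exists B.
- move=> /= _ _ [X1 [mX1 [X2 [mX2 ->]]]] [Y1 [mY1 [Y2 [mY2 ->]]]].
  rewrite -setXI; exists (X1 `&` Y1); split; first exact: measurableI.
  by exists (X2 `&` Y2); split => //; exact: measurableI.
- by move=> _; exists setT; split => //; exists setT; split => //; rewrite setXTT.
- by rewrite bigcup_const.
- by move=> A [A1 [mA1 [A2 [mA2 ->]]]]; exact: m12.
Qed.

Lemma big_subseq (R : Type) (idx : R) (op : Monoid.com_law idx) (I : eqType)
    (s t : seq I) (F : I -> R) : uniq s -> uniq t -> {subset s <= t} ->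
  \big[op/idx]_(i <- s) F i =
  \big[op/idx]_(i <- t) (if i \in s then F i else idx).
Proof.
move=> us ut st; rewrite -big_mkcond -[RHS]big_filter; apply: perm_big.
apply: uniq_perm => //; first exact: filter_uniq.
by move=> i; rewrite mem_filter; case: (boolP (i \in s)) => //= /st ->.
Qed.

Section iid_normal.
Context (R : realType) (d : measure_display) (T : measurableType d)
  (P : probability T R).
Notation N01 := (@normal_prob R 0 1).
Local Open Scope ereal_scope.

(** Indices range over an arbitrary type, so that families over [nat], [nat * nat] and ['I_m] are
    treated alike. The product rule is asked of duplicate-free sequences, since a repeated index
    would break it. *)
Definition iid_normal (I : eqType) (X : I -> T -> R) : Prop :=
  (forall i, measurable_fun setT (X i)) /\
  forall s : seq I, uniq s -> forall B : I -> set R, (forall i, measurable (B i)) ->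
    P (\big[setI/setT]_(i <- s) (X i @^-1` B i)) = \prod_(i <- s) N01 (B i).

Lemma measurable_cylinder (I : eqType) (X : I -> T -> R) (B : I -> set R)
    (s : seq I) :
  (forall i, measurable_fun setT (X i)) -> (forall i, measurable (B i)) ->
  measurable (\big[setI/setT]_(i <- s) (X i @^-1` B i)).
Proof.
move=> mX mB; apply: bigsetI_measurable => i _.
by rewrite -[X in measurable X]setTI; exact: mX.
Qed.

Lemma iid_normal_reindex (I : eqType) (J : choiceType) (f : J -> I) (X : I -> T -> R) :
  injective f -> iid_normal X -> iid_normal (X \o f).
Proof.
move=> injf [mX iX]; split=> [j|s us B mB]; first exact: mX.
(* The left inverse [g] of [f] needs a default value; without one, [J] is empty and so is [s]. *)
case: (pselect (inhabited J)) => [[j0]|nJ]; last first.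
  have -> : s = [::] by case: s us => // j ? _; exfalso; apply: nJ; exists.
  by have := iX [::] isT (fun=> setT) (fun=> measurableT); rewrite !big_nil.
pose g (i : I) := xget j0 [set j | f j = i].
have gf j : g (f j) = j.
  by rewrite /g; case: xgetP => [y _ /injf|/(_ j)] //; case.
have := iX (map f s); rewrite map_inj_uniq// => /(_ us (B \o g) (fun i => mB (g i))).
rewrite !big_map => h.
transitivity (P (\big[setI/setT]_(j <- s) (X (f j) @^-1` (B \o g) (f j)))).
  by congr (P _); apply: eq_bigr => j _; rewrite /= gf.
by rewrite h; apply: eq_bigr => j _; rewrite /= gf.
Qed.

(* A finite independence statement may always be enlarged to involve two
   prescribed indices, by adding the trivial constraint [setT]. *)
Lemma iid_normal_with2 (I : eqType) (X : I -> T -> R) (a b : I) : a != b ->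
  (forall i, measurable_fun setT (X i)) ->
  (forall (s : seq I) (B : I -> set R), uniq [:: a, b & s] ->
     (forall i, measurable (B i)) ->
     P (\big[setI/setT]_(i <- [:: a, b & s]) (X i @^-1` B i)) =
     \prod_(i <- [:: a, b & s]) N01 (B i)) ->
  iid_normal X.
Proof.
move=> ab mX H; split=> // s us B mB.
pose s0 := [seq i <- s | (i != a) && (i != b)].
pose t := [:: a, b & s0].
have ut : uniq t.
  rewrite /t /= !inE negb_or ab filter_uniq//= !mem_filter eqxx/= andbT.
  by rewrite eqxx/= andbF.
have st : {subset s <= t}.
  move=> i si; rewrite /t !inE mem_filter si andbT.
  by case: (i == a); case: (i == b).
pose B' i := if i \in s then B i else setT.
have mB' i : measurable (B' i) by rewrite /B'; case: ifP.
have := H s0 B' ut mB'; rewrite -/t => h.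
rewrite (big_subseq _ _ us ut st) [RHS](big_subseq _ _ us ut st).
transitivity (P (\big[setI/setT]_(i <- t) (X i @^-1` B' i))).
  by congr (P _); apply: eq_bigr => i _; rewrite /B'; case: ifP.
rewrite h; apply: eq_bigr => i _; rewrite /B'; case: ifP => // _.
by rewrite probability_setT.
Qed.

(** Once the event [E] on the other indices is frozen, both sides are finite measures in [C] that
    agree on rectangles. General planar sets are needed because a rotation does not map rectangles
    to rectangles. *)
Lemma iid_normal_pair (I : eqType) (X : I -> T -> R) (a b : I) (s : seq I)
    (B : I -> set R) (C : set (R * R)) :
  iid_normal X -> uniq [:: a, b & s] -> (forall i, measurable (B i)) ->
  measurable C ->
  P ([set w | C (X a w, X b w)] `&` \big[setI/setT]_(i <- s) (X i @^-1` B i)) =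
  (N01 \x N01) C * \prod_(i <- s) N01 (B i).
Proof.
move=> [mX iX] us mB mC.
set E := \big[setI/setT]_(i <- s) _.
have mE : measurable E by exact: measurable_cylinder.
have us' : uniq s by move: us => /= /and3P[].
have PE : P E = \prod_(i <- s) N01 (B i) by exact: iX.
have mXX : @measurable_fun _ _ T (measurableTypeR R * measurableTypeR R)%type
    setT (fun w => (X a w, X b w)).
  by apply: measurable_fun_pair; exact: mX.
pose m1 := image_measure (mrestr P mE) mXX.
have PE0 : (0 <= fine (P E))%R by rewrite fine_ge0.
pose m2 : {measure set (measurableTypeR R * measurableTypeR R) -> \bar R} :=
   mscale (NngNum PE0) (N01 \x N01).
have m1E D : m1 D = P ([set w | D (X a w, X b w)] `&` E) by [].
have m2E D : m2 D = P E * (N01 \x N01) D.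
  by rewrite -[P E]fineK// fin_num_measure.
have -> : P ([set w | C (X a w, X b w)] `&` E) = m2 C.
  rewrite -m1E; apply: (@measure_prod_ext _ _ _ _ _ m1 m2) => //.
    rewrite m1E (_ : _ `&` E = E); last by apply/seteqP; split => w // [].
    exact: le_lt_trans (probability_le1 P mE) (ltry _).
  move=> A A' mA mA'; rewrite [LHS]m1E [RHS]m2E product_measure1E//.
  pose B' i := if i == a then A else if i == b then A' else B i.
  have mB' i : measurable (B' i).
    rewrite /B'; case: ifP => _; first exact: mA.
    by case: ifP => _; [exact: mA'|exact: mB].
  have := iX [:: a, b & s] us B' mB'.
  rewrite !big_cons /B' eqxx.
  have ba : (b == a) = false.
    by move: us; rewrite /= inE negb_or eq_sym => /andP[/andP[/negbTE]].
  have sa i : i \in s -> (i == a) = false /\ (i == b) = false.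
    move=> si; move: us => /= /and3P[]; rewrite inE negb_or => /andP[_ as_] bs _.
    by split; apply/negbTE; [apply: contraNneq as_ => <-|apply: contraNneq bs => <-].
  rewrite ba eqxx.
  have -> : \big[setI/setT]_(j <- s) (X j @^-1` (if j == a then A else if j == b then A' else B j)) = E.
    by apply: eq_big_seq => i /sa[-> ->].
  have -> : \prod_(j <- s) N01 (if j == a then A else if j == b then A' else B j) = P E.
    by rewrite PE; apply: eq_big_seq => i /sa[-> ->].
  by rewrite setIA muleA muleC => <-.
by rewrite m2E PE muleC.
Qed.

Definition rotate_pair (I : eqType) (c s : R) (a b : I) (X : I -> T -> R) :
    I -> T -> R := fun i w =>
  if i == a then (c * X a w + s * X b w)%R
  else if i == b then (c * X b w - s * X a w)%R else X i w.

(** Normalized sums of variables and the midpoint refinement are both obtained below by iterating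
    such rotations, which replaces any convolution of densities. *)
Lemma iid_normal_rotate_pair (I : eqType) (c s : R) (a b : I) (X : I -> T -> R) :
  (0 < c)%R -> (c ^+ 2 + s ^+ 2 = 1)%R -> a != b -> iid_normal X ->
  iid_normal (rotate_pair c s a b X).
Proof.
move=> c0 cs ab iidX; have [mX _] := iidX.
apply: (iid_normal_with2 ab) => [i|t B ut mB].
  rewrite /rotate_pair; case: (i == a).
    by apply: measurable_funD; apply: measurable_funM.
  by case: (i == b) => //; apply: measurable_funB; apply: measurable_funM.
have ba : (b == a) = false by rewrite eq_sym; exact/negbTE.
have ta i : i \in t -> (i == a) = false /\ (i == b) = false.
  move=> si; move: ut => /= /and3P[]; rewrite inE negb_or => /andP[_ as_] bs _.
  by split; apply/negbTE; [apply: contraNneq as_ => <-|apply: contraNneq bs => <-].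
rewrite !big_cons.
pose C := [set p : R * R | B a (c * p.1 + s * p.2)%R /\ B b (c * p.2 - s * p.1)%R].
have mC : measurable C.
  have m1 : measurable_fun setT (fun p : R * R => c * p.1 + s * p.2)%R.
    by apply: measurable_funD; apply: measurable_funM.
  have m2 : measurable_fun setT (fun p : R * R => c * p.2 - s * p.1)%R.
    by apply: measurable_funB; apply: measurable_funM.
  have -> : C = (fun p : R * R => c * p.1 + s * p.2)%R @^-1` B a `&`
                (fun p : R * R => c * p.2 - s * p.1)%R @^-1` B b by [].
  by apply: measurableI; rewrite -[X in measurable X]setTI; [exact: m1|exact: m2].
have -> : \big[setI/setT]_(j <- t) (rotate_pair c s a b X j @^-1` B j) =
    \big[setI/setT]_(j <- t) (X j @^-1` B j).
  by apply: eq_big_seq => i /ta[h1 h2]; apply/funext => w; rewrite /preimage/= /rotate_pair h1 h2.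
rewrite setIA muleA -(normal_prob01_rotation c0 cs)// -/C -(iid_normal_pair iidX ut)//.
congr (P (_ `&` _)); apply/seteqP; split => w /=;
  by rewrite /rotate_pair /preimage /= eqxx ba eqxx.
Qed.

End iid_normal.

(** * Reduction to open rays, and splitting the digits of a uniform variable *)

Section rays.
Context (R : realType).

Lemma measurable_fun_rays (d : measure_display) (T : measurableType d)
    (f : T -> R) :
  (forall a, measurable [set w | a < f w]) -> measurable_fun setT f.
Proof.
move=> h; apply: (measurability _ (RGenOInfty.measurableE R)).
move=> _ [_ [a ->] <-]; rewrite setTI.
rewrite (_ : _ @^-1` _ = [set w | a < f w])//.
by apply/seteqP; split => w; rewrite /preimage/= in_itv/= andbT.
Qed.

Lemma finite_measure_ext_rays (m1 m2 : {measure set (measurableTypeR R) -> \bar R}) :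
  (m1 setT < +oo)%E ->
  (forall a : R, m1 [set x | a < x] = m2 [set x | a < x]) ->
  forall A, measurable A -> m1 A = m2 A.
Proof.
move=> m1oo m12 A mA.
have rayE (a : R) : `]a, +oo[%classic = [set x | a < x].
  by apply/seteqP; split => w; rewrite /= in_itv/= andbT.
apply: (@measure_unique _ R (measurableTypeR R) (@RGenOInfty.G R)
  (fun k => `](- k%:R), +oo[%classic)) => //.
- exact: RGenOInfty.measurableE.
- move=> _ _ [a ->] [b ->]; exists (Num.max a b); rewrite !rayE.
  by apply/seteqP; split => w /=; rewrite gt_max => /andP.
- by move=> k; eexists.
- apply/seteqP; split => // x _; exists (Num.bound `|x|) => //=.
  rewrite in_itv/= andbT; have := archi_boundP (normr_ge0 x).
  by have := ler_norm (- x); rewrite normrN; lra.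
- by move=> _ [a ->]; rewrite rayE.
- by move=> k; apply: le_lt_trans m1oo; apply: le_measure; rewrite ?inE.
Qed.

Lemma measurable_ray (a : R) : measurable [set x : R | a < x].
Proof.
rewrite (_ : [set x | _] = `]a, +oo[%classic)//.
by apply/seteqP; split => w; rewrite /= in_itv/= andbT.
Qed.

End rays.

Section uniform_split.
Context (R : realType).
Notation mu := (@lebesgue_measure R).
Local Open Scope ereal_scope.

Definition unif01 : set (measurableTypeR R) -> \bar R :=
  mrestr mu (measurable_itv `[0%R, 1%R[ : measurable (`[0%R, 1%R[%classic : set (measurableTypeR R))).
HB.instance Definition _ := Measure.on unif01.

Lemma unif01E A : unif01 A = mu (A `&` `[0%R, 1%R[). Proof. by []. Qed.

Let unif01_setT : unif01 setT = 1.
Proof. by rewrite unif01E setTI lebesgue_measure_itv/= lte01 sube0. Qed.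
HB.instance Definition _ := @Measure_isProbability.Build _ _ R unif01 unif01_setT.

(** The leading binary digit of a point of [[0, 1[]; [doubling] is the shift that removes it. *)
Definition bit (w : R) : R := if (w < 2^-1)%R then 0%R else 1%R.
Definition doubling (w : R) : R := (2 * w - bit w)%R.

Lemma measurable_bit : measurable_fun setT bit.
Proof.
rewrite (_ : bit = \1_(`[2^-1%R, +oo[%classic)); last first.
  apply/funext => w; rewrite /bit indicE; case: ltP => h.
    by rewrite memNset//= in_itv/= andbT; apply/negP; rewrite -ltNge.
  by rewrite mem_set//= in_itv/= andbT.
exact: measurable_indic.
Qed.

Lemma measurable_doubling : measurable_fun setT doubling.
Proof.
by apply: measurable_funB; [exact: measurable_funM|exact: measurable_bit].
Qed.

(** On each half of the interval [doubling] is affine of slope 2, so the leading digit is fair and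
    independent of the shifted point. *)
Lemma unif01_half (i : bool) (A : set R) : measurable A ->
  unif01 ([set w | bit w = i%:R] `&` doubling @^-1` A) = (2^-1)%:E * unif01 A.
Proof.
move=> mA; rewrite !unif01E.
have mA' : measurable (A `&` `[0%R, 1%R[) by exact: measurableI.
rewrite -(@lebesgue_measure_affine R 2 (- i%:R))//; congr (mu _).
have h2 : (0 < 2^-1 :> R)%R by rewrite invr_gt0.
apply/seteqP; split => w /=; rewrite !in_itv/=.
  move=> [[bi Aw] w01]; move: bi Aw; rewrite /doubling /bit; case: ltP => h.
    case: i => [/eqP|_]; first by rewrite eq_sym oner_eq0.
    by move=> Aw; split => //; rewrite ?mulr0n ?mulr1n; lra.
  case: i => [_|/eqP]; last by rewrite oner_eq0.
  by move=> Aw; split => //; rewrite ?mulr0n ?mulr1n; lra.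
move=> [Aw w01]; rewrite /doubling /bit; case: i Aw w01 => /=;
  rewrite ?mulr0n ?mulr1n => Aw w01.
  have -> : (w < 2^-1)%R = false by apply/negbTE; rewrite -leNgt; lra.
  by split => //; lra.
have -> : (w < 2^-1)%R by lra.
by split => //; lra.
Qed.

(* The first [n] binary digits of [w] are dealt out alternately to the two
   coordinates. *)
Fixpoint deal (n : nat) (w : R) : R * R :=
  if n is m.+1 then
    let p := deal m (doubling w) in (((bit w + p.2) / 2)%R, p.1)
  else (0%R, 0%R).

Lemma measurable_deal n : measurable_fun setT (fun w => (deal n w).1) /\
  measurable_fun setT (fun w => (deal n w).2).
Proof.
elim: n => [|n [h1 h2]] /=; first by split.
split.
  apply: measurable_funM => //; apply: measurable_funD; first exact: measurable_bit.
  exact: (measurableT_comp h2 measurable_doubling).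
exact: (measurableT_comp h1 measurable_doubling).
Qed.

Lemma deal_nd n w : ((deal n w).1 <= (deal n.+1 w).1)%R /\
  ((deal n w).2 <= (deal n.+1 w).2)%R.
Proof.
elim: n w => [|n IH] w.
  by split => //=; rewrite /bit; case: ifP => _; rewrite addr0 ?mul0r ?divr_ge0.
have [h1 h2] := IH (doubling w); split => //=.
by rewrite ler_pM2r ?invr_gt0// lerD2l.
Qed.

Lemma deal_le1 n w : ((deal n w).1 <= 1)%R /\ ((deal n w).2 <= 1)%R.
Proof.
elim: n w => [|n IH] w /=; first by rewrite ler01.
have [h1 h2] := IH (doubling w); split => //.
rewrite ler_pdivrMr//; apply: le_trans (lerD (_ : _ <= 1)%R h2) _; last by lra.
by rewrite /bit; case: ifP.
Qed.

(** The survival functions of the two coordinates of [deal n]. Conditioning on the leading digit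
    averages the two rescaled tails, and the coordinates swap roles as in [deal]. *)
Fixpoint deal_tail (n : nat) : (R -> R) * (R -> R) :=
  if n is m.+1 then
    let p := deal_tail m in
    ((fun a => 2^-1 * (p.2 (2 * a) + p.2 (2 * a - 1)))%R, p.1)
  else ((fun a => if a < 0 then 1 else 0)%R, (fun a => if a < 0 then 1 else 0)%R).

Lemma unif01_deal n (a b : R) :
  unif01 [set w | (a < (deal n w).1)%R /\ (b < (deal n w).2)%R] =
  ((deal_tail n).1 a * (deal_tail n).2 b)%:E.
Proof.
elim: n a b => [|n IH] a b /=.
  case: ltP => ha; last by rewrite mul0r (_ : [set w | _] = set0) ?measure0//; apply/seteqP; split => w // -[].
  case: ltP => hb; last by rewrite mulr0 (_ : [set w | _] = set0) ?measure0//; apply/seteqP; split => w // -[].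
  by rewrite mulr1 (_ : [set w | _] = setT) ?probability_setT//; apply/seteqP; split.
have [m1 m2] := measurable_deal n.
pose A (x : R) := [set w | (b < (deal n w).1)%R /\ (x < (deal n w).2)%R].
have mA x : measurable (A x).
  have -> : A x = (fun w => (deal n w).1) @^-1` `]b, +oo[ `&` (fun w => (deal n w).2) @^-1` `]x, +oo[.
    by apply/seteqP; split => w; rewrite /A /= !in_itv/= !andbT.
  by apply: measurableI; rewrite -[X in measurable X]setTI; [exact: m1|exact: m2].
have -> : [set w | (a < (bit w + (deal n (doubling w)).2) / 2)%R /\
                   (b < (deal n (doubling w)).1)%R] =
    ([set w | bit w = false%:R] `&` doubling @^-1` A (2 * a)%R) `|`
    ([set w | bit w = true%:R] `&` doubling @^-1` A (2 * a - 1)%R).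
  apply/seteqP; split => w /=.
    move=> [h1 h2]; rewrite /A /=.
    case: (ltP w 2^-1%R) => h; [left|right]; move: h1; rewrite /bit ?h.
      by move=> h1; split => //; split => //; lra.
    have -> : (w < 2^-1)%R = false by apply/negbTE; rewrite -leNgt.
    by move=> h1; split => //; split => //; lra.
  by move=> [[-> [h1 h2]]|[-> [h1 h2]]]; rewrite /=; split => //; lra.
have mb (i : bool) : measurable [set w | bit w = i%:R].
  rewrite -[X in measurable X]setTI.
  exact: (measurable_bit measurableT (measurable_set1 _)).
have mD B : measurable B -> measurable (doubling @^-1` B).
  by move=> mB; rewrite -[X in measurable X]setTI; exact: (measurable_doubling measurableT mB).
rewrite measureU; first last.
- apply/seteqP; split => // w [[/= -> _] [/= /eqP]].
  by rewrite eq_sym oner_eq0.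
- by apply: measurableI; [exact: mb|exact: (mD _ (mA _))].
- by apply: measurableI; [exact: mb|exact: (mD _ (mA _))].
rewrite [LHS](_ : _ = (2^-1)%:E * unif01 (A (2 * a)%R) +
    (2^-1)%:E * unif01 (A (2 * a - 1)%R)); last first.
  by congr (_ + _); exact: unif01_half.
rewrite /A !IH -!EFinM -EFinD; congr EFin.
by ring.
Qed.

Definition clamp_tail (a : R) : R := Num.min 1%R (Num.max 0%R (1 - a)%R).

(** For [a] in [[0, 1[] exactly one of [2 a] and [2 a - 1] lies in that interval, so the error is
    halved at the first coordinate, while the second merely inherits the error of the first. The
    weights 3 and 4 fit both moves to the common ratio [3/4]: [4 / 2 <= 3 * 3/4] and
    [3 = 4 * 3/4]. *)
Lemma deal_tail_err n (a : R) :
  (`|(deal_tail n).1 a - clamp_tail a| <= (if (0 <= a < 1) then 3 * (3/4) ^+ n else 0))%R /\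
  (`|(deal_tail n).2 a - clamp_tail a| <= (if (0 <= a < 1) then 4 * (3/4) ^+ n else 0))%R.
Proof.
have ct0 (x : R) : (x < 0 -> clamp_tail x = 1)%R.
  by move=> x0; rewrite /clamp_tail; apply/min_idPl; rewrite le_max; apply/orP; right; lra.
have ct1 (x : R) : (1 <= x -> clamp_tail x = 0)%R.
  move=> x0; rewrite /clamp_tail (max_idPl _); last by lra.
  by apply/min_idPr.
have ctm (x : R) : (0 <= x -> x < 1 -> clamp_tail x = 1 - x)%R.
  move=> x0 x1; rewrite /clamp_tail (max_idPr _); last by lra.
  by apply/min_idPr; lra.
elim: n a => [|n IH] a /=.
  rewrite expr0 !mulr1; case: ltP => a0 /=.
    by rewrite ct0// subrr normr0.
  case: ltP => a1 /=; last by rewrite ct1// subrr normr0.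
  by rewrite ctm// sub0r normrN ger0_norm; [split; lra|lra].
split; last first.
  have [h _] := IH a; apply: le_trans h _; case: ifP => // _.
  by rewrite exprS; lra.
have [_ h1] := IH (2 * a)%R; have [_ h2] := IH (2 * a - 1)%R.
have p0 : (0 <= (3 / 4 : R) ^+ n)%R by rewrite exprn_ge0// divr_ge0.
set x := (deal_tail n).2 (2 * a)%R in h1 *.
set y := (deal_tail n).2 (2 * a - 1)%R in h2 *.
have ceq : clamp_tail a = (2^-1 * (clamp_tail (2 * a) + clamp_tail (2 * a - 1)))%R.
  case: (ltP a 0%R) => a0; first by rewrite !ct0; [field|lra|lra|lra].
  case: (leP 1%R a) => a1; first by rewrite !ct1; [field|lra|lra|lra].
  case: (ltP a 2^-1%R) => ah.
    by rewrite (ctm a)// (ctm (2 * a)%R) ?ct0; [field|lra|lra|lra].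
  by rewrite (ctm a)// (ct1 (2 * a)%R) ?ctm; [field|lra|lra|lra].
have tri : (`|2^-1 * (x + y) - clamp_tail a| <=
    2^-1 * (`|x - clamp_tail (2 * a)| + `|y - clamp_tail (2 * a - 1)|))%R.
  rewrite ceq -mulrBr normrM (ger0_norm (_ : 0 <= 2^-1)%R) ?invr_ge0//.
  by rewrite ler_pM2l ?invr_gt0// opprD addrACA ler_normD.
apply: le_trans tri _; rewrite exprS.
case: (ltP a 0%R) h1 h2 => a0 /=.
  have -> : (0 <= 2 * a)%R = false by apply/negbTE; rewrite -ltNge; lra.
  have -> : (0 <= 2 * a - 1)%R = false by apply/negbTE; rewrite -ltNge; lra.
  by rewrite /=; lra.
case: (ltP a 1%R) => a1 /=; last first.
  have -> : (2 * a < 1)%R = false by apply/negbTE; rewrite -leNgt; lra.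
  have -> : (2 * a - 1 < 1)%R = false by apply/negbTE; rewrite -leNgt; lra.
  by rewrite !andbF; lra.
case: (ltP a 2^-1%R) => ah.
  have -> : (0 <= 2 * a - 1)%R = false by apply/negbTE; rewrite -ltNge; lra.
  by case: ifP => _ /=; lra.
have -> : (2 * a < 1)%R = false by apply/negbTE; rewrite -leNgt; lra.
by rewrite andbF; case: ifP => _ /=; lra.
Qed.

End uniform_split.

(** * A sequence of independent normal variables on the unit interval *)

Section normal_sequence.
Context (R : realType).
Notation U := (@unif01 R).
Notation N01 := (@normal_prob R 0 1).
Local Open Scope ereal_scope.

Definition split1 (w : R) : R := limn (fun n => (deal n w).1).
Definition split2 (w : R) : R := limn (fun n => (deal n w).2).

Lemma deal1_nd (w : R) : nondecreasing_seq (fun n => (deal n w).1).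
Proof. by apply/nondecreasing_seqP => n; have [] := deal_nd n w. Qed.

Lemma deal2_nd (w : R) : nondecreasing_seq (fun n => (deal n w).2).
Proof. by apply/nondecreasing_seqP => n; have [] := deal_nd n w. Qed.

Lemma nd_lim_gt (u : R^nat) (M a : R) : nondecreasing_seq u ->
  (forall n, u n <= M)%R -> (a < limn u)%R <-> exists n, (a < u n)%R.
Proof.
move=> ndu uM.
have cu : cvgn u.
  by apply: nondecreasing_is_cvgn => //; exists M => _ [n _ <-].
split=> [au|[n aun]]; last first.
  exact: lt_le_trans aun (nondecreasing_cvgn_le ndu cu n).
have [n _ /(_ n (leqnn n)) h] := cvgr_gt _ cu _ au.
by exists n.
Qed.

Lemma split_gtE (a b : R) :
  [set w | (a < split1 w)%R /\ (b < split2 w)%R] =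
  \bigcup_n [set w | (a < (deal n w).1)%R /\ (b < (deal n w).2)%R].
Proof.
have H1 w := nd_lim_gt a (deal1_nd w) (fun n => (deal_le1 n w).1).
have H2 w := nd_lim_gt b (deal2_nd w) (fun n => (deal_le1 n w).2).
apply/seteqP; split=> w /=.
  move=> [/H1[n hn] /H2[m hm]]; exists (maxn n m) => //; split.
    by apply: lt_le_trans hn _; apply: deal1_nd; exact: leq_maxl.
  by apply: lt_le_trans hm _; apply: deal2_nd; exact: leq_maxr.
by move=> [n _ [h1 h2]]; split; [apply/H1|apply/H2]; exists n.
Qed.

Lemma measurable_deal_gt n (a b : R) :
  measurable [set w | (a < (deal n w).1)%R /\ (b < (deal n w).2)%R].
Proof.
have [m1 m2] := @measurable_deal R n.
rewrite (_ : [set w | _] = (fun w => (deal n w).1) @^-1` `]a, +oo[ `&`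
    (fun w => (deal n w).2) @^-1` `]b, +oo[); last first.
  by apply/seteqP; split => w; rewrite /= !in_itv/= !andbT.
by apply: measurableI; rewrite -[X in measurable X]setTI; [exact: m1|exact: m2].
Qed.

Let measurable_nd_lim (u : nat -> R -> R) : (forall n, measurable_fun setT (u n)) ->
  (forall w, nondecreasing_seq (u ^~ w)) -> (forall n w, u n w <= 1)%R ->
  measurable_fun setT (fun w => limn (u ^~ w)).
Proof.
move=> mu ndu u1; apply: measurable_fun_rays => a.
rewrite (_ : [set w | _] = \bigcup_n u n @^-1` `]a, +oo[).
  by apply: bigcupT_measurable => n; rewrite -[X in measurable X]setTI; exact: mu.
apply/seteqP; split => w /=.
  by move=> /(nd_lim_gt a (ndu w) (u1^~ w))[n hn]; exists n => //=; rewrite in_itv/= hn.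
move=> [n _]; rewrite /= in_itv/= andbT => hn.
by apply/(nd_lim_gt a (ndu w) (u1^~ w)); exists n.
Qed.

Lemma measurable_split1 : measurable_fun setT split1.
Proof.
apply: measurable_nd_lim => [n|w|n w]; first by have [] := @measurable_deal R n.
  exact: deal1_nd.
by have [] := deal_le1 n w.
Qed.

Lemma measurable_split2 : measurable_fun setT split2.
Proof.
apply: measurable_nd_lim => [n|w|n w]; first by have [] := @measurable_deal R n.
  exact: deal2_nd.
by have [] := deal_le1 n w.
Qed.

Lemma unif01_split_gt (a b : R) :
  U [set w | (a < split1 w)%R /\ (b < split2 w)%R] =
  (clamp_tail a * clamp_tail b)%:E.
Proof.
rewrite split_gtE; set F := fun n => [set w | _].
have cF : U \o F @ \oo --> U (\bigcup_n F n).
  apply: nondecreasing_cvg_mu.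
  - by move=> n; exact: measurable_deal_gt.
  - by apply: bigcupT_measurable => n; exact: measurable_deal_gt.
  - apply/nondecreasing_seqP => n; apply/subsetPset => w [h1 h2].
    have [e1 e2] := deal_nd n w.
    by split; [exact: lt_le_trans e1|exact: lt_le_trans e2].
apply/esym; apply: (cvg_unique _ _ cF) => //.
rewrite (_ : U \o F = EFin \o (fun n => (deal_tail R n).1 a * (deal_tail R n).2 b)%R).
  apply: cvg_EFin; first by near=> n.
  have c0 : (fun n => 4 * (3 / 4 : R) ^+ n)%R @ \oo --> (0 : R)%R.
    rewrite -(mulr0 (4 : R)%R); apply: cvgM; first exact: cvg_cst.
    by apply: cvg_expr; rewrite ger0_norm; lra.
  have bnd (v : R^nat) (x : R) : (forall n, `|v n - x| <= 4 * (3 / 4 : R) ^+ n)%R ->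
      v @ \oo --> x.
    move=> h; apply/cvgrPdist_lt => e e0.
    move/cvgrPdist_lt : c0 => /(_ e e0) H.
    near=> n; rewrite distrC; apply: le_lt_trans (h n) _.
    have : (`|0 - 4 * (3 / 4 : R) ^+ n| < e)%R by near: n.
    by rewrite sub0r normrN ger0_norm// mulr_ge0// exprn_ge0// divr_ge0.
  have p0 n : (0 <= (3 / 4 : R) ^+ n)%R by rewrite exprn_ge0// divr_ge0.
  apply: cvgM; apply: bnd => n.
    have [h _] := @deal_tail_err R n a; apply: le_trans h _.
    by case: ifP => _; have := p0 n; lra.
  have [_ h] := @deal_tail_err R n b; apply: le_trans h _.
  by case: ifP => _; have := p0 n; lra.
by apply/funext => n /=; rewrite unif01_deal.
Unshelve. all: by end_near. Qed.

Lemma unif01_gt (a : R) : U [set x | (a < x)%R] = (clamp_tail a)%:E.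
Proof.
rewrite unif01E /clamp_tail; case: (ltP a 0%R) => a0.
  rewrite (_ : _ `&` _ = `[0%R, 1%R[%classic); last first.
    apply/seteqP; split => x /=; rewrite in_itv/=; first by case.
    by move=> h; split => //; lra.
  rewrite lebesgue_measure_itv/= lte01 sube0; congr EFin; apply/esym.
  by apply/min_idPl; rewrite le_max; apply/orP; right; lra.
rewrite (_ : _ `&` _ = `]a, 1%R[%classic); last first.
  apply/seteqP; split => x /=; rewrite !in_itv/=; first by case=> h1 h2; lra.
  by move=> h; split; lra.
rewrite lebesgue_measure_itv/= lte_fin; case: ltP => a1.
  rewrite -EFinD; congr EFin; rewrite (max_idPr _); last by lra.
  by apply/esym/min_idPr; lra.
congr EFin; rewrite (max_idPl _); last by lra.
by apply/esym/min_idPr.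
Qed.

(** Rays are replaced by Borel sets one coordinate at a time: with the other coordinate frozen, both
    sides are finite measures on the line that agree on rays. *)
Lemma unif01_split (A B : set R) : measurable A -> measurable B ->
  U (split1 @^-1` A `&` split2 @^-1` B) = U A * U B.
Proof.
have ct0 (x : R) : (0 <= clamp_tail x)%R.
  by rewrite /clamp_tail le_min ler01/= le_max lexx.
have mpre (f : R -> R) (D : set R) : measurable_fun setT f -> measurable D -> measurable (f @^-1` D).
  by move=> mf mD; rewrite -[X in measurable X]setTI; exact: mf.
have mray (a : R) : measurable [set x : R | (a < x)%R] := measurable_ray a.
have fU (D : set R) : measurable D -> U D \is a fin_num.
  by move=> mD; exact: fin_num_measure.
have s1 : forall (b : R) (A : set R), measurable A ->
    U (split1 @^-1` A `&` split2 @^-1` [set x | (b < x)%R]) = U A * (clamp_tail b)%:E.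
  move=> b {}A mA.
  have mD : measurable (split2 @^-1` [set x | (b < x)%R]).
    by apply: mpre => //; exact: measurable_split2.
  have ms : @measurable_fun _ _ (measurableTypeR R) (measurableTypeR R) setT split1.
    exact: measurable_split1.
  pose m1 := image_measure (mrestr U mD) ms.
  pose m2 : {measure set (measurableTypeR R) -> \bar R} := mscale (NngNum (ct0 b)) U.
  rewrite muleC; apply: (@finite_measure_ext_rays R m1 m2) => //.
    apply: le_lt_trans (ltry 1); apply: probability_le1.
    by apply: measurableI => //; exact: mpre.
  by move=> a; rewrite [LHS]unif01_split_gt mulrC EFinM -(unif01_gt a).
move=> mA mB.
have mD : measurable (split1 @^-1` A).
  by apply: mpre => //; exact: measurable_split1.
have ms : @measurable_fun _ _ (measurableTypeR R) (measurableTypeR R) setT split2.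
  exact: measurable_split2.
pose m1 := image_measure (mrestr U mD) ms.
have UA0 : (0 <= fine (U A))%R by rewrite fine_ge0.
pose m2 : {measure set (measurableTypeR R) -> \bar R} := mscale (NngNum UA0) U.
have m2E D : m2 D = U A * U D by rewrite -[U A]fineK ?fU.
rewrite setIC -m2E; apply: (@finite_measure_ext_rays R m1 m2) => //.
  apply: le_lt_trans (ltry 1); apply: probability_le1.
  by apply: measurableI => //; exact: mpre.
move=> b; rewrite m2E unif01_gt -(s1 b A mA).
by rewrite setIC.
Qed.

Definition normal_tail (x : R) : R := fine (N01 [set y | (x < y)%R]).
(** The quantile function is taken from the survival function, hence decreasing in [w]: then
    [x < quantile w] holds exactly when [w < normal_tail x], and the preimage of an open ray is an
    initial segment. The value 0 outside []0, 1[] is a default. *)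
Definition quantile (w : R) : R :=
  if (0 < w < 1)%R then sup [set x | (w < normal_tail x)%R] else 0%R.

Lemma normal_tailE x : N01 [set y | (x < y)%R] = (normal_tail x)%:E.
Proof. by rewrite fineK// fin_num_measure//; exact: measurable_ray. Qed.

Lemma normal_tail_le x y : (x <= y)%R -> (normal_tail y <= normal_tail x)%R.
Proof.
move=> xy; rewrite -lee_fin -!normal_tailE.
apply: le_measure; rewrite ?inE; [exact: measurable_ray|exact: measurable_ray|].
by move=> z /=; exact: le_lt_trans.
Qed.

Lemma normal_tail_ge0 x : (0 <= normal_tail x)%R.
Proof. exact: fine_ge0. Qed.

Lemma normal_tail_le1 x : (normal_tail x <= 1)%R.
Proof. by rewrite -lee_fin -normal_tailE; apply: probability_le1; exact: measurable_ray. Qed.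

(** Right continuity of the tail, by continuity from below along the rays starting at [x + 1/(n+1)].
    It yields the strict inequality [x < quantile w]. *)
Lemma normal_tail_right (w x : R) : (w < normal_tail x)%R ->
  exists2 y, (x < y)%R & (w < normal_tail y)%R.
Proof.
move=> wx; pose F n := [set y : R | (x + n.+1%:R^-1 < y)%R].
have UF : \bigcup_n F n = [set y | (x < y)%R].
  apply/seteqP; split => y /=.
    by move=> [n _]; rewrite /F /=; apply: le_lt_trans; rewrite lerDl invr_ge0.
  move=> xy; have yx0 : (0 < y - x)%R by rewrite subr_gt0.
  exists (Num.truncn (y - x)^-1) => //; rewrite /F /= -ltrBrDl.
  rewrite invf_plt ?posrE//; first exact: truncnS_gt.
have cF : N01 \o F @ \oo --> N01 (\bigcup_n F n).
  apply: nondecreasing_cvg_mu.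
  - by move=> n; exact: measurable_ray.
  - by rewrite UF; exact: measurable_ray.
  - apply/nondecreasing_seqP => n; apply/subsetPset => y; rewrite /F /=.
    by apply: le_lt_trans; rewrite lerD2l lef_pV2 ?posrE// ler_nat.
move: cF; rewrite UF normal_tailE => /fine_cvgP[_ cF].
have [n _ /(_ n (leqnn n)) h] := cvgr_gt _ cF _ wx.
by exists (x + n.+1%:R^-1)%R => //; rewrite ltrDl invr_gt0.
Qed.

Lemma normal_tail_gt (w : R) : (w < 1)%R -> exists x, (w < normal_tail x)%R.
Proof.
move=> w1; pose F n := [set y : R | (- n%:R < y)%R].
have UF : \bigcup_n F n = setT.
  apply/seteqP; split => y // _; exists (Num.bound `|y|) => //; rewrite /F /=.
  have := archi_boundP (normr_ge0 y).
  by have := ler_norm (- y)%R; rewrite normrN; lra.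
have cF : N01 \o F @ \oo --> N01 (\bigcup_n F n).
  apply: nondecreasing_cvg_mu.
  - by move=> n; exact: measurable_ray.
  - by rewrite UF.
  - apply/nondecreasing_seqP => n; apply/subsetPset => y; rewrite /F /=.
    by apply: le_lt_trans; rewrite lerN2 ler_nat.
move: cF; rewrite UF probability_setT => /fine_cvgP[_ cF].
have [n _ /(_ n (leqnn n)) h] := cvgr_gt _ cF _ w1.
by exists (- n%:R)%R.
Qed.

Lemma normal_tail_lt (w : R) : (0 < w)%R -> exists x, (normal_tail x < w)%R.
Proof.
move=> w1; pose F n := [set y : R | (n%:R < y)%R].
have UF : \bigcap_n F n = set0.
  apply/seteqP; split => y // /(_ (Num.bound `|y|) I); rewrite /F /=.
  have := archi_boundP (normr_ge0 y).
  by have := ler_norm y; lra.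
have cF : N01 \o F @ \oo --> N01 (\bigcap_n F n).
  apply: nonincreasing_cvg_mu.
  - apply: le_lt_trans (ltry 1); apply: probability_le1; exact: measurable_ray.
  - by move=> n; exact: measurable_ray.
  - by rewrite UF.
  - apply/nonincreasing_seqP => n; apply/subsetPset => y; rewrite /F /=.
    by apply: le_lt_trans; rewrite ler_nat.
move: cF; rewrite UF measure0 => /fine_cvgP[_ cF].
have [n _ /(_ n (leqnn n)) h] := cvgr_lt _ cF _ w1.
by exists n%:R.
Qed.

Lemma quantile_gt (w x : R) : (0 < w < 1)%R ->
  (x < quantile w)%R <-> (w < normal_tail x)%R.
Proof.
move=> w01; rewrite /quantile w01; have /andP[w0 w1] := w01.
have hs : has_sup [set x | (w < normal_tail x)%R].
  split; first by have [y hy] := normal_tail_gt w1; exists y.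
  have [z hz] := normal_tail_lt w0; exists z => y /= hy.
  by rewrite leNgt; apply/negP => /ltW/normal_tail_le; lra.
split=> [xs|].
  have e0 : (0 < sup [set x | (w < normal_tail x)%R] - x)%R by rewrite subr_gt0.
  have [y /= hy xy] := sup_adherent e0 hs.
  apply: lt_le_trans hy _; apply: normal_tail_le; apply: ltW.
  by move: xy; rewrite opprB addrC subrK.
move=> /normal_tail_right[y xy hy].
by apply: lt_le_trans xy _; apply: ub_le_sup hy; have [] := hs.
Qed.

Lemma quantile_gt_setE x : [set w | (x < quantile w)%R] =
  (`]0%R, 1%R[ `&` `]-oo, (normal_tail x)[) `|` (~` `]0%R, 1%R[ `&` [set _ | (x < 0)%R]).
Proof.
apply/seteqP; split => w /=; rewrite !in_itv/=.
  have [w01|w01] := boolP (0 < w < 1)%R.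
    by move=> /(quantile_gt _ w01) h; left.
  by rewrite /quantile (negbTE w01) => h; right; split => //; exact/negP.
move=> [[w01 h]|[/negP w01 h]]; first exact/quantile_gt.
by rewrite /quantile (negbTE w01).
Qed.

Lemma measurable_quantile : measurable_fun setT quantile.
Proof.
apply: measurable_fun_rays => x; rewrite quantile_gt_setE.
apply: measurableU; first exact: measurableI.
apply: measurableI; first exact: measurableC.
case: (ltP x 0%R) => h.
  by rewrite (_ : [set _ | _] = setT)//; apply/seteqP; split.
by rewrite (_ : [set _ | _] = set0)//; apply/seteqP; split.
Qed.

Lemma unif01_quantile_gt x : U [set w | (x < quantile w)%R] = (normal_tail x)%:E.
Proof.
have n0 := normal_tail_ge0 x; have n1 := normal_tail_le1 x.
have mq : measurable ([set w | (x < quantile w)%R] `&` `[0%R, 1%R[).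
  apply: measurableI => //; rewrite quantile_gt_setE.
  have := measurable_quantile measurableT (measurable_ray x).
  by rewrite setTI /preimage/= quantile_gt_setE.
rewrite unif01E; apply/eqP; rewrite eq_le; apply/andP; split.
  apply: (@le_trans _ _ (lebesgue_measure (`[0%R, normal_tail x]%classic : set R))).
    apply: le_measure; rewrite ?inE//= => w [/=]; rewrite !in_itv/= => h w01.
    have [/(quantile_gt x)/proj1/(_ h)|] := boolP (0 < w < 1)%R; first by lra.
    by rewrite negb_and -!leNgt => /orP[]; lra.
  rewrite lebesgue_measure_itv/= lte_fin; case: ifP => _; first by rewrite -EFinB subr0.
  by rewrite lee_fin.
apply: (@le_trans _ _ (lebesgue_measure (`]0%R, normal_tail x[%classic : set R))).
  rewrite lebesgue_measure_itv/= lte_fin; case: ltP => h; first by rewrite -EFinB subr0.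
  by rewrite lee_fin.
apply: le_measure; rewrite ?inE//= => w /=; rewrite !in_itv/= => h.
split; last by lra.
by apply/quantile_gt; lra.
Qed.

Lemma unif01_quantile (B : set R) : measurable B -> U (quantile @^-1` B) = N01 B.
Proof.
have mq : @measurable_fun _ _ (measurableTypeR R) (measurableTypeR R) setT quantile.
  exact: measurable_quantile.
move=> mB; apply: (@finite_measure_ext_rays R (image_measure U mq) N01) => //.
  rewrite [X in X < _](_ : _ = U setT)// probability_setT; exact: ltry.
by move=> a; exact: etrans (unif01_quantile_gt a) (esym (normal_tailE a)).
Qed.

(** Variable [n] is made from the first half of the digits left after [n] splittings; the other half
    feeds all later variables. *)
Definition normal_seq (n : nat) (w : R) : R := quantile (split1 (iter n split2 w)).

Lemma measurable_normal_seq n : measurable_fun setT (normal_seq n).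
Proof.
apply: (measurableT_comp measurable_quantile).
apply: (measurableT_comp measurable_split1).
elim: n => [|n IH] /=; first exact: measurable_id.
exact: (measurableT_comp measurable_split2 IH).
Qed.

Lemma unif01_normal_seq n (B : nat -> set R) : (forall i, measurable (B i)) ->
  U (\big[setI/setT]_(i <- iota 0 n) (normal_seq i @^-1` B i)) =
  \prod_(i <- iota 0 n) N01 (B i).
Proof.
elim: n B => [|n IH] B mB; first by rewrite !big_nil probability_setT.
rewrite /= !big_cons.
rewrite (iotaDl 1 0 n) !big_map.
have mq : measurable (quantile @^-1` B 0%N).
  by rewrite -[X in measurable X]setTI; exact: measurable_quantile.
have mC : measurable (\big[setI/setT]_(i <- iota 0 n) (normal_seq i @^-1` B i.+1)).
  apply: bigsetI_measurable => i _; rewrite -[X in measurable X]setTI.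
  exact: measurable_normal_seq.
rewrite -(unif01_quantile (mB 0%N)) -(IH (fun i => B i.+1))//.
rewrite -unif01_split//; congr (U _); congr (_ `&` _).
rewrite -[RHS]/(split2 @^-1` _).
elim: (iota 0 n) => [|i s IHs]; first by rewrite !big_nil.
rewrite !big_cons IHs; congr (_ `&` _).
by apply/seteqP; split => w; rewrite /preimage /= /normal_seq add1n iterSr.
Qed.

Lemma iid_normal_seq : iid_normal U normal_seq.
Proof.
split=> [i|s us B mB]; first exact: measurable_normal_seq.
pose n := (\max_(i <- s) i).+1.
have st : {subset s <= iota 0 n}.
  by move=> i si; rewrite mem_iota add0n ltnS; exact: leq_bigmax_seq.
pose B' i := if i \in s then B i else setT.
have mB' i : measurable (B' i) by rewrite /B'; case: ifP.
have h := unif01_normal_seq n mB'.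
rewrite (big_subseq _ _ us (iota_uniq 0 n) st) [RHS](big_subseq _ _ us (iota_uniq 0 n) st).
transitivity (U (\big[setI/setT]_(i <- iota 0 n) (normal_seq i @^-1` B' i))).
  by congr (U _); apply: eq_bigr => i _; rewrite /B'; case: ifP.
rewrite h; apply: eq_bigr => i _; rewrite /B'; case: ifP => // _.
by rewrite probability_setT.
Qed.

End normal_sequence.

(** * Limits of independent normal families *)

Section iid_limits.
Context (R : realType) (d : measure_display) (T : measurableType d)
  (P : probability T R).
Notation N01 := (@normal_prob R 0 1).
Local Open Scope ereal_scope.

(** Induction on the indices already freed: [s1] carries arbitrary Borel constraints and [s2] still
    carries rays. Freeing one more index only needs uniqueness of a measure on the line given its
    values on rays. *)
Lemma iid_normal_rays (I : eqType) (X : I -> T -> R) :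
  (forall i, measurable_fun setT (X i)) ->
  (forall s : seq I, uniq s -> forall b : I -> R,
     P (\big[setI/setT]_(i <- s) (X i @^-1` [set x | (b i < x)%R])) =
     \prod_(i <- s) N01 [set x | (b i < x)%R]) ->
  iid_normal P X.
Proof.
move=> mX H; split=> // s us B mB.
suff claim : forall s1 s2 : seq I, uniq (s1 ++ s2) ->
    forall D : I -> set R, (forall i, measurable (D i)) ->
    (forall i, i \in s2 -> exists b : R, D i = [set x | (b < x)%R]) ->
    P (\big[setI/setT]_(i <- s1 ++ s2) (X i @^-1` D i)) =
    \prod_(i <- s1 ++ s2) N01 (D i).
  by have := claim s [::]; rewrite cats0; apply.
move=> {s us B mB}; elim=> [|i s1 IH] s2 us D mD Dray.
  rewrite cat0s in us *.
  pose b i := xget 0%R [set b : R | D i = [set x | (b < x)%R]].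
  have Db i : i \in s2 -> D i = [set x | (b i < x)%R].
    by move=> /Dray; rewrite /b; case: xgetP => [y _ //|h [b' /h]].
  transitivity (P (\big[setI/setT]_(i <- s2) (X i @^-1` [set x | (b i < x)%R]))).
    by congr (P _); apply: eq_big_seq => i /Db ->.
  by rewrite H//; apply: eq_big_seq => i /Db ->.
rewrite /= in us *; have /andP[is12 us12] := us.
rewrite !big_cons.
set E := \big[setI/setT]_(j <- s1 ++ s2) _.
have mE : measurable E by exact: measurable_cylinder.
set c := \prod_(j <- s1 ++ s2) _.
have c0 : 0 <= c by apply: prode_ge0 => j _; exact: measure_ge0.
have cfin : c \is a fin_num.
  by apply: prode_fin_num => j _; apply: fin_num_measure; exact: mD.
have c0' : (0 <= fine c)%R by rewrite fine_ge0.
have mXi : @measurable_fun _ _ T (measurableTypeR R) setT (X i) by exact: mX.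
pose m1 := image_measure (mrestr P mE) mXi.
pose m2 : {measure set (measurableTypeR R) -> \bar R} := mscale (NngNum c0') N01.
have m2E A : m2 A = c * N01 A by rewrite -[c]fineK.
rewrite [RHS]muleC -m2E.
apply: (@finite_measure_ext_rays R m1 m2); last exact: mD.
  apply: le_lt_trans (ltry 1); apply: probability_le1; apply: measurableI => //.
  by rewrite -[X in measurable X]setTI; apply: mX.
move=> a; rewrite m2E.
pose D' j := if j == i then [set x | (a < x)%R] else D j.
have D'E j : j \in s1 ++ s2 -> D' j = D j.
  by move=> js; rewrite /D'; case: eqP => // ji; move: is12; rewrite -ji js.
have D'i : D' i = [set x | (a < x)%R] by rewrite /D' eqxx.
have pe : perm_eq (s1 ++ i :: s2) (i :: s1 ++ s2) by rewrite perm_catC/= perm_cons perm_catC.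
have := IH (i :: s2) _ D'; rewrite (perm_uniq pe)/= => /(_ us).
rewrite !(perm_big _ pe)/= !big_cons D'i.
have -> : \big[setI/setT]_(j <- s1 ++ s2) (X j @^-1` D' j) = E.
  by apply: eq_big_seq => j /D'E ->.
have -> : \prod_(j <- s1 ++ s2) N01 (D' j) = c.
  by apply: eq_big_seq => j /D'E ->.
move=> hh; rewrite muleC; apply: hh.
  by move=> j; rewrite /D'; case: ifP => // _; exact: measurable_ray.
move=> j; rewrite inE /D'; case: eqP => [_ _|_ /= js]; first by exists a.
exact: Dray.
Qed.

Lemma measurable_fun_pw_cvg (f_ : nat -> T -> R) (f : T -> R) :
  (forall n, measurable_fun setT (f_ n)) ->
  (forall w, (f_ n w) @[n --> \oo] --> f w) -> measurable_fun setT f.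
Proof.
move=> mf cf; apply/measurable_EFinP.
apply: (emeasurable_fun_cvg (fun n x => (f_ n x)%:E)) => [n|w _].
  exact/measurable_EFinP.
by apply: cvg_EFin; [near=> n|exact: cf].
Unshelve. all: by end_near. Qed.

(** Fatou's lemma for events, [E] being contained in the lower limit of the [E_ n]. The next lemma
    is its counterpart for the upper limit. *)
Lemma prob_liminf_le (E_ : nat -> set T) (E : set T) (c : \bar R) :
  (forall n, measurable (E_ n)) -> measurable E -> (forall n, P (E_ n) <= c) ->
  (forall w, E w -> \forall n \near \oo, E_ n w) -> P E <= c.
Proof.
move=> mE_ mE Ec EE.
pose F k := \bigcap_(n in [set n | (k <= n)%N]) E_ n.
have mF k : measurable (F k).
  by apply: bigcap_measurable; [exists k => /=|move=> n _; exact: mE_].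
have cF : P \o F @ \oo --> P (\bigcup_n F n).
  apply: nondecreasing_cvg_mu => //; first exact: bigcupT_measurable.
  apply/nondecreasing_seqP => k; apply/subsetPset => w Fw n /= kn.
  by apply: Fw => /=; exact: ltnW.
apply: (@le_trans _ _ (P (\bigcup_n F n))).
  apply: le_measure; [by rewrite inE|by rewrite inE; exact: bigcupT_measurable|].
  by move=> w /EE [k _ h]; exists k => // n /= kn; exact: h.
rewrite -(cvg_lim _ cF)//; apply: lime_le; first by apply/cvg_ex; eexists; exact: cF.
apply: nearW => k /=; apply: le_trans (Ec k).
by apply: le_measure; rewrite ?inE// => w; apply => /=.
Qed.

Lemma prob_limsup_ge (E_ : nat -> set T) (E : set T) (c : \bar R) :
  (forall n, measurable (E_ n)) -> measurable E -> (forall n, c <= P (E_ n)) ->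
  (forall w, ~ E w -> \forall n \near \oo, ~ E_ n w) -> c <= P E.
Proof.
move=> mE_ mE Ec EE.
pose F k := \bigcup_(n in [set n | (k <= n)%N]) E_ n.
have mF k : measurable (F k) by apply: bigcup_measurable => n _; exact: mE_.
have cF : P \o F @ \oo --> P (\bigcap_n F n).
  apply: nonincreasing_cvg_mu => //.
  - by apply: le_lt_trans (ltry 1); exact: probability_le1.
  - exact: bigcapT_measurable.
  apply/nonincreasing_seqP => k; apply/subsetPset => w [n /= kn Enw].
  by exists n => //=; exact: ltnW.
apply: (@le_trans _ _ (P (\bigcap_n F n))); last first.
  apply: le_measure; [by rewrite inE; exact: bigcapT_measurable|by rewrite inE|].
  move=> w Fw; apply: contrapT => /EE[k _ h].
  by have [n /= kn Enw] := Fw k I; exact: h kn Enw.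
rewrite -(cvg_lim _ cF)//; apply: lime_ge; first by apply/cvg_ex; eexists; exact: cF.
apply: nearW => k /=; apply: le_trans (Ec k) _.
by apply: le_measure; rewrite ?inE// => w h; exists k => /=.
Qed.

Lemma EFin_prod (I : Type) (r : seq I) (F : I -> R) :
  (\prod_(i <- r) F i)%R%:E = \prod_(i <- r) (F i)%:E.
Proof.
by elim: r => [|i r IH]; rewrite ?big_nil// !big_cons EFinM IH.
Qed.

Lemma cvg_normal_tail (b : R) :
  (normal_tail (b + n.+1%:R^-1)) @[n --> \oo] --> normal_tail b.
Proof.
apply/cvgrPdist_lt => e e0.
have [y by_ hy] : exists2 y, (b < y)%R & (normal_tail b - e < normal_tail y)%R.
  by apply: normal_tail_right; rewrite ltrBlDr ltrDl.
have yb0 : (0 < y - b)%R by rewrite subr_gt0.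
exists (Num.truncn (y - b)^-1) => // n /= kn.
have h : (b + n.+1%:R^-1 <= y)%R.
  rewrite -lerBrDl invf_ple ?posrE//; apply: le_trans (ltW (truncnS_gt _)) _.
  by rewrite ler_nat.
rewrite ger0_norm ?subr_ge0.
  by have := normal_tail_le h; lra.
by apply: normal_tail_le; rewrite lerDl invr_ge0.
Qed.

(** Pointwise convergence preserves only strict inequalities, so the two bounds are asymmetric. The
    upper bound is the lower limit of the events; for the lower bound the thresholds are first
    raised by [1/(k+1)], and right continuity of the tail lets [k] tend to infinity. *)
Lemma iid_normal_cvg (I : choiceType) (X_ : nat -> I -> T -> R) (X : I -> T -> R) :
  (forall n, iid_normal P (X_ n)) ->
  (forall i w, X_ n i w @[n --> \oo] --> X i w) -> iid_normal P X.
Proof.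
move=> iX cX.
have mX_ n i : measurable_fun setT (X_ n i) by have [] := iX n.
have mX i : measurable_fun setT (X i).
  by apply: (measurable_fun_pw_cvg (f_ := fun n => X_ n i)).
have mcyl (Y : I -> T -> R) (s : seq I) (b : I -> R) : (forall i, measurable_fun setT (Y i)) ->
    measurable (\big[setI/setT]_(i <- s) (Y i @^-1` [set x | (b i < x)%R])).
  by move=> mY; apply: measurable_cylinder => // i; exact: measurable_ray.
have cylE (Y : I -> T -> R) (s : seq I) (b : I -> R) w :
    (\big[setI/setT]_(i <- s) (Y i @^-1` [set x | (b i < x)%R])) w <->
    (forall i, i \in s -> (b i < Y i w)%R).
  by rewrite -bigcap_seq; split => h i /h.
apply: iid_normal_rays => // s us b.
have fins n (c : I -> R) : P (\big[setI/setT]_(i <- s) (X_ n i @^-1` [set x | (c i < x)%R])) =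
    (\prod_(i <- s) normal_tail (c i))%R%:E.
  have [_ ->//] := iX n; last by move=> i; exact: measurable_ray.
  by rewrite EFin_prod; apply: eq_bigr => i _; rewrite normal_tailE.
have -> : \prod_(i <- s) N01 [set x | (b i < x)%R] = (\prod_(i <- s) normal_tail (b i))%R%:E.
  by rewrite EFin_prod; apply: eq_bigr => i _; rewrite normal_tailE.
apply/eqP; rewrite eq_le; apply/andP; split.
  apply: (@prob_liminf_le (fun n => \big[setI/setT]_(i <- s) (X_ n i @^-1` [set x | (b i < x)%R]))).
  - by move=> n; exact: mcyl.
  - exact: mcyl.
  - by move=> n; rewrite fins.
  move=> w /cylE h.
  suff : \forall n \near \oo, forall i, i \in s -> (b i < X_ n i w)%R.
    by apply: filterS => n hn; apply/cylE.
  elim: (s) h => [|i t IH] h; first by near=> n.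
  have h1 : \forall n \near \oo, forall i, i \in t -> (b i < X_ n i w)%R.
    by apply: IH => j jt; apply: h; rewrite inE jt orbT.
  have h2 : \forall n \near \oo, (b i < X_ n i w)%R.
    exact: (cvgr_gt _ (cX i w) _ (h i (mem_head _ _))).
  case: h1 => n1 _ k1; case: h2 => n2 _ k2.
  exists (maxn n1 n2) => // n /=; rewrite geq_max => /andP[n1n n2n] j.
  by rewrite inE => /orP[/eqP->|]; [exact: k2|exact: k1].
have cprod : (\prod_(i <- s) normal_tail (b i + k.+1%:R^-1))%R%:E @[k --> \oo] -->
    (\prod_(i <- s) normal_tail (b i))%R%:E.
  apply: cvg_EFin; first by near=> n.
  elim: (s) => [|i t IH]; first by under eq_fun do rewrite big_nil; rewrite big_nil; exact: cvg_cst.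
  under eq_fun do rewrite big_cons; rewrite big_cons.
  by apply: cvgM => //; exact: cvg_normal_tail.
rewrite -(cvg_lim _ cprod)//; apply: lime_le; first by apply/cvg_ex; eexists; exact: cprod.
apply: nearW => k.
apply: (@prob_limsup_ge (fun n => \big[setI/setT]_(i <- s)
  (X_ n i @^-1` [set x | (b i + k.+1%:R^-1 < x)%R]))).
- by move=> n; exact: mcyl.
- exact: mcyl.
- by move=> n; rewrite fins.
move=> w h.
have [i si hi] : exists2 i, i \in s & (X i w <= b i)%R.
  apply: contrapT => h'; apply: h; apply/cylE => i si.
  by rewrite ltNge; apply/negP => h2; apply: h'; exists i.
have : (X i w < b i + k.+1%:R^-1)%R by apply: le_lt_trans hi _; rewrite ltrDl invr_gt0.
move=> /(cvgr_lt _ (cX i w)); apply: filterS => n hn /cylE /(_ i si).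
by move=> /(lt_trans hn); rewrite ltxx.
Unshelve. all: by end_near. Qed.

Lemma iid_normal_ae (I : choiceType) (X : I -> T -> R) (D : set T) :
  measurable D -> P D = 1 -> iid_normal P X ->
  iid_normal P (fun i w => (X i w * \1_D w)%R).
Proof.
move=> mD PD [mX iX]; split=> [i|s us B mB].
  by apply: measurable_funM => //; exact: measurable_indic.
have PI (E : set T) : measurable E -> P (E `&` D) = P E.
  by move=> mE; exact: prob_setI_full.
rewrite -iX// -PI; last first.
  apply: measurable_cylinder => // i.
  by apply: measurable_funM => //; exact: measurable_indic.
rewrite -[RHS]PI; last exact: measurable_cylinder.
congr (P _); rewrite -!bigcap_seq; apply/seteqP; split => w [h Dw]; split => // i si;
  have := h i si; rewrite /preimage /= indicE mem_set// mulr1//.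
Qed.

End iid_limits.

(** * Normalized block sums and midpoint refinement *)

Section levy_construction.
Context (R : realType) (d : measure_display) (T : measurableType d)
  (P : probability T R).
Notation N01 := (@normal_prob R 0 1).

(** The rotation with cosine [sqrt ((l+1)/(l+2))] and sine [sqrt (1/(l+2))] absorbs one more
    variable into the normalized sum kept at index [k]; the orthogonal combination is left at index
    [k + l + 1], so the whole family remains independent. *)
Lemma iid_normal_merge_block (X : nat -> T -> R) (k l : nat) : iid_normal P X ->
  exists X' : nat -> T -> R, [/\ iid_normal P X',
    (forall w, X' k w = (\sum_(k <= j < (k + l).+1) X j w) / Num.sqrt l.+1%:R) &
    forall j, (j < k)%N || (k + l < j)%N -> X' j = X j].
Proof.
move=> iX; elim: l => [|l [X' [iX' X'k X'j]]].
  by exists X; split => // w; rewrite addn0 big_nat1 sqrtr1 divr1.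
pose c : R := Num.sqrt (l.+1%:R / l.+2%:R).
pose s : R := Num.sqrt (l.+2%:R^-1).
have c0 : 0 < c by rewrite sqrtr_gt0 divr_gt0.
have cs : c ^+ 2 + s ^+ 2 = 1.
  rewrite !sqr_sqrtr ?invr_ge0 ?divr_ge0//.
  by rewrite -[X in _ + X]mul1r -mulrDl -natr1 -natr1 -natr1; field; rewrite natr1 natr1.
have kl : k != (k + l).+1 by rewrite -addnS -{1}[k]addn0 eqn_add2l.
exists (rotate_pair c s k (k + l).+1 X'); split.
- exact: iid_normal_rotate_pair.
- move=> w; rewrite /rotate_pair eqxx X'k (X'j (k + l).+1) ?ltnSn ?orbT//.
  rewrite addnS (big_nat_recr (k + l).+1)//=; last by rewrite leqW// leq_addr.
  rewrite mulrDl; congr (_ + _).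
    rewrite mulrCA; congr (_ * _).
    rewrite /c sqrtrM// sqrtrV// mulrAC mulfV ?mul1r//.
  by rewrite /s sqrtrV// mulrC.
- move=> j h; have jk : j == k = false.
    by apply/negbTE; apply: contraTneq h => ->; rewrite ltnn/= -leqNgt leq_addr.
  have jl : j == (k + l).+1 = false.
    apply/negbTE; apply: contraTneq h => ->.
    by rewrite addnS ltnn orbF -leqNgt leqW// leq_addr.
  apply/funext => w; rewrite /rotate_pair jk jl X'j//.
  by case/orP: h => [->//|]; rewrite addnS => /ltnW ->; rewrite orbT.
Qed.

Lemma iid_normal_merge_blocks (X : nat -> T -> R) (kap : nat -> nat) (m : nat) :
  iid_normal P X -> (forall i, (i < m)%N -> (kap i < kap i.+1)%N) ->
  exists X' : nat -> T -> R, [/\ iid_normal P X',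
    (forall i w, (i < m)%N -> X' (kap i) w =
       (\sum_(kap i <= j < kap i.+1) X j w) / Num.sqrt (kap i.+1 - kap i)%:R) &
    forall j, (kap m <= j)%N -> X' j = X j].
Proof.
move=> iX; elim: m => [|m IH] km; first by exists X.
have [X' [iX' X'b X'j]] := IH (fun i im => km i (ltnW im)).
have kmm := km m (ltnSn m).
pose l := (kap m.+1 - kap m).-1.
have lE : (kap m.+1 - kap m)%N = l.+1 by rewrite /l prednK// subn_gt0.
have klE : (kap m + l).+1 = kap m.+1 by rewrite -addnS -lE subnKC// ltnW.
have kmono i : (i < m)%N -> (kap i < kap m)%N.
  move=> im; have kle j : (j <= m - i.+1)%N -> (kap i < kap (i.+1 + j))%N.
    elim: j => [|j IHj] jm; first by rewrite addn0; apply: km; rewrite ltnS ltnW.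
    apply: ltn_trans (IHj (ltnW jm)) _; rewrite addnS; apply: km.
    by move: jm im; lia.
  by have := kle _ (leqnn _); rewrite subnKC.
have [X'' [iX'' X''k X''j]] := iid_normal_merge_block (kap m) l iX'.
exists X''; split => //.
- move=> i w; rewrite ltnS leq_eqVlt => /orP[/eqP->|im].
    rewrite X''k lE klE; congr (_ / _).
    by apply: eq_big_nat => j /andP[mj _]; rewrite X'j.
  by rewrite X''j ?kmono// X'b.
- move=> j mj; rewrite X''j; last by rewrite -ltnS klE ltnS mj orbT.
  by rewrite X'j// (leq_trans (ltnW kmm)).
Qed.

Lemma iid_normal_block_sums (X : nat -> T -> R) (kap : nat -> nat) (m : nat) :
  iid_normal P X -> (forall i, (i < m)%N -> (kap i < kap i.+1)%N) ->
  iid_normal P (fun (i : 'I_m) w =>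
     (\sum_(kap i <= j < kap i.+1) X j w) / Num.sqrt (kap i.+1 - kap i)%:R).
Proof.
move=> iX km; have [X' [iX' X'b _]] := iid_normal_merge_blocks iX km.
have kmono (i j : nat) : (i < j)%N -> (j < m)%N -> (kap i < kap j)%N.
  elim: j => // j IHj; rewrite ltnS leq_eqVlt => /orP[/eqP->|ij] jm.
    by apply: km; exact: ltnW.
  by apply: ltn_trans (IHj ij (ltnW jm)) _; apply: km; exact: ltnW.
pose f (i : 'I_m) := kap i.
have injf : injective f.
  move=> i j; rewrite /f => fij; apply/val_inj => /=.
  case: (ltngtP i j) => // h.
    by have := kmono _ _ h (ltn_ord j); rewrite fij ltnn.
  by have := kmono _ _ h (ltn_ord i); rewrite fij ltnn.
have := iid_normal_reindex injf iX'.
rewrite [X in iid_normal P X](_ : _ = fun (i : 'I_m) w =>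
     (\sum_(kap i <= j < kap i.+1) X j w) / Num.sqrt (kap i.+1 - kap i)%:R)//.
by apply/funext => i; apply/funext => w /=; rewrite /f X'b.
Qed.

(* Row 0 holds the normalized increments of the current level; row [m] with
   [0 < m] holds fresh noise, row 1 being consumed by the next refinement. *)
Definition levy_step (Y : nat * nat -> T -> R) : nat * nat -> T -> R :=
  fun p w =>
  if p.1 is 0 then
    if odd p.2 then (Num.sqrt 2)^-1 * Y (0, p.2./2)%N w - (Num.sqrt 2)^-1 * Y (1, p.2./2)%N w
    else (Num.sqrt 2)^-1 * Y (1, p.2./2)%N w + (Num.sqrt 2)^-1 * Y (0, p.2./2)%N w
  else Y (p.1.+1, p.2) w.

(** [levy_step] transforms infinitely many pairs at once. This is its effect on the first [J] pairs,
    up to relabelling, as a composition of finitely many plane rotations; row 1 comes first in each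
    pair, so it receives the normalized sum and row 0 the normalized difference. *)
Fixpoint rotate_rows (J : nat) (Y : nat * nat -> T -> R) : nat * nat -> T -> R :=
  if J is j.+1 then
    rotate_pair (Num.sqrt 2)^-1 (Num.sqrt 2)^-1 (1, j)%N (0, j)%N (rotate_rows j Y)
  else Y.

Lemma iid_normal_rotate_rows J Y : iid_normal P Y -> iid_normal P (rotate_rows J Y).
Proof.
move=> iY; elim: J => //= j IH; apply: iid_normal_rotate_pair => //.
by rewrite exprVn sqr_sqrtr//; field.
Qed.

Lemma rotate_rowsE J Y p w : rotate_rows J Y p w =
  if (p.2 < J)%N then
    match p.1 with
    | 0 => (Num.sqrt 2)^-1 * Y (0, p.2)%N w - (Num.sqrt 2)^-1 * Y (1, p.2)%N w
    | 1 => (Num.sqrt 2)^-1 * Y (1, p.2)%N w + (Num.sqrt 2)^-1 * Y (0, p.2)%N w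
    | _ => Y p w
    end
  else Y p w.
Proof.
elim: J p => [|J IH] [a b] //=.
rewrite /rotate_pair !IH /= !xpair_eqE ltnn.
case: (ltngtP b J) => [bJ|Jb|->]; rewrite ?andbF ?andbT ?ltnS.
- by rewrite (ltnW bJ).
- by rewrite leqNgt Jb.
- by rewrite leqnn; case: a => [|[|a]].
Qed.

(** Finitely many indices involve only finitely many pairs, so there [levy_step Y] is
    [rotate_rows J Y] read through the injection [g]: even places of row 0 come from row 1, odd
    places from row 0, and fresh rows move by one. *)
Lemma iid_normal_levy_step Y : iid_normal P Y -> iid_normal P (levy_step Y).
Proof.
move=> iY.
pose g (p : nat * nat) := if p.1 is 0 then
  (if odd p.2 then (0, p.2./2)%N else (1, p.2./2)%N) else (p.1.+1, p.2).
have injg : injective g.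
  move=> [[|a] b] [[|a'] b']; rewrite /g /=.
  - case: (boolP (odd b)) => ob; case: (boolP (odd b')) => ob' // [] e;
      by rewrite -[b]odd_double_half -[b']odd_double_half e (negbTE ob) (negbTE ob') || rewrite -[b]odd_double_half -[b']odd_double_half e ob ob'.
  - by case: ifP.
  - by case: ifP.
  - by move=> [-> ->].
have stepE J p w : (p.2 < J)%N -> levy_step Y p w = rotate_rows J Y (g p) w.
  case: p => [[|a] b] /= bJ; rewrite rotate_rowsE /levy_step /g /=; last first.
    by case: ifP.
  have hJ : (b./2 < J)%N by apply: leq_ltn_trans bJ; rewrite -divn2 leq_div.
  by case: ifP => _ /=; rewrite hJ.
split=> [p|s us B mB].
  have -> : levy_step Y p = rotate_rows p.2.+1 Y (g p).
    by apply/funext => w; rewrite (stepE p.2.+1).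
  by have [] := iid_normal_rotate_rows p.2.+1 iY.
pose J := (\max_(p <- s) p.2).+1.
have [_ h] := iid_normal_reindex injg (iid_normal_rotate_rows J iY).
rewrite -(h s us B mB); congr (P _); apply: eq_big_seq => p ps.
apply/funext => w; rewrite /preimage /=; rewrite (stepE J)// ltnS.
exact: (@leq_bigmax_seq _ s xpredT snd).
Qed.

Variable Z : nat * nat -> T -> R.
Hypothesis iidZ : iid_normal P Z.

Definition levy_incr (n j : nat) (w : T) : R := iter n levy_step Z (0, j)%N w.

Lemma iid_levy_incr n : iid_normal P (levy_incr n).
Proof.
have iY : iid_normal P (iter n levy_step Z).
  by elim: n => [//|n IH]; exact: iid_normal_levy_step.
have injf : injective (fun j : nat => (0%N, j)) by move=> i j [].
exact: (iid_normal_reindex injf iY).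
Qed.

Lemma levy_incr_sum n j w :
  levy_incr n.+1 j.*2 w + levy_incr n.+1 j.*2.+1 w = Num.sqrt 2 * levy_incr n j w.
Proof.
rewrite /levy_incr /= /levy_step /= odd_double /= uphalf_double half_double.
set a := iter n _ _ _ _; set b := iter n _ _ _ _.
have s2 : (Num.sqrt 2 : R) ^+ 2 = 2 by rewrite sqr_sqrtr.
have s0 : (Num.sqrt 2 : R) != 0 by rewrite gt_eqF// sqrtr_gt0.
transitivity (2 * (Num.sqrt 2)^-1 * b); first by ring.
by rewrite -{1}s2; congr (_ * _); field.
Qed.

End levy_construction.

(** * Gaussian tail bounds *)

Section gaussian_tails.
Context (R : realType).
Notation mu := (@lebesgue_measure R).
Notation N01 := (@normal_prob R 0 1).
Local Open Scope ereal_scope.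

Lemma normal_prob_scale (s : R) (B : set R) : (0 < s)%R -> measurable B ->
  normal_prob 0 s B = N01 [set x | B (s * x)%R].
Proof.
move=> s0 mB; have sn0 : s != 0%R by rewrite gt_eqF.
have mB' : measurable [set x | B (s * x)%R].
  rewrite -[X in measurable X]setTI.
  have ms : measurable_fun setT (fun x : R => s * x)%R by exact: measurable_funM.
  exact: (ms measurableT B mB).
rewrite normal_prob01E// /normal_prob integral_mkcond.
have mf : measurable_fun setT ((fun x => (normal_pdf 0 s x)%:E) \_ B).
  apply/(measurable_restrictT _ mB); apply/measurable_EFinP.
  by apply: measurable_funTS; exact: measurable_normal_pdf.
rewrite [LHS](@ge0_integral_affine R s 0)//; last first.
  by move=> x; rewrite patchE; case: ifP => // _; rewrite lee_fin normal_pdf_ge0.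
rewrite -ge0_integralZl//; last 3 first.
- have ms : measurable_fun setT (fun x : R => s * x + 0)%R.
    by apply: measurable_funD => //; exact: measurable_funM.
  exact: (measurableT_comp mf ms).
- by move=> x _; rewrite patchE; case: ifP => // _; rewrite lee_fin normal_pdf_ge0.
- by rewrite lee_fin ltW.
apply: eq_integral => x _; rewrite patchE indicE addr0.
have -> : (x \in [set x0 | B (s * x0)%R]) = ((s * x)%R \in B).
  by apply/idP/idP; rewrite !inE.
case: ifP => _; last by rewrite mule0 mul0r.
rewrite mul1r -EFinM; congr EFin; rewrite !normal_pdfE ?oner_eq0//.
rewrite mulrA /normal_peak /normal_fun !subr0 expr1n mul1r; congr (_ * expR _)%R.
  rewrite -mulrnAr sqrtrM ?sqr_ge0// sqrtr_sqr ger0_norm ?(ltW s0)// invfM.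
  by rewrite mulrA mulfV// mul1r.
by rewrite exprMn -mulNr -mulrnAr invfM; field.
Qed.

(** Half of the exponent [x^2 / 2] is spent on [a^2 / 4]; the other half is, up to [sqrt 2], the
    density of variance 2, whose mass is at most 1. *)
Lemma normal_prob01_abs_gt (a : R) : (0 <= a)%R ->
  N01 [set x | (a < `|x|)%R] <= (2 * expR (- (a ^+ 2 / 4)))%:E.
Proof.
move=> a0.
have mA : measurable [set x : R | (a < `|x|)%R].
  have mn : measurable_fun setT (fun x : R => `|x|%R) by exact: normr_measurable.
  rewrite -[X in measurable X]setTI.
  exact: (mn measurableT _ (measurable_ray a)).
set A := [set x | _] in mA *.
have s20 : (0 < Num.sqrt 2 :> R)%R by rewrite sqrtr_gt0.
have s2n : Num.sqrt 2 != 0%R :> R by rewrite gt_eqF.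
have key x : A x -> (normal_pdf 0 1 x)%:E <=
    (Num.sqrt 2 * expR (- (a ^+ 2 / 4)))%:E * (normal_pdf 0 (Num.sqrt 2) x)%:E.
  rewrite /A /= => ax; rewrite -EFinM lee_fin !normal_pdfE ?oner_eq0//.
  rewrite /normal_peak /normal_fun !subr0 expr1n mul1r sqr_sqrtr//.
  have -> : ((Num.sqrt (2 * pi *+ 2))^-1 = (Num.sqrt 2)^-1 * (Num.sqrt (pi *+ 2))^-1 :> R)%R.
    by rewrite -mulrnAr sqrtrM// invfM.
  rewrite [leRHS](_ : _ = (Num.sqrt (pi *+ 2))^-1 *
      (expR (- (a ^+ 2 / 4)) * expR (- x ^+ 2 / (2 *+ 2))))%R; last first.
    by set Q := (Num.sqrt (pi *+ 2))^-1%R; set E := expR _; set F := expR _; field.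
  rewrite ler_wpM2l ?invr_ge0 ?sqrtr_ge0// -expRD ler_expR.
  have : (a ^+ 2 <= x ^+ 2)%R.
    by rewrite -(real_normK (num_real x)) ler_sqr ?nnegrE// ltW.
  have -> : (2 *+ 2 = 4 :> R)%R by ring.
  lra.
apply: (@le_trans _ _ ((Num.sqrt 2 * expR (- (a ^+ 2 / 4)))%:E * normal_prob 0 (Num.sqrt 2) A)).
  have mp : measurable_fun A (fun x => (normal_pdf 0 (Num.sqrt 2) x)%:E).
    by apply/measurable_EFinP; apply: measurable_funTS; exact: measurable_normal_pdf.
  have p0 x : A x -> 0 <= (normal_pdf 0 (Num.sqrt 2) x)%:E.
    by move=> _; rewrite lee_fin normal_pdf_ge0.
  have c0 : 0 <= (Num.sqrt 2 * expR (- (a ^+ 2 / 4)))%:E :> \bar R.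
    by rewrite lee_fin mulr_ge0 ?expR_ge0 ?sqrtr_ge0.
  rewrite /normal_prob -ge0_integralZl//.
  apply: ge0_le_integral => //.
  - by move=> x _; rewrite lee_fin normal_pdf_ge0.
  - by apply/measurable_EFinP; apply: measurable_funTS; exact: measurable_normal_pdf.
  - under eq_fun do rewrite -EFinM; apply/measurable_EFinP.
    by apply: measurable_funM => //; apply: measurable_funTS; exact: measurable_normal_pdf.
apply: (@le_trans _ _ ((Num.sqrt 2 * expR (- (a ^+ 2 / 4)))%:E * 1)).
  apply: lee_wpmul2l; first by rewrite lee_fin mulr_ge0 ?expR_ge0 ?sqrtr_ge0.
  exact: probability_le1.
rewrite mule1 lee_fin ler_pM2r ?expR_gt0//.
by rewrite -[leRHS]ger0_norm// -sqrtr_sqr ler_sqrt; lra.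
Qed.

Let normal_prob01_unit_itv (b c : R) : (0 <= c)%R -> (- c <= b)%R -> (b + 1 <= c)%R ->
  (normal_pdf 0 1 0 * expR (- (c ^+ 2 / 2)))%:E <= N01 (`]b, (b + 1)%R[%classic : set R).
Proof.
move=> c0 cb bc; rewrite /normal_prob.
apply: (@le_trans _ _ (\int[mu]_(x in `]b, (b + 1)%R[%classic)
   (cst (normal_pdf 0 1 0 * expR (- (c ^+ 2 / 2)))%:E) x)).
  rewrite integral_cst//= lebesgue_measure_itv/= lte_fin ltrDl ltr01 -EFinB.
  by rewrite -EFinM addrAC subrr add0r mulr1.
apply: ge0_le_integral => //.
- by move=> x _; rewrite lee_fin mulr_ge0 ?expR_ge0 ?normal_pdf_ge0.
- by apply/measurable_EFinP; apply: measurable_funTS; exact: measurable_normal_pdf.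
move=> x /=; rewrite in_itv/= => /andP[ax xa]; rewrite lee_fin (normal_pdf01E x).
rewrite ler_wpM2l ?normal_pdf_ge0// ler_expR lerN2 ler_pM2r//.
by rewrite -[leLHS]real_normK ?num_real// ler_sqr ?nnegrE// ler_norml; apply/andP; split; lra.
Qed.

Lemma normal_prob01_gt (a : R) : (0 <= a)%R ->
  (normal_pdf 0 1 0 * expR (- ((a + 1) ^+ 2 / 2)))%:E <= N01 [set x | (a < x)%R].
Proof.
move=> a0; apply: le_trans (@normal_prob01_unit_itv a (a + 1)%R _ _ _) _; [lra|lra|lra|].
apply: le_measure; rewrite ?inE//; first exact: measurable_ray.
by move=> x /=; rewrite in_itv/= => /andP[].
Qed.

Lemma normal_prob01_lt (a : R) : (0 <= a)%R ->
  (normal_pdf 0 1 0 * expR (- ((a + 1) ^+ 2 / 2)))%:E <= N01 [set x | (x < - a)%R].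
Proof.
move=> a0; apply: le_trans (@normal_prob01_unit_itv (- a - 1)%R (a + 1)%R _ _ _) _; [lra|lra|lra|].
apply: le_measure; rewrite ?inE//.
  by rewrite (_ : [set x | _] = `]-oo, (- a)%R[%classic) //; apply/seteqP; split => x /=; rewrite in_itv.
by move=> x /=; rewrite in_itv/= subrK => /andP[].
Qed.

End gaussian_tails.

Lemma measurable_abs_gt (R : realType) (d : measure_display)
    (T : measurableType d) (f : T -> R) (a : R) : measurable_fun setT f ->
  measurable [set w | a < `|f w|].
Proof.
move=> mf; rewrite -[X in measurable X]setTI.
have mn : measurable_fun setT (fun w => `|f w|) by exact: measurableT_comp.
exact: (mn measurableT _ (measurable_ray a)).
Qed.

(** * Simultaneous control of all dyadic increments *)

Section levy_paths.
Context (R : realType) (d : measure_display) (T : measurableType d)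
  (P : probability T R) (Z : nat * nat -> T -> R).
Hypothesis iidZ : iid_normal P Z.
Notation th := (3 / 4 : R).

Definition raw_incr (n j : nat) (w : T) : R :=
  (Num.sqrt 2)^-1 ^+ n * levy_incr Z n j w.

(** The rate [3/4] lies strictly between [1 / sqrt 2], the scale of an increment per level, and 1.
    Being below 1 it makes increments summable over the levels; relative to the variance, the
    squared threshold grows like [(9/8)^n], which pays for the [2^n t] increments of level [n]. *)
Definition tame (D : nat -> nat -> T -> R) (t h : nat) : set T :=
  [set w | forall n j, (j < 2 ^ n * t)%N -> `|D n j w| <= h%:R * th ^+ n].

Lemma tameCE D t h : ~` tame D t h =
  \bigcup_n \bigcup_(j in `I_(2 ^ n * t)) [set w | h%:R * th ^+ n < `|D n j w|].
Proof.
apply/seteqP; split => w.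
  move=> /existsNP[n /existsNP[j /not_implyP[jn h1]]].
  by exists n => //; exists j => //=; rewrite ltNge; exact/negP.
move=> [n _ [j /= jn h1]] /(_ n j jn); rewrite leNgt; exact/negP/negPn.
Qed.

Lemma measurable_tame D t h : (forall n j, measurable_fun setT (D n j)) ->
  measurable (tame D t h).
Proof.
move=> mD; rewrite -[tame _ _ _]setCK; apply: measurableC; rewrite tameCE.
apply: bigcupT_measurable => n; apply: bigcup_measurable => j _.
exact: measurable_abs_gt.
Qed.

Lemma measurable_raw_incr n j : measurable_fun setT (raw_incr n j).
Proof.
apply: measurable_funM => //.
by have [mG _] := iid_levy_incr iidZ n; exact: mG.
Qed.

Lemma prob_bigcup_le (E : nat -> set T) (N : nat) (c : R) :
  (forall j, measurable (E j)) -> (forall j, (P (E j) <= c%:E)%E) ->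
  (P (\bigcup_(j in `I_N) E j) <= (N%:R * c)%:E)%E.
Proof.
move=> mE Ec; elim: N => [|N IH]; first by rewrite II0 bigcup_set0 measure0 mul0r.
rewrite IIS bigcup_setU bigcup_set1.
have mU : measurable (\bigcup_(j in `I_N) E j) by exact: bigcup_measurable.
apply: (@le_trans _ _ (P (\bigcup_(j in `I_N) E j) + P (E N))%E).
  by apply: measureU2 => //; exact: mE.
rewrite -natr1 mulrDl mul1r EFinD; apply: leeD; first exact: IH.
exact: Ec.
Qed.

Lemma expR2_ge4 : 4 <= expR 2 :> R.
Proof.
have h : 1 + 2^-1 <= expR 2^-1 :> R by exact: expR_ge1Dx.
have -> : (2 : R) = 2^-1 * 4%:R by field.
rewrite expRM_natr; apply: le_trans (lerXn2r 4 _ _ h); rewrite ?nnegrE ?expR_ge0//; lra.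
Qed.

(** By Bernoulli's inequality the exponent is at least [h^2 (1 + n/8) / 4]. As [h >= 8], the part
    depending on [n] is at least [2 n >= n ln 4], hence the factor [4^-n]; multiplied by the [2^n t]
    increments it is still summable. *)
Lemma prob_raw_incr_gt (h n j : nat) : (8 <= h)%N ->
  (P [set w | (h%:R * th ^+ n < `|raw_incr n j w|)%R] <=
   (2 * expR (- (h%:R ^+ 2 / 4)) * 4^-1 ^+ n)%:E)%E.
Proof.
move=> h8.
have s20 : 0 < Num.sqrt 2 :> R by rewrite sqrtr_gt0.
pose a : R := h%:R * (th * Num.sqrt 2) ^+ n.
have a0 : 0 <= a by rewrite mulr_ge0// exprn_ge0// mulr_ge0// ?divr_ge0// ltW.
have -> : [set w | h%:R * th ^+ n < `|raw_incr n j w|] =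
    levy_incr Z n j @^-1` [set x | a < `|x|].
  apply/seteqP; split => w; rewrite /preimage /= /raw_incr normrM ger0_norm ?exprn_ge0 ?invr_ge0 ?(ltW s20)//.
    by rewrite exprVn [X in _ < X]mulrC ltr_pdivlMr ?exprn_gt0// -mulrA -exprMn.
  by rewrite exprVn [X in _ -> _ < X]mulrC ltr_pdivlMr ?exprn_gt0// -mulrA -exprMn.
have [mG iG] := iid_levy_incr iidZ n.
have mA : measurable [set x : R | a < `|x|] by apply: measurable_abs_gt.
have := iG [:: j] isT (fun=> [set x | a < `|x|]) (fun=> mA).
rewrite !big_cons !big_nil setIT mule1 => ->.
apply: le_trans (normal_prob01_abs_gt a0) _; rewrite lee_fin -mulrA ler_pM2l//.
have e1 : 4^-1 ^+ n = expR (- ln 4 * n%:R) :> R.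
  by rewrite expRM_natr expRN lnK// posrE.
rewrite e1 -expRD ler_expR.
have a2 : a ^+ 2 = h%:R ^+ 2 * (9 / 8) ^+ n.
  rewrite /a exprMn -exprM mulnC exprM; congr (_ * _ ^+ n).
  by rewrite exprMn sqr_sqrtr//; field.
have bern : 1 + n%:R / 8 <= (9 / 8 : R) ^+ n.
  elim: n {a a0 mA mG iG e1 a2} => [|n IH]; first by rewrite expr0 mulr0n; lra.
  rewrite exprS -natr1; apply: (@le_trans _ _ (9 / 8 * (1 + n%:R / 8))).
    by have n0 : 0 <= n%:R :> R by []; lra.
  by rewrite ler_pM2l//; lra.
have h64 : (64 : R) <= h%:R ^+ 2.
  have : (8 : R) <= h%:R by rewrite ler_nat.
  by move=> h8'; nra.
have ln4 : ln 4 <= 2 :> R by rewrite -[leRHS]expRK ler_ln ?posrE ?expR_gt0// expR2_ge4.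
have n0 : 0 <= n%:R :> R by [].
have k1 : h%:R ^+ 2 * (1 + n%:R / 8) <= a ^+ 2.
  by rewrite a2 ler_wpM2l// sqr_ge0.
have k2 : 64 * (n%:R : R) <= h%:R ^+ 2 * n%:R by rewrite ler_wpM2r.
have k3 : ln 4 * (n%:R : R) <= 2 * n%:R by rewrite ler_wpM2r.
lra.
Qed.

Lemma prob_tameC (t h : nat) : (8 <= h)%N ->
  (P (~` tame raw_incr t h) <= (4 * t%:R * expR (- (h%:R ^+ 2 / 4)))%:E)%E.
Proof.
move=> h8; rewrite tameCE.
set c := expR (- (h%:R ^+ 2 / 4)).
have mE n j : measurable [set w | h%:R * th ^+ n < `|raw_incr n j w|].
  exact/measurable_abs_gt/measurable_raw_incr.
have mU n : measurable (\bigcup_(j in `I_(2 ^ n * t)) [set w | h%:R * th ^+ n < `|raw_incr n j w|]).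
  by apply: bigcup_measurable => j _; exact: mE.
apply: (@le_trans _ _ (\sum_(0 <= n <oo) P (\bigcup_(j in `I_(2 ^ n * t))
    [set w | h%:R * th ^+ n < `|raw_incr n j w|]%R))%E).
  by apply: measure_sigma_subadditive => //; exact: bigcupT_measurable.
apply: (@le_trans _ _ (\sum_(0 <= n <oo) ((4 * t%:R * c) / (2 ^ n.+1)%:R)%:E)%E).
  apply: lee_nneseries => [n _ _|n _]; first exact: measure_ge0.
  apply: (@le_trans _ _ ((2 ^ n * t)%:R * (2 * c * 4^-1 ^+ n))%:E).
    apply: (prob_bigcup_le _ (mE n)) => j; exact: prob_raw_incr_gt.
  rewrite lee_fin natrM !natrX -/c le_eqVlt; apply/orP; left; apply/eqP.
  have -> : 4^-1 ^+ n = (2 ^+ n)^-1 * (2 ^+ n)^-1 :> R.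
    by rewrite -invfM -exprMn exprVn; congr (_ ^+ n)^-1; ring.
  by rewrite exprS; field; rewrite expf_neq0.
apply: (@epsilon_trick0 R _ xpredT).
by rewrite !mulr_ge0// expR_ge0.
Qed.

Definition tame_eventually : set T := \bigcap_t \bigcup_h tame raw_incr t h.

Lemma measurable_tame_eventually : measurable tame_eventually.
Proof.
apply: bigcapT_measurable => t; apply: bigcupT_measurable => h.
by apply: measurable_tame => n j; exact: measurable_raw_incr.
Qed.

Lemma prob_tame_eventually : P tame_eventually = 1%E.
Proof.
have mt t h : measurable (tame raw_incr t h).
  by apply: measurable_tame => n j; exact: measurable_raw_incr.
have mU t : measurable (\bigcup_h tame raw_incr t h) by exact: bigcupT_measurable.
have z t : P (~` \bigcup_h tame raw_incr t h) = 0%E.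
  apply/eqP; rewrite eq_le; apply/andP; split; last exact: measure_ge0.
  apply/lee_addgt0Pr => e e0; rewrite add0e.
  have [h h8 he] : exists2 h : nat, (8 <= h)%N & 4 * t%:R * expR (- (h%:R ^+ 2 / 4)) <= e.
    pose x := 4 * t%:R / e.
    have x0 : 0 <= x by rewrite divr_ge0 ?mulr_ge0// ltW.
    exists (Num.bound x + 8)%N; first by rewrite leq_addl.
    set h := (Num.bound x + 8)%N.
    rewrite expRN ler_pdivrMr ?expR_gt0// [leRHS]mulrC -ler_pdivrMr// -/x.
    have xh : x <= h%:R by rewrite natrD; have := archi_boundP x0; lra.
    apply: le_trans xh _.
    have h8 : (8 : R) <= h%:R by rewrite ler_nat leq_addl.
    have := @expR_ge1Dx R (h%:R ^+ 2 / 4).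
    have : 8 * h%:R <= h%:R ^+ 2 :> R by rewrite expr2 ler_wpM2r//; lra.
    lra.
  apply: (@le_trans _ _ (P (~` tame raw_incr t h))).
    apply: le_measure; rewrite ?inE; [exact: measurableC|exact: measurableC|].
    by apply: subsetC => w hw; exists h.
  by apply: le_trans (prob_tameC t h8) _; rewrite lee_fin.
have zD : P (~` tame_eventually) = 0%E.
  apply/eqP; rewrite eq_le; apply/andP; split; last exact: measure_ge0.
  rewrite /tame_eventually setC_bigcap.
  apply: (@le_trans _ _ (\sum_(0 <= t <oo) P (~` \bigcup_h tame raw_incr t h))%E).
    apply: measure_sigma_subadditive => //.
      by move=> n; exact: measurableC.
    by apply: bigcupT_measurable => n; exact: measurableC.
  by rewrite eseries0.
have := probability_setC P measurable_tame_eventually; rewrite zD => h.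
have : P tame_eventually \is a fin_num by apply: fin_num_measure; exact: measurable_tame_eventually.
move: h; case: (P tame_eventually) => [r| |]//= [] h _; congr EFin.
by move: h => /esym/eqP; rewrite subr_eq0 => /eqP.
Qed.

(* Replacing the increments by 0 on a null set makes every path tame. *)
Definition incr (n j : nat) (w : T) : R :=
  (Num.sqrt 2)^-1 ^+ n * (levy_incr Z n j w * \1_tame_eventually w).

Lemma incrE n j w : incr n j w = raw_incr n j w * \1_tame_eventually w.
Proof. by rewrite /incr mulrA. Qed.

Lemma incr_sum n j w : incr n.+1 j.*2 w + incr n.+1 j.*2.+1 w = incr n j w.
Proof.
rewrite /incr -mulrDr -mulrDl levy_incr_sum exprS.
have s0 : (Num.sqrt 2 : R) != 0 by rewrite gt_eqF// sqrtr_gt0.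
by field.
Qed.

Lemma iid_incr n : iid_normal P (fun j w => levy_incr Z n j w * \1_tame_eventually w).
Proof.
apply: iid_normal_ae; first exact: measurable_tame_eventually.
  exact: prob_tame_eventually.
exact: iid_levy_incr.
Qed.

Lemma measurable_incr n j : measurable_fun setT (incr n j).
Proof. by apply: measurable_funM => //; have [mX _] := iid_incr n; exact: mX. Qed.

Lemma tame_incr t h : tame raw_incr t h `<=` tame incr t h.
Proof.
move=> w hw n j jn; apply: le_trans (hw n j jn).
rewrite incrE normrM ler_piMr// indicE; case: (_ \in _); rewrite ?normr1 ?normr0//.
Qed.

Lemma tame_incr_ex t w : exists h, tame incr t h w.
Proof.
have [Dw|nDw] := pselect (tame_eventually w).
  by have [h _ hw] := Dw t I; exists h; exact: tame_incr.
exists 0%N => n j _; rewrite incrE indicE memNset// mulr0 normr0.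
by rewrite mul0r.
Qed.

End levy_paths.

(** * Continuous paths from dyadic increments *)

(** With [e n] the tail of the geometric series, [u - e] is nondecreasing and [u + e] nonincreasing;
    this squeeze gives the limit and the error bound together. *)
Lemma geometric_cauchy (R : realType) (u : R^nat) (M q : R) :
  0 <= M -> 0 <= q -> q < 1 -> (forall n, `|u n.+1 - u n| <= M * q ^+ n) ->
  cvgn u /\ forall n, `|limn u - u n| <= M * q ^+ n / (1 - q).
Proof.
move=> M0 q0 q1 hu.
have q1' : 0 < 1 - q by rewrite subr_gt0.
pose e n := M * q ^+ n / (1 - q).
have eS n : e n = M * q ^+ n + e n.+1.
  by rewrite /e exprS; field; rewrite gt_eqF.
have e0 n : 0 <= e n by rewrite divr_ge0 ?mulr_ge0 ?exprn_ge0// ltW.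
have ce : e @ \oo --> (0 : R).
  have -> : e = fun n => (M / (1 - q)) * q ^+ n.
    by apply/funext => n; rewrite /e mulrAC.
  rewrite -[X in _ --> X](mulr0 (M / (1 - q))); apply: cvgM; first exact: cvg_cst.
  by apply: cvg_expr; rewrite ger0_norm.
pose v n := u n + e n; pose l n := u n - e n.
have vni : nonincreasing_seq v.
  apply/nonincreasing_seqP => n; rewrite /v (eS n).
  by have := ler_norm (u n.+1 - u n); have := hu n; lra.
have lnd : nondecreasing_seq l.
  apply/nondecreasing_seqP => n; rewrite /l (eS n).
  by have := ler_norm (u n - u n.+1); rewrite distrC; have := hu n; lra.
have cv : cvgn v.
  apply: nonincreasing_is_cvgn => //; exists (l 0%N) => _ [n _ <-].
  by apply: le_trans (lnd 0%N n (leq0n n)) _; rewrite /l /v; have := e0 n; lra.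
have cu : u @ \oo --> limn v.
  have -> : u = fun n => v n - e n by apply/funext => n; rewrite /v addrK.
  by rewrite -[X in _ --> X](subr0 (limn v)); apply: cvgB.
have cl : l @ \oo --> limn v.
  by rewrite -[X in _ --> X](subr0 (limn v)); apply: cvgB.
split; first by apply/cvg_ex; exists (limn v).
move=> n; rewrite (cvg_lim _ cu)// ler_distl -/(e n); apply/andP; split.
  rewrite -(cvg_lim _ cl)//; apply: (nondecreasing_cvgn_le lnd).
  by apply/cvg_ex; exists (limn v).
exact: (nonincreasing_cvgn_ge vni).
Qed.

Section dyadic_path.
Context (R : realType) (D : nat -> nat -> R).
Hypothesis Dsum : forall n j, D n.+1 j.*2 + D n.+1 j.*2.+1 = D n j.
Notation th := (3 / 4 : R).

Definition dyadic_sum (n k : nat) : R := \sum_(0 <= j < k) D n j.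

(** The limit is taken at every real [t], along the largest dyadic points below it, so no extension
    from dyadic times is required. *)
Definition dyadic_path (t : R) : R :=
  limn (fun n => dyadic_sum n (Num.truncn (2 ^+ n * t))).

Lemma dyadic_sum_double n k : dyadic_sum n.+1 k.*2 = dyadic_sum n k.
Proof.
elim: k => [|k IH]; first by rewrite /dyadic_sum !big_nil.
by rewrite /dyadic_sum doubleS !big_nat_recr//= -addrA Dsum -/(dyadic_sum _ _) IH.
Qed.

Lemma dyadic_sum_refine n (t : R) : 0 <= t ->
  dyadic_sum n.+1 (Num.truncn (2 ^+ n.+1 * t)) = dyadic_sum n (Num.truncn (2 ^+ n * t)) \/
  [/\ (Num.truncn (2 ^+ n.+1 * t)) = (Num.truncn (2 ^+ n * t)).*2.+1 &
   dyadic_sum n.+1 (Num.truncn (2 ^+ n.+1 * t)) = dyadic_sum n (Num.truncn (2 ^+ n * t))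
     + D n.+1 (Num.truncn (2 ^+ n * t)).*2].
Proof.
move=> t0; set k := Num.truncn (2 ^+ n * t).
have x0 : 0 <= 2 ^+ n * t by rewrite mulr_ge0// exprn_ge0.
have /andP[k1 k2] := truncn_itv x0; rewrite -/k in k1 k2.
have y0 : 0 <= 2 ^+ n.+1 * t by rewrite mulr_ge0// exprn_ge0.
have yE : 2 ^+ n.+1 * t = 2 * (2 ^+ n * t) by rewrite exprS mulrA.
have [h|h] := ltP (2 ^+ n.+1 * t) (k.*2.+1)%:R.
  left; have -> : Num.truncn (2 ^+ n.+1 * t) = k.*2.
    apply/eqP; rewrite truncn_eq// h andbT yE -muln2 natrM; lra.
  exact: dyadic_sum_double.
right; have e : Num.truncn (2 ^+ n.+1 * t) = k.*2.+1.
  apply/eqP; rewrite truncn_eq// h /= yE.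
  have -> : (k.*2.+2)%:R = 2 * k.+1%:R :> R by rewrite -doubleS -muln2 natrM mulrC.
  by rewrite ltr_pM2l.
by split => //; rewrite e /dyadic_sum big_nat_recr//= -/(dyadic_sum _ _) dyadic_sum_double.
Qed.

Definition tame_array (t h : nat) :=
  forall n j, (j < 2 ^ n * t)%N -> `|D n j| <= h%:R * th ^+ n.

(** Passing to the next level adds at most one increment of that level. The factor 3 is
    [(3/4) / (1 - 3/4)]. *)
Lemma dyadic_path_cvg (T h : nat) (t : R) : tame_array T h -> 0 <= t -> t <= T%:R ->
  cvgn (fun n => dyadic_sum n (Num.truncn (2 ^+ n * t))) /\
  forall n, `|dyadic_path t - dyadic_sum n (Num.truncn (2 ^+ n * t))| <= 3 * h%:R * th ^+ n.
Proof.
move=> hD t0 tT.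
have M0 : 0 <= h%:R * th by rewrite mulr_ge0// divr_ge0.
have [||||cu bu] := @geometric_cauchy R (fun n => dyadic_sum n (Num.truncn (2 ^+ n * t))) (h%:R * th) th.
- exact: M0.
- by lra.
- by lra.
- move=> n; have [->|[kE ->]] := dyadic_sum_refine n t0.
    by rewrite subrr normr0 mulr_ge0// exprn_ge0//; lra.
  rewrite addrC addKr -mulrA -exprS; apply: hD.
  rewrite -ltnS -kE ltnS truncn_le_nat.
  apply: (@le_lt_trans _ _ (2 ^ n.+1 * T)%:R); last by rewrite ltr_nat.
  by rewrite natrM natrX ler_wpM2l// exprn_ge0.
split => // n; apply: le_trans (bu n) _.
have -> : 1 - th = 4^-1 by field.
by rewrite invrK; lra.
Qed.

(** The dyadic points of level [n] below [s] and [t] are equal or adjacent, so [7 = 3 + 1 + 3]: one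
    increment and two approximation errors. *)
Lemma dyadic_path_modulus (T h n : nat) (s t : R) : tame_array T h ->
  0 <= s -> s <= t -> t <= T%:R -> t - s <= (2 ^+ n)^-1 ->
  `|dyadic_path t - dyadic_path s| <= 7 * h%:R * th ^+ n.
Proof.
move=> hD s0 st tT ts.
have [_ /(_ n) ht] := dyadic_path_cvg hD (le_trans s0 st) tT.
have [_ /(_ n) hs] := dyadic_path_cvg hD s0 (le_trans st tT).
set a := Num.truncn (2 ^+ n * t) in ht *; set b := Num.truncn (2 ^+ n * s) in hs *.
have p0 : 0 < 2 ^+ n :> R by rewrite exprn_gt0.
have x0 : 0 <= 2 ^+ n * s by rewrite mulr_ge0// ltW.
have y0 : 0 <= 2 ^+ n * t by apply: mulr_ge0; [exact: ltW|exact: le_trans st].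
have /andP[b1 b2] := truncn_itv x0; rewrite -/b in b1 b2.
have /andP[a1 a2] := truncn_itv y0; rewrite -/a in a1 a2.
have xy : 2 ^+ n * t <= 2 ^+ n * s + 1.
  have := ts; rewrite -(ler_pM2l p0) mulfV ?gt_eqF// mulrBr; lra.
have xy' : 2 ^+ n * s <= 2 ^+ n * t by rewrite ler_pM2l.
have ba : (b <= a)%N by rewrite /a /b le_truncn.
have ab : (a <= b.+1)%N.
  rewrite -ltnS -(ltr_nat R); apply: le_lt_trans a1 _; apply: le_lt_trans xy _.
  by rewrite -[in ltRHS]natr1 ltrD2r.
have q0 : 0 <= h%:R * th ^+ n by rewrite mulr_ge0// exprn_ge0//; lra.
have dab : `|dyadic_sum n a - dyadic_sum n b| <= h%:R * th ^+ n.
  move: ba; rewrite leq_eqVlt => /orP[/eqP->|ba]; first by rewrite subrr normr0.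
  have aE : a = b.+1 by apply/eqP; rewrite eqn_leq ab ba.
  have -> : dyadic_sum n a = dyadic_sum n b + D n b.
    by rewrite aE /dyadic_sum big_nat_recr.
  rewrite addrC addKr; apply: hD.
  rewrite -ltnS -aE ltnS -(ler_nat R); apply: le_trans a1 _.
  by rewrite natrM natrX ler_wpM2l// ltW.
have -> : dyadic_path t - dyadic_path s = (dyadic_path t - dyadic_sum n a) +
    (dyadic_sum n a - dyadic_sum n b) - (dyadic_path s - dyadic_sum n b) by ring.
apply: le_trans (ler_normB _ _) _; apply: le_trans (lerD (ler_normD _ _) (lexx _)) _.
lra.
Qed.

Lemma dyadic_path0 : dyadic_path 0 = 0.
Proof.
rewrite /dyadic_path (_ : (fun n => _) = cst 0); first by rewrite lim_cst.
by apply/funext => n; rewrite mulr0 truncn0 /dyadic_sum big_nil.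
Qed.

Lemma dyadic_path_neg (t : R) : t <= 0 -> dyadic_path t = 0.
Proof.
move=> t0; rewrite /dyadic_path (_ : (fun n => _) = cst 0); first by rewrite lim_cst.
apply/funext => n; rewrite (_ : Num.truncn _ = 0%N) ?/dyadic_sum ?big_nil//.
apply/eqP; rewrite -leqn0 truncn_le_nat (le_lt_trans _ ltr01)//.
by rewrite mulr_ge0_le0// exprn_ge0.
Qed.

Hypothesis Dtame : forall t, exists h, tame_array t h.

Lemma dyadic_path_continuous : {within `[0, +oo[, continuous dyadic_path}.
Proof.
apply/subspace_continuousP => t /=; rewrite in_itv/= andbT => t0.
pose T := (Num.bound t).+1.
have tT : t + 1 <= T%:R by rewrite -natr1 lerD2r ltW// archi_boundP.
have [h hT] := Dtame T.
apply/cvgrPdist_le => e e0.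
have [n hn] : exists n, 7 * h%:R * th ^+ n <= e.
  have c : (fun n => 7 * h%:R * th ^+ n) @ \oo --> (0 : R).
    rewrite -[X in _ --> X](mulr0 (7 * h%:R)); apply: cvgM; first exact: cvg_cst.
    by apply: cvg_expr; rewrite ger0_norm; lra.
  have [n _ /(_ n (leqnn n)) hn] := cvgr_le _ c _ e0.
  by exists n.
have p0 : 0 < (2 ^+ n)^-1 :> R by rewrite invr_gt0 exprn_gt0.
have p1 : (2 ^+ n)^-1 <= 1 :> R by rewrite invf_le1 ?exprn_gt0// exprn_ege1// ler1n.
rewrite near_withinE; near=> s => /=; rewrite in_itv/= andbT => s0.
have ts : `|t - s| < (2 ^+ n)^-1.
  by near: s; move/cvgrPdist_lt : (@cvg_id R (nbhs t)); apply.
apply: le_trans hn; have [st|ts'] := leP s t.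
  by apply: (dyadic_path_modulus hT) => //; [lra|rewrite ger0_norm ?subr_ge0// in ts; exact: ltW].
rewrite distrC; apply: (dyadic_path_modulus hT) => //; first exact: ltW.
  by move: ts; rewrite ltr0_norm ?subr_lt0//; lra.
by move: ts; rewrite ltr0_norm ?subr_lt0//; lra.
Unshelve. all: by end_near. Qed.

End dyadic_path.

(** * Brownian motion with tame paths *)

Lemma exp_half_small (R : realType) (e : R) : 0 < e ->
  exists N, forall n, (N <= n)%N -> (2 ^+ n)^-1 <= e.
Proof.
move=> e0; have c : (fun n => (2^-1) ^+ n) @ \oo --> (0 : R).
  by apply: cvg_expr; rewrite ger0_norm; lra.
have [N _ H] := cvgr_le _ c _ e0; exists N => n Nn.
by rewrite -exprVn; exact: H.
Qed.

Section levy_brownian.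
Context (R : realType) (d : measure_display) (T : measurableType d)
  (P : probability T R) (Z : nat * nat -> T -> R).
Hypothesis iidZ : iid_normal P Z.

Definition levy_path (t : R) (w : T) : R :=
  dyadic_path (fun n j => incr Z n j w) t.

Let tame_w t w : exists h, tame_array (fun n j => incr Z n j w) t h.
Proof. exact: tame_incr_ex. Qed.

Lemma levy_path_cvg t w : 0 <= t ->
  dyadic_sum (fun n j => incr Z n j w) n (Num.truncn (2 ^+ n * t)) @[n --> \oo]
  --> levy_path t w.
Proof.
move=> t0; have [h hT] := tame_w (Num.bound t) w.
have [] // := @dyadic_path_cvg R _ _ (Num.bound t) h t hT.
  by move=> n j; exact: incr_sum.
by apply: ltW; exact: archi_boundP.
Qed.

Lemma measurable_levy_path t : measurable_fun setT (levy_path t).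
Proof.
have [t0|t0] := leP 0 t; last first.
  rewrite (_ : levy_path t = cst 0)//.
  by apply/funext => w; rewrite /levy_path dyadic_path_neg// ltW.
apply: (measurable_fun_pw_cvg (f_ := fun n w =>
  dyadic_sum (fun n j => incr Z n j w) n (Num.truncn (2 ^+ n * t)))); last first.
  by move=> w; exact: levy_path_cvg.
move=> n; rewrite /dyadic_sum.
by apply: measurable_sum => j; exact: (measurable_incr iidZ n j).
Qed.

Lemma cvg_truncn_div (t : R) : 0 <= t ->
  (Num.truncn (2 ^+ n * t))%:R / 2 ^+ n @[n --> \oo] --> t.
Proof.
move=> t0; apply/cvgrPdist_le => e e0.
have [N HN] := exp_half_small e0; exists N => // n /= Nn; have hn := HN n Nn.
have p0 : 0 < 2 ^+ n :> R by rewrite exprn_gt0.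
have /andP[a1 a2] := truncn_itv (mulr_ge0 (ltW p0) t0).
have h1 : (Num.truncn (2 ^+ n * t))%:R / 2 ^+ n <= t by rewrite ler_pdivrMr// [leRHS]mulrC.
rewrite ger0_norm ?subr_ge0//; apply: le_trans hn.
rewrite lerBlDr (_ : _ + _ = (Num.truncn (2 ^+ n * t)).+1%:R / 2 ^+ n).
  by rewrite ler_pdivlMr// [leLHS]mulrC ltW.
by rewrite -[(Num.truncn (2 ^+ n * t)).+1%:R]natr1 mulrDl mul1r addrC.
Qed.

(** At level [n] the increments are sums over consecutive blocks of independent normal variables,
    cut at [kap n i]. Normalized by the block length they are exactly independent standard normal,
    and they converge pointwise to the normalized increments of the path. *)
Lemma levy_path_fdd (m : nat) (s : nat -> R) (B : nat -> set R) :
  0 <= s 0%N -> (forall i, s i < s i.+1) -> (forall i, measurable (B i)) ->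
  P (\bigcap_(i in `I_m) [set w | B i (levy_path (s i.+1) w - levy_path (s i) w)])
  = (\prod_(i < m) normal_prob 0 (Num.sqrt (s i.+1 - s i)) (B i))%E.
Proof.
move=> s00 sS mB.
have s0 i : 0 <= s i by elim: i => // i IH; exact: le_trans IH (ltW (sS i)).
pose kap n i := Num.truncn (2 ^+ n * s i).
have kapS : \forall n \near \oo, forall i, (i < m)%N -> (kap n i < kap n i.+1)%N.
  have one i : \forall n \near \oo, (kap n i < kap n i.+1)%N.
    have di0 : 0 < s i.+1 - s i by rewrite subr_gt0.
    have [N HN] := exp_half_small di0; exists N => // n /= Nn; have hn := HN n Nn.
    have p0 : 0 < 2 ^+ n :> R by rewrite exprn_gt0.
    have /andP[a1 _] := truncn_itv (mulr_ge0 (ltW p0) (s0 i)).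
    rewrite /kap truncn_ge_nat ?mulr_ge0 ?(ltW p0)// -natr1.
    move: hn; rewrite -(ler_pM2l p0) mulfV ?gt_eqF// mulrBr; lra.
  elim: m => [|k IH]; first by near=> n.
  case: IH => n1 _ k1; case: (one k) => n2 _ k2.
  exists (maxn n1 n2) => // n /=; rewrite geq_max => /andP[n1n n2n] j.
  rewrite ltnS leq_eqVlt => /orP[/eqP->|]; [exact: k2|exact: k1].
(* From level [n0] on, the mesh is finer than all the gaps [s i.+1 - s i] involved, so every block
   is non-empty and the normalization makes sense. *)
case: kapS => n0 _ kapS.
pose G n j w := levy_incr Z n j w * \1_(tame_eventually Z) w.
pose Y n (i : 'I_m) w := (\sum_(kap n i <= j < kap n i.+1) G n j w) /
  Num.sqrt (kap n i.+1 - kap n i)%:R.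
pose Yoo (i : 'I_m) w := (levy_path (s i.+1) w - levy_path (s i) w) /
  Num.sqrt (s i.+1 - s i).
have iY n : iid_normal P (Y (n + n0)%N).
  apply: iid_normal_block_sums; first exact: iid_incr.
  by apply: kapS; exact: leq_addl.
have YE n i w : (n0 <= n)%N -> Y n i w =
    (dyadic_sum (fun n j => incr Z n j w) n (kap n i.+1) -
     dyadic_sum (fun n j => incr Z n j w) n (kap n i)) /
    Num.sqrt ((kap n i.+1)%:R / 2 ^+ n - (kap n i)%:R / 2 ^+ n).
  move=> nn; have kl : (kap n i < kap n i.+1)%N by exact: kapS.
  have sumE : dyadic_sum (fun n j => incr Z n j w) n (kap n i.+1) -
      dyadic_sum (fun n j => incr Z n j w) n (kap n i) =
      (Num.sqrt 2)^-1 ^+ n * \sum_(kap n i <= j < kap n i.+1) G n j w.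
    rewrite /dyadic_sum (@big_cat_nat _ _ _ (kap n i) 0 (kap n i.+1))//=; last exact: ltnW.
    by rewrite addrC addrK mulr_sumr.
  have sqE : Num.sqrt ((kap n i.+1)%:R / 2 ^+ n - (kap n i)%:R / 2 ^+ n) =
      (Num.sqrt 2)^-1 ^+ n * Num.sqrt (kap n i.+1 - kap n i)%:R :> R.
    have -> : (kap n i.+1)%:R / 2 ^+ n - (kap n i)%:R / 2 ^+ n =
        (kap n i.+1 - kap n i)%:R / 2 ^+ n :> R.
      by rewrite natrB ?mulrBl// ltnW.
    rewrite sqrtrM// mulrC; congr (_ * _).
    elim: {sumE kl nn} n => [|n IH]; first by rewrite !expr0 invr1 sqrtr1.
    by rewrite !exprS invfM sqrtrM ?invr_ge0// IH sqrtrV.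
  rewrite sumE sqE /Y invfM mulrACA mulfV ?mul1r//.
have cY i w : Y (n + n0)%N i w @[n --> \oo] --> Yoo i w.
  have c : (dyadic_sum (fun n j => incr Z n j w) n (kap n i.+1) -
     dyadic_sum (fun n j => incr Z n j w) n (kap n i)) /
    Num.sqrt ((kap n i.+1)%:R / 2 ^+ n - (kap n i)%:R / 2 ^+ n) @[n --> \oo] --> Yoo i w.
    apply: cvgM; first by apply: cvgB; exact: levy_path_cvg.
    have cS : Num.sqrt ((kap n i.+1)%:R / 2 ^+ n - (kap n i)%:R / 2 ^+ n : R)
        @[n --> \oo] --> Num.sqrt (s i.+1 - s i).
      have cD : ((kap n i.+1)%:R / 2 ^+ n - (kap n i)%:R / 2 ^+ n : R)
          @[n --> \oo] --> s i.+1 - s i by apply: cvgB; exact: cvg_truncn_div.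
      exact: (continuous_cvg _ (sqrt_continuous (x := _)) cD).
    have ne : Num.sqrt (s i.+1 - s i) != 0 by rewrite gt_eqF// sqrtr_gt0 subr_gt0.
    exact: (cvgV ne cS).
  under eq_fun do rewrite YE ?leq_addl//.
  have := c; rewrite -(cvg_shiftn n0); exact.
have [_ iYoo] : iid_normal P Yoo by apply: (iid_normal_cvg iY).
have sq0 i : 0 < Num.sqrt (s i.+1 - s i) by rewrite sqrtr_gt0 subr_gt0.
pose B' (i : 'I_m) := [set x : R | B i (Num.sqrt (s i.+1 - s i) * x)].
have mB' i : measurable (B' i).
  rewrite -[X in measurable X]setTI.
  have ms : measurable_fun setT (fun x : R => Num.sqrt (s i.+1 - s i) * x).
    exact: measurable_funM.
  exact: (ms measurableT _ (mB i)).
have := iYoo (index_enum 'I_m) (index_enum_uniq _) B' mB'.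
rewrite (eq_bigr (fun i : 'I_m => normal_prob 0 (Num.sqrt (s i.+1 - s i)) (B i))); last first.
  by move=> i _; rewrite [RHS](normal_prob_scale (sq0 i) (mB i)).
move=> <-; congr (P _); rewrite -bigcap_seq; apply/seteqP; split => w /=.
  move=> h i _; rewrite /preimage /B' /Yoo /=.
  by rewrite mulrC divfK ?gt_eqF//; exact: (h i (ltn_ord i)).
move=> h i im; have := h (Ordinal im) (mem_index_enum _).
by rewrite /preimage /B' /Yoo /= mulrC divfK ?gt_eqF.
Unshelve. all: by end_near. Qed.

Lemma levy_path_brownian : brownian_motion P levy_path.
Proof.
split.
- exact: measurable_levy_path.
- by move=> w; exact: dyadic_path0.
- move=> w; apply: dyadic_path_continuous; last by move=> t; exact: tame_w.
  by move=> n j; exact: incr_sum.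
- exact: levy_path_fdd.
Qed.

End levy_brownian.

(** All that the sequel uses of the construction. The increment tail estimate starts at threshold 8,
    whence [h + 8] in the modulus, with [h] ranging over all of [nat]. Every sample point lies in
    some [A h], without an exceptional null set. *)
Definition tame_brownian (R : realType) (d : measure_display)
  (Omega : measurableType d) (P : probability Omega R) (W : R -> Omega -> R)
  (A : nat -> set Omega) : Prop :=
  [/\ brownian_motion P W,
      (forall h, measurable (A h)),
      (forall w, exists h, A h w),
      (forall h, (P (~` A h) <= (4 * expR (- (h%:R ^+ 2 / 4)))%:E)%E) &
      forall h w n s t, A h w -> 0 <= s -> s <= t -> t <= 1 ->
        t - s <= (2 ^+ n)^-1 ->
        `|W t w - W s w| <= 7 * (h + 8)%:R * (3 / 4) ^+ n].

Lemma tame_brownian_exists (R : realType) :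
  exists (W : R -> measurableTypeR R -> R) (A : nat -> set (measurableTypeR R)),
    tame_brownian (@unif01 R) W A.
Proof.
pose Z (p : nat * nat) : measurableTypeR R -> R := normal_seq (pickle p).
have iidZ : iid_normal (@unif01 R) Z.
  have injp : injective (@pickle (nat * nat)%type) by exact: (pcan_inj pickleK).
  exact: (iid_normal_reindex injp (iid_normal_seq R)).
exists (levy_path Z), (fun h => tame (incr Z) 1 (h + 8)); split.
- exact: levy_path_brownian.
- by move=> h; apply: measurable_tame => n j; exact: (measurable_incr iidZ n j).
- move=> w; have [h hw] := @tame_incr_ex R _ _ Z 1 w; exists h => n j jn.
  apply: le_trans (hw n j jn) _; rewrite ler_wpM2r ?exprn_ge0 ?divr_ge0//.
  by rewrite ler_nat leq_addr.
- move=> h; apply: (@le_trans _ _ (@unif01 R (~` tame (raw_incr Z) 1 (h + 8)))%E).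
    apply: le_measure; rewrite ?inE; last exact/subsetC/tame_incr.
      by apply: measurableC; apply: measurable_tame => n j; exact: (measurable_incr iidZ n j).
    by apply: measurableC; apply: measurable_tame => n j; exact: (measurable_raw_incr iidZ n j).
  apply: le_trans (prob_tameC iidZ 1 (leq_addl h 8)) _.
  rewrite lee_fin mulr1 ler_pM2l// ler_expR lerN2 ler_pM2r//.
  by rewrite ler_sqr ?nnegrE// ler_nat leq_addr.
- move=> h w n s t hw s0 st t1 ts; apply: (@dyadic_path_modulus R _ _ 1) => //.
  by move=> k j; exact: incr_sum.
Qed.

(** * Running integrals and zeros of paths on the half-line *)

Section running_integral.
Context (R : realType).
Notation mu := (@lebesgue_measure R).
Implicit Types f g : R -> R.

Definition cont0 f := forall t, 0 <= t -> forall e, 0 < e ->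
  exists2 d, 0 < d & forall s, 0 <= s -> `|s - t| < d -> `|f s - f t| < e.

Lemma cont0P f : {within `[0, +oo[, continuous f} <-> cont0 f.
Proof.
split.
  move=> /subspace_continuousP cf t t0 e e0.
  have := cf t; rewrite /= in_itv/= andbT => /(_ t0)/cvgrPdist_lt/(_ e e0).
  rewrite near_withinE => /nbhs_ballP[d /= d0 hd]; exists d => // s s0 st.
  rewrite distrC; apply: (hd s); last by rewrite /= in_itv/= s0.
  by rewrite /ball/= distrC.
move=> cf; apply/subspace_continuousP => t /=; rewrite in_itv/= andbT => t0.
apply/cvgrPdist_lt => e e0; have [d d0 hd] := cf t t0 e e0.
rewrite near_withinE; apply/nbhs_ballP; exists d => //= s; rewrite /ball/= => st.
by rewrite in_itv/= andbT => s0; rewrite distrC; apply: hd => //; rewrite distrC.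
Qed.

Definition rint f (t : R) : R := Rintegral mu `[0, t] f.

Lemma integrable_cont0 f (t : R) : cont0 f -> mu.-integrable `[0, t] (EFin \o f).
Proof.
move=> /cont0P cf; apply: continuous_compact_integrable.
  exact: segment_compact.
apply: continuous_subspaceW cf => s /=; rewrite !in_itv/= andbT.
by move=> /andP[].
Qed.

Lemma rint0 f : rint f 0 = 0.
Proof. by rewrite /rint set_itv1 Rintegral_set1. Qed.

Lemma rint_le f (s t c : R) : cont0 f -> 0 <= s -> s <= t ->
  (forall r, s <= r -> r <= t -> f r <= c) -> rint f t - rint f s <= c * (t - s).
Proof.
move=> cf s0 st fc.
have it := integrable_cont0 t cf.
rewrite /rint Rintegral_itvB//= ?bnd_simp//.
have its : mu.-integrable `]s, t] (EFin \o f).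
  apply: integrableS it => // r /=; rewrite !in_itv/= => /andP[sr ->].
  by rewrite (le_trans s0)// ltW.
have mst : mu (`]s, t]%classic : set R) = (t - s)%:E.
  rewrite lebesgue_measure_itv/= lte_fin; case: ltP => h; first by rewrite -EFinB.
  by have -> : t = s; [lra|rewrite subrr].
have -> : c * (t - s) = Rintegral mu `]s, t] (cst c).
  by rewrite Rintegral_cst//= mst.
apply: le_Rintegral => //.
  apply/integrableP; split; first exact: measurable_cst.
  rewrite (_ : (fun x => _) = cst `|c|%:E)//.
  by rewrite integral_cst//= mst -EFinM ltry.
by move=> r /=; rewrite in_itv/= => /andP[sr rt]; apply: fc => //; exact: ltW.
Qed.

Lemma cont0N f : cont0 f -> cont0 (fun t => - f t).
Proof.
move=> cf t t0 e e0; have [d d0 hd] := cf t t0 e e0; exists d => // s s0 st.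
by rewrite -opprD normrN; exact: hd.
Qed.

Lemma cont0D f g : cont0 f -> cont0 g -> cont0 (fun t => f t + g t).
Proof.
move=> cf cg t t0 e e0.
have e20 : 0 < e / 2 by rewrite divr_gt0.
have [d1 d10 h1] := cf t t0 _ e20; have [d2 d20 h2] := cg t t0 _ e20.
exists (Num.min d1 d2); first by rewrite lt_min d10 d20.
move=> s s0; rewrite lt_min => /andP[st1 st2].
rewrite opprD addrACA; apply: le_lt_trans (ler_normD _ _) _.
by have := h1 s s0 st1; have := h2 s s0 st2; lra.
Qed.

Lemma rintN f t : cont0 f -> rint (fun s => - f s) t = - rint f t.
Proof.
move=> cf; rewrite /rint.
have := @RintegralZl _ _ _ mu `[0, t]%classic f (-1) _ (integrable_cont0 t cf).
rewrite mulN1r => <- //; apply: eq_Rintegral => s _; by rewrite mulN1r.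
Qed.

Lemma rintD f g t : cont0 f -> cont0 g ->
  rint (fun s => f s + g s) t = rint f t + rint g t.
Proof. by move=> cf cg; rewrite /rint -RintegralD//; exact: integrable_cont0. Qed.

Lemma rint_ge f (s t c : R) : cont0 f -> 0 <= s -> s <= t ->
  (forall r, s <= r -> r <= t -> c <= f r) -> c * (t - s) <= rint f t - rint f s.
Proof.
move=> cf s0 st fc; have := @rint_le _ s t (- c) (cont0N cf) s0 st.
rewrite !rintN// => h.
suff : - rint f t - - rint f s <= - c * (t - s) by lra.
by apply: h => r sr rt; rewrite lerN2; exact: fc.
Qed.

Lemma last_zero f (a b : R) : cont0 f -> 0 <= a -> a <= b -> f a <= 0 -> 0 < f b ->
  exists t, [/\ a <= t, t < b, f t = 0 & forall s, t < s -> s <= b -> 0 < f s].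
Proof.
move=> cf a0 ab fa fb.
pose S := [set s | [/\ a <= s, s <= b & f s <= 0]].
have Sa : S a by split.
have hs : has_sup S by split; [exists a|exists b => s []].
set t := sup S.
have Sub s : S s -> s <= t by move=> Ss; apply: ub_le_sup => //; have [] := hs.
have at_ : a <= t by exact: Sub.
have tb : t <= b by apply: ge_sup; [exists a|move=> s []].
have t0 : 0 <= t by exact: le_trans at_.
have ft : f t <= 0.
  rewrite leNgt; apply/negP => ft0; have [d d0 hd] := cf t t0 _ ft0.
  have [s [as_ sb fs] ts] := sup_adherent d0 hs.
  have st : s <= t by apply: Sub.
  have : `|f s - f t| < f t.
    apply: hd; first exact: le_trans as_.
    by rewrite ler0_norm ?subr_le0// opprB; move: ts; rewrite -/t; lra.
  by rewrite ltr_norml => /andP[]; lra.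
have tb' : t < b by rewrite lt_neqAle tb andbT; apply: contraTneq fb => <-; rewrite -leNgt.
have pos s : t < s -> s <= b -> 0 < f s.
  move=> ts sb; rewrite ltNge; apply/negP => fs.
  have : s <= t by apply: Sub; split => //; rewrite (le_trans at_)// ltW.
  by rewrite leNgt ts.
exists t; split => //; apply/eqP; rewrite eq_le ft /=.
rewrite leNgt; apply/negP => ft0; have nf0 : 0 < - f t by lra.
have [d d0 hd] := cf t t0 _ nf0.
pose s := Num.min b (t + d / 2).
have ts : t < s by rewrite lt_min tb' ltrDl divr_gt0.
have sb : s <= b by rewrite ge_min lexx.
have sd : s <= t + d / 2 by rewrite ge_min lexx orbT.
have : `|f s - f t| < - f t.
  apply: hd; first by rewrite (le_trans t0)// ltW.
  by rewrite ger0_norm; lra.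
by rewrite ltr_norml => /andP[_]; have := pos s ts sb; lra.
Qed.

Lemma max0_dist (b s t : R) : `|Num.max 0 (b - s) - Num.max 0 (b - t)| <= `|s - t|.
Proof.
have n1 := ler_norm (s - t); have n2 := ler_norm (t - s); rewrite distrC in n2.
by rewrite /Num.max ler_norml; case: ltP => h1; case: ltP => h2; lra.
Qed.

(** Time reversal of [last_zero]; clipping the reversed time at 0 keeps the reversed path continuous
    on the whole half-line. *)
Lemma first_zero f (a b : R) : cont0 f -> 0 <= a -> a <= b -> 0 < f a -> f b <= 0 ->
  exists t, [/\ a < t, t <= b, f t = 0 & forall s, a <= s -> s < t -> 0 < f s].
Proof.
move=> cf a0 ab fa fb.
pose g s := f (Num.max 0 (b - s)).
have cg : cont0 g.
  move=> t t0 e e0.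
  have m0 (r : R) : 0 <= Num.max 0 (b - r) by rewrite le_max lexx.
  have [d d0 hd] := cf _ (m0 t) e e0.
  exists d => // s s0 st; apply: hd; first exact: m0.
  exact: le_lt_trans (max0_dist _ _ _) _.
have [||||t [t1 t2 t3 t4]] := @last_zero g 0 (b - a) cg.
- by [].
- by rewrite subr_ge0.
- by rewrite /g subr0 (max_idPr _)//; lra.
- by rewrite /g opprB addrC subrK (max_idPr _).
have bt : 0 <= b - t by lra.
exists (b - t); split; [lra|lra| |].
  by move: t3; rewrite /g (max_idPr _).
move=> s as_ sbt; have := t4 (b - s); rewrite /g.
have -> : b - (b - s) = s by ring.
by rewrite (max_idPr _); [apply; lra|lra].
Qed.

End running_integral.

(** * Pathwise estimates for the reflected system *)

Section reflected_estimates.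
Context (R : realType) (beta x y : R) (w q1 q2 L : R -> R).
Hypothesis beta0 : 0 < beta.
Hypothesis y0 : 0 <= y.
Hypothesis sol : reflected_sol beta x y w q1 q2 L.
Let u t := - q1 t.
Let A1 := rint u.
Let A2 := rint q2.

Let cz : cont0 q2. Proof. by apply/cont0P; move: sol => [_ [_ [_ [? _]]]]. Qed.
Let cu : cont0 u. Proof. by apply: cont0N; apply/cont0P; move: sol => [_ [_ [? _]]]. Qed.
Let LS s t : 0 <= s -> s <= t -> L s <= L t.
Proof. by move: sol => [_ [_ [_ [_ [_ [h _]]]]]]; exact: h. Qed.
Let u0 t : 0 <= t -> 0 <= u t.
Proof. by move: sol => [_ [_ [_ [_ [_ [_ [_ [_ [h _]]]]]]]]] /h; rewrite /u oppr_ge0. Qed.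

Let zE t : 0 <= t -> q2 t = y + L t - A2 t.
Proof. by move: sol => [_ [h _]] /h. Qed.

Let uE t : 0 <= t -> u t = - x - Num.sqrt 2 * w t + beta * t - A1 t - A2 t + L t.
Proof.
move=> t0; have := sol => -[/(_ t t0) h _]; rewrite /u h.
have -> : Rintegral lebesgue_measure `[0, t] (fun s => - q1 s + q2 s) = A1 t + A2 t.
  exact: rintD.
by ring.
Qed.

(** The reflection condition speaks of closed intervals on which [u > 0], whereas [u] may vanish at
    the left end [a]; right continuity of [L] reaches that end point. *)
Let L_excursion a t : 0 <= a -> a <= t ->
  (forall s, a < s -> s <= t -> 0 < u s) -> L a = L t.
Proof.
move=> a0 at_ upos; have [->//|a_t] := eqVneq a t.
have {a_t at_}at_ : a < t by rewrite lt_neqAle a_t.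
have Ls s : a < s -> s <= t -> L s = L t.
  move=> as_ st; have := sol => -[_ [_ [_ [_ [_ [_ [_ [_ [_ h]]]]]]]]].
  apply: h => //; first by rewrite ltW// (le_lt_trans a0).
  by move=> r sr rt; have := upos r (lt_le_trans as_ sr) rt; rewrite /u oppr_gt0.
have cL : L r @[r --> a^'+] --> L a.
  by move: sol => [_ [_ [_ [_ [_ [_ [_ [h _]]]]]]]]; exact: h.
have cL' : L r @[r --> a^'+] --> L t.
  apply: cvg_near_cst; near=> r; apply: Ls; near: r; first exact: nbhs_right_gt.
  exact: nbhs_right_le.
exact: (cvg_unique _ cL cL').
Unshelve. all: by end_near. Qed.

Let u_incr a t : 0 <= a -> a <= t -> (forall s, a < s -> s <= t -> 0 < u s) ->
  u t = u a - Num.sqrt 2 * (w t - w a) + beta * (t - a)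
        - (A1 t - A1 a) - (A2 t - A2 a).
Proof.
move=> a0 at_ upos; rewrite (uE a0) (uE (le_trans a0 at_)) (L_excursion a0 at_ upos).
by ring.
Qed.

Let z_incr a t : 0 <= a -> a <= t -> (forall s, a < s -> s <= t -> 0 < u s) ->
  q2 t = q2 a - (A2 t - A2 a).
Proof.
move=> a0 at_ upos; rewrite (zE a0) (zE (le_trans a0 at_)) (L_excursion a0 at_ upos).
by ring.
Qed.

(** In [q2 - u] both the reflection term and the integral of [q2] cancel; this balance is used
    whenever [u] touches 0 in between. *)
Let S_incr a t : 0 <= a -> a <= t ->
  q2 t - u t = q2 a - u a + Num.sqrt 2 * (w t - w a) - beta * (t - a) + (A1 t - A1 a).
Proof.
move=> a0 at_; have t0 := le_trans a0 at_.
by rewrite (zE a0) (zE t0) (uE a0) (uE t0); ring.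
Qed.

Lemma reflected_q1_0 : w 0 = 0 -> q1 0 = x.
Proof.
move=> w0; have := uE (lexx 0).
have -> : L 0 = 0 by move: sol => [_ [_ [_ [_ [-> _]]]]].
by rewrite w0 /A1 /A2 !rint0 /u; lra.
Qed.

Lemma reflected_q2_0 : q2 0 = y.
Proof.
have := zE (lexx 0).
have -> : L 0 = 0 by move: sol => [_ [_ [_ [_ [-> _]]]]].
by rewrite /A2 rint0; lra.
Qed.

(** After its last zero, a negative [q2] would be pushed upwards by [L] and by its own integral. *)
Lemma reflected_q2_ge0 t : 0 <= t -> 0 <= q2 t.
Proof.
move=> t0; rewrite leNgt; apply/negP => zt.
have [||||tau [t1 t2 t3 t4]] := @last_zero R (fun s => - q2 s) 0 t (cont0N cz).
- by [].
- exact: t0.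
- by rewrite reflected_q2_0 oppr_le0.
- by rewrite oppr_gt0.
have ztau : q2 tau = 0 by lra.
have : A2 t - A2 tau <= 0 * (t - tau).
  apply: rint_le => //; first exact: ltW.
  move=> r; rewrite le_eqVlt => /orP[/eqP<- _|tr rt]; first by rewrite ztau.
  by have := t4 r tr rt; lra.
have := LS t1 (ltW t2).
by move: ztau zt; rewrite (zE t1) (zE t0); lra.
Qed.

Let A1_ge0 a t : 0 <= a -> a <= t -> 0 <= A1 t - A1 a.
Proof.
move=> a0 at_; have := @rint_ge R u a t 0 cu a0 at_; rewrite mul0r; apply.
by move=> r ar _; apply: u0; exact: le_trans ar.
Qed.

Let A2_ge0 a t : 0 <= a -> a <= t -> 0 <= A2 t - A2 a.
Proof.
move=> a0 at_; have := @rint_ge R q2 a t 0 cz a0 at_; rewrite mul0r; apply.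
by move=> r ar _; apply: reflected_q2_ge0; exact: le_trans ar.
Qed.

(** The reflection is silent along an excursion of [u]. The one that ends at [t] starts either
    before [a] or at a zero of [u], possibly [t] itself. *)
Let last_visit a t : 0 <= a -> a <= t ->
  (forall s, a <= s -> s <= t -> 0 < u s) \/
  exists tau, [/\ a <= tau, tau <= t, u tau = 0 & forall s, tau < s -> s <= t -> 0 < u s].
Proof.
move=> a0 at_.
have [h|/existsNP[s /not_implyP[as_ /not_implyP[st us]]]] :=
  pselect (forall s, a <= s -> s <= t -> 0 < u s); first by left.
right; have us0 : u s <= 0 by rewrite leNgt; exact/negP.
have s0 := le_trans a0 as_.
have [ut|ut] := ltP 0 (u t).
  have [tau [t1 t2 t3 t4]] := last_zero cu s0 st us0 ut.
  by exists tau; split => //; [exact: le_trans t1|exact: ltW].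
exists t; split => //.
  by apply/eqP; rewrite eq_le ut u0// (le_trans s0).
by move=> r tr rt; move: (lt_le_trans tr rt); rewrite ltxx.
Qed.

Let noise_le m r s : Num.sqrt 2 * `|w r - w s| <= m ->
  - (Num.sqrt 2 * (w r - w s)) <= m /\ Num.sqrt 2 * (w r - w s) <= m.
Proof.
move=> h; split; apply: le_trans h; last by rewrite ler_wpM2l ?sqrtr_ge0// ler_norm.
by rewrite -mulrN ler_wpM2l ?sqrtr_ge0// -normrN ler_norm.
Qed.

(** If [u] has no zero, then [u 1 <= u s + m + beta] for every [s], so the integral of [u] is at
    least [u 1 - m - beta]. Fed back into the bound at [s = 0], this counts [u 1] twice, hence the
    factor [1/2]. If [u] has a zero, the initial value drops out. *)
Lemma reflected_u_contract m : (forall s, 0 <= s -> s <= 1 ->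
    Num.sqrt 2 * `|w 1 - w s| <= m) ->
  - q1 1 <= - q1 0 / 2 + beta + m.
Proof.
move=> hm; rewrite -/(u 1) -/(u 0).
have hm' s : 0 <= s -> s <= 1 -> - (Num.sqrt 2 * (w 1 - w s)) <= m.
  by move=> s0 s1; have [] := noise_le (hm s s0 s1).
have bb s : 0 <= s -> s <= 1 -> beta * (1 - s) <= beta.
  by move=> s0 s1; rewrite -[leRHS]mulr1 ler_pM2l//; lra.
have [h|[tau [t1 t2 t3 t4]]] := last_visit (lexx 0) (ler01 : 0 <= 1 :> R).
  have key s : 0 <= s -> s <= 1 -> u 1 <= u s + m + beta - (A1 1 - A1 s).
    move=> s0 s1; rewrite (u_incr s0 s1); last by move=> r sr; apply: h; rewrite (le_trans s0)// ltW.
    by have := hm' s s0 s1; have := bb s s0 s1; have := A2_ge0 s0 s1; lra.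
  have : (u 1 - m - beta) * (1 - 0) <= A1 1 - A1 0.
    apply: rint_ge => // r r0 r1.
    by have := key r r0 r1; have := A1_ge0 r0 r1; lra.
  by have := key 0 (lexx 0) ler01; lra.
have -> := u_incr t1 t2 t4; rewrite t3.
by have := hm' tau t1 t2; have := bb tau t1 t2; have := A2_ge0 t1 t2;
  have := A1_ge0 t1 t2; have := u0 (lexx 0); lra.
Qed.

Lemma reflected_u_le t m : 0 <= t -> (forall s, 0 <= s -> s <= t ->
    Num.sqrt 2 * `|w t - w s| <= m) ->
  - q1 t <= - q1 0 + m + beta * t.
Proof.
move=> t0 hm; rewrite -/(u t) -/(u 0).
have hm' s : 0 <= s -> s <= t -> - (Num.sqrt 2 * (w t - w s)) <= m.
  by move=> s0 s1; have [] := noise_le (hm s s0 s1).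
have bb s : 0 <= s -> s <= t -> beta * (t - s) <= beta * t.
  by move=> s0 s1; rewrite ler_pM2l//; lra.
have [h|[tau [t1 t2 t3 t4]]] := last_visit (lexx 0) t0.
  rewrite (u_incr (lexx 0) t0); last by move=> r r0; apply: h; exact: ltW.
  by have := hm' 0 (lexx 0) t0; have := bb 0 (lexx 0) t0;
    have := A2_ge0 (lexx 0) t0; have := A1_ge0 (lexx 0) t0; lra.
have -> := u_incr t1 t2 t4; rewrite t3.
by have := hm' tau t1 t2; have := bb tau t1 t2; have := A2_ge0 t1 t2;
  have := A1_ge0 t1 t2; have := u0 (lexx 0); lra.
Qed.

(** In the balance of [q2 - u], the integral of [u] is at most [t (u 0 + m + beta t)]. For [t <= 1]
    the terms [- u 0] and [- beta t] of the balance absorb all of it but [t m]. *)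
Lemma reflected_q1_le t m : 0 <= t -> t <= 1 -> (forall r s, 0 <= s -> s <= r -> r <= t ->
    Num.sqrt 2 * `|w r - w s| <= m) ->
  q1 t <= q2 0 + Num.sqrt 2 * (w t - w 0) + t * m.
Proof.
move=> t0 t1 hm.
have ub r : 0 <= r -> r <= t -> u r <= u 0 + m + beta * t.
  move=> r0 rt; apply: le_trans (@reflected_u_le r m r0 _) _.
    by move=> s s0 sr; exact: hm.
  by rewrite lerD2l ler_pM2l.
have := @rint_le R u 0 t (u 0 + m + beta * t) cu (lexx 0) t0 ub.
have := S_incr (lexx 0) t0.
have := reflected_q2_ge0 t0.
have k1 : u 0 * t <= u 0 by rewrite ler_piMr// u0.
have k2 : beta * t * t <= beta * t.
  by rewrite ler_piMr// mulr_ge0// ltW.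
have -> : q1 t = - u t by rewrite /u opprK.
rewrite -/A1; nra.
Qed.

Lemma reflected_q2_ge t : 0 <= t ->
  q2 0 + q1 0 + Num.sqrt 2 * (w t - w 0) - beta * t <= q2 t.
Proof.
move=> t0; have := S_incr (lexx 0) t0; have := u0 t0; have := A1_ge0 (lexx 0) t0.
by rewrite /u; lra.
Qed.

(** Until the first zero of [u] the reflection is silent and [q2] decreases at rate
    [q2 >= N >= beta]. *)
Let q2_descent (T N a s1 : R) : 0 <= a -> a <= s1 -> s1 <= T -> beta <= N ->
  (forall r, a <= r -> r <= T -> N <= q2 r) -> u s1 <= 0 ->
  exists sig, [/\ a <= sig, sig <= T, u sig = 0 & q2 sig <= q2 a - beta * (sig - a)].
Proof.
move=> a0 as1 s1T bN zN us1.
have [ua|ua] := ltP 0 (u a); last first.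
  exists a; split => //; last by rewrite subrr mulr0 subr0.
    exact: le_trans s1T.
  by apply/eqP; rewrite eq_le ua u0.
have [sig [h1 h2 h3 h4]] := first_zero cu a0 as1 ua us1.
exists sig; split => //; [exact: ltW|exact: le_trans s1T|].
have zs s : a <= s -> s < sig -> q2 s <= q2 a - beta * (s - a).
  move=> as_ ss; rewrite (z_incr a0 as_); last first.
    by move=> r ar rs; apply: h4; [exact: ltW|exact: le_lt_trans rs ss].
  rewrite lerD2l lerN2; apply: le_trans (_ : N * (s - a) <= _).
    by rewrite ler_wpM2r// subr_ge0.
  apply: rint_ge => // r ar rs; apply: zN => //.
  by rewrite (le_trans rs)// (le_trans (ltW ss))// (le_trans h2).
(* [z_incr] needs [u > 0] up to and including the right end, which excludes [sig]; continuity of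
   [q2] closes the gap. *)
apply/ler_addgt0Pr => e e0.
have sig0 : 0 <= sig by rewrite ltW// (le_lt_trans a0).
have e20 : 0 < e / 2 by rewrite divr_gt0.
have [d d0 hd] := cz sig0 e20.
pose d' := Num.min d (e / (2 * beta)).
have d'0 : 0 < d' by rewrite lt_min d0 divr_gt0// mulr_gt0.
have d'd : d' <= d by rewrite ge_min lexx.
have d'b : beta * d' <= e / 2.
  have -> : e / 2 = beta * (e / (2 * beta)) by field; rewrite gt_eqF.
  by rewrite ler_pM2l// ge_min lexx orbT.
pose s := Num.max a (sig - d' / 2).
have as_ : a <= s by rewrite le_max lexx.
have ss : s < sig by rewrite gt_max h1 gtrBl divr_gt0.
have sd : sig - s <= d' / 2 by rewrite lerBlDr -lerBlDl le_max lexx orbT.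
have : `|q2 s - q2 sig| < e / 2.
  apply: hd; first exact: le_trans as_.
  by rewrite ltr0_norm ?subr_lt0// opprB (le_lt_trans sd)//; lra.
have : beta * (sig - s) <= beta * (d' / 2) by rewrite ler_pM2l.
have := zs s as_ ss; rewrite ltr_norml => zs1 b1 /andP[b2 _].
lra.
Qed.

Let q2_run (T N m e a : R) : 0 <= a -> a <= T -> beta <= N -> 0 <= e ->
  (forall r, a <= r -> r <= T -> N <= q2 r) ->
  (forall s t, 0 <= s -> s <= t -> t <= T ->
     Num.sqrt 2 * `|w t - w s| <= m /\
     Num.sqrt 2 * `|w t - w s| <= e + (N - beta) * (t - s)) ->
  q2 T <= q2 a - beta * (T - a) + m + (T + 1) * e.
Proof.
move=> a0 aT bN e0 zN hw.
have m0 : 0 <= m.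
  by have [h _] := hw a T a0 aT (lexx T); apply: le_trans h; rewrite mulr_ge0 ?sqrtr_ge0.
have A2N s t : a <= s -> s <= t -> t <= T -> N * (t - s) <= A2 t - A2 s.
  move=> as_ st tT; apply: rint_ge => //; first exact: le_trans as_.
  by move=> r sr rt; apply: zN; [exact: le_trans sr|exact: le_trans tT].
have T0 := le_trans a0 aT.
have Te : 0 <= (T + 1) * e by rewrite mulr_ge0//; lra.
have [upos|/existsNP[s1 /not_implyP[as1 /not_implyP[s1T us1]]]] :=
    pselect (forall s, a <= s -> s <= T -> 0 < u s).
  rewrite (z_incr a0 aT); last by move=> s as_; apply: upos; exact: ltW.
  have : beta * (T - a) <= N * (T - a) by rewrite ler_wpM2r// subr_ge0.
  by have := A2N a T (lexx a) aT (lexx T); lra.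
have us1' : u s1 <= 0 by rewrite leNgt; exact/negP.
have [sig [asig sigT usig zsig]] := q2_descent a0 as1 s1T bN zN us1'.
have sig0 := le_trans a0 asig.
have ue t : sig <= t -> t <= T -> u t <= e.
  move=> st tT.
  have [h|[tau [t1 t2 t3 t4]]] := last_visit sig0 st.
    by have := h sig (lexx sig) st; rewrite usig ltxx.
  have tau0 := le_trans sig0 t1.
  rewrite (u_incr tau0 t2 t4) t3.
  have [_ /noise_le[h1 _]] := hw tau t tau0 t2 tT.
  by have := A1_ge0 tau0 t2; have := A2N tau t (le_trans asig t1) t2 tT; lra.
have := @rint_le R u sig T e cu sig0 sigT ue.
have := S_incr sig0 sigT; rewrite -/A1 usig.
have [/noise_le[_ h1] _] := hw sig T sig0 sigT (lexx T).
have := ue T sigT (lexx T).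
have : e * (T - sig) <= e * T by rewrite ler_wpM2l//; lra.
lra.
Qed.

(** The run starts at the last time where [q2] equals [N], which gives the second term of the
    maximum, or at time 0 if [q2] never goes below [N], which gives the first. *)
Lemma reflected_q2_le (T N m e : R) : 0 <= T -> beta <= N -> 0 <= e ->
  (forall s t, 0 <= s -> s <= t -> t <= T ->
     Num.sqrt 2 * `|w t - w s| <= m /\
     Num.sqrt 2 * `|w t - w s| <= e + (N - beta) * (t - s)) ->
  q2 T <= Num.max (q2 0 - beta * T) N + m + (T + 1) * e.
Proof.
move=> T0 bN e0 hw.
have m0 : 0 <= m.
  have [h _] := hw 0 T (lexx 0) T0 (lexx T).
  by apply: le_trans h; rewrite mulr_ge0 ?sqrtr_ge0.
have Te : 0 <= (T + 1) * e by rewrite mulr_ge0//; lra.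
have mx1 : q2 0 - beta * T <= Num.max (q2 0 - beta * T) N by rewrite le_max lexx.
have mx2 : N <= Num.max (q2 0 - beta * T) N by rewrite le_max lexx orbT.
have [zT|zT] := leP (q2 T) N; first by lra.
have [h|/existsNP[s /not_implyP[s0 /not_implyP[sT zs]]]] :=
    pselect (forall r, 0 <= r -> r <= T -> N <= q2 r).
  by have := q2_run (lexx 0) T0 bN e0 h hw; lra.
have cz' : cont0 (fun r => q2 r + - N).
  by apply: cont0D => // t _ e' e'0; exists 1 => // r _ _; rewrite subrr normr0.
have [||||tau [t1 t2 t3 t4]] := @last_zero R (fun r => q2 r + - N) s T cz'.
- exact: s0.
- exact: sT.
- by move/negP : zs; rewrite -ltNge => /ltW; lra.
- by lra.
have h r : tau <= r -> r <= T -> N <= q2 r.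
  rewrite le_eqVlt => /orP[/eqP<- _|tr rT]; first by lra.
  by have := t4 r tr rT; lra.
have tau0 := le_trans s0 t1.
have := q2_run tau0 (ltW t2) bN e0 h hw.
have : 0 <= beta * (T - tau) by rewrite mulr_ge0 ?(ltW beta0)// subr_ge0 ltW.
lra.
Qed.

End reflected_estimates.

(** * Running maximum and Picard iteration *)

Section skorokhod.
Context (R : realType).
Implicit Types f g z q : R -> R.

Lemma cont0_bounded f (T : R) : cont0 f -> 0 <= T ->
  exists2 M, 0 < M & forall t, 0 <= t -> t <= T -> `|f t| <= M.
Proof.
move=> cf T0.
have cw (g : R -> R) : cont0 g -> {within `[0, T], continuous g}.
  move=> /cont0P; apply: continuous_subspaceW => s /=; rewrite !in_itv/= andbT.
  by move=> /andP[].
have [c1 _ h1] := EVT_max T0 (cw _ cf).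
have [c2 _ h2] := EVT_max T0 (cw _ (cont0N cf)).
exists (`|f c1| + `|f c2| + 1); first by have := normr_ge0 (f c1); have := normr_ge0 (f c2); lra.
move=> t t0 tT; have tI : t \in `[0, T] by rewrite in_itv/= t0.
have := h1 t tI; have := h2 t tI; have := ler_norm (f c1); have := ler_norm (- f c2).
by rewrite normrN ler_norml; have := normr_ge0 (f c1); have := normr_ge0 (f c2); lra.
Qed.

Lemma cont0_rint f : cont0 f -> cont0 (rint f).
Proof.
move=> cf t t0 e e0.
have t10 : 0 <= t + 1 by lra.
have [M M0 hM] := cont0_bounded cf t10.
exists (Num.min 1 (e / M)); first by rewrite lt_min ltr01 divr_gt0.
move=> s s0; rewrite lt_min => /andP[st1 st2].
have key a b : 0 <= a -> a <= b -> b <= t + 1 -> `|rint f b - rint f a| <= M * (b - a).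
  move=> a0 ab bt; rewrite ler_norml; apply/andP; split.
    rewrite -mulNr; apply: rint_ge => // r ar rb.
    have := hM r (le_trans a0 ar) (le_trans rb bt).
    by rewrite ler_norml => /andP[].
  apply: rint_le => // r ar rb.
  have := hM r (le_trans a0 ar) (le_trans rb bt).
  by rewrite ler_norml => /andP[].
have fin : M * `|s - t| < e by rewrite mulrC -ltr_pdivlMr.
have [st|ts] := leP s t.
  rewrite distrC; apply: le_lt_trans (key s t s0 st _) _; first by lra.
  by move: fin; rewrite ler0_norm ?subr_le0// opprB.
apply: le_lt_trans (key t s t0 (ltW ts) _) _.
  by move: st1; rewrite gtr0_norm ?subr_gt0//; lra.
by move: fin; rewrite gtr0_norm ?subr_gt0.
Qed.

(** In the norm weighted by [expR (l * s)], integration is bounded by [1 / l] whatever the horizon,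
    so that a single iteration yields a solution for all times. *)
Lemma rint_expR_le f (K l t : R) : cont0 f -> 0 < l -> 0 <= K -> 0 <= t ->
  (forall s, 0 <= s -> s <= t -> `|f s| <= K * expR (l * s)) ->
  `|rint f t| <= K / l * expR (l * t).
Proof.
move=> cf l0 K0; rewrite le_eqVlt => /orP[/eqP<- _|t0 hf].
  by rewrite rint0 normr0 mulr_ge0 ?expR_ge0// divr_ge0// ltW.
pose E (s : R) := K * expR (l * s).
have cE' : continuous E.
  move=> s; apply: cvgM; first exact: cvg_cst.
  apply: (cvg_comp (fun s => l * s) expR); last exact: continuous_expR.
  by apply: cvgM; [exact: cvg_cst|exact: cvg_id].
have cE : cont0 E by apply/cont0P; apply: continuous_subspaceT.
pose F (s : R) := K / l * expR (l * s).
have cF : continuous F.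
  move=> s; apply: cvgM; first exact: cvg_cst.
  apply: (cvg_comp (fun s => l * s) expR); last exact: continuous_expR.
  by apply: cvgM; [exact: cvg_cst|exact: cvg_id].
have FTC : rint E t = F t - F 0.
  rewrite /rint /Rintegral (@continuous_FTC2 R E F 0 t)//.
  - exact: continuous_subspaceT.
  - split; first by move=> r _; exact: ex_derive.
      by apply/cvg_at_right_filter; exact: cF.
    by apply/cvg_at_left_filter; exact: cF.
  - move=> r _; rewrite /F derive1Ml// derive1_comp// derive1E.
    have /funeqP -> := @derive_expR R.
    by rewrite derive1Ml// derive1_id mulr1 /E; field; rewrite gt_eqF.
have F0 : 0 <= F 0 by rewrite /F mulr_ge0 ?expR_ge0// divr_ge0// ltW.
have half (g : R -> R) : cont0 g -> (forall s, 0 <= s -> s <= t -> g s <= E s) ->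
    rint g t <= F t.
  move=> cg hg; have := @rint_ge R (fun s => E s + - g s) 0 t 0 _ (lexx 0) (ltW t0).
  rewrite mul0r !rint0 subr0 rintD ?rintN//; last exact: cont0N.
  move=> h; suff : 0 <= rint E t - rint g t by rewrite FTC; lra.
  apply: h; first by apply: cont0D => //; exact: cont0N.
  by move=> r r0 rt; rewrite subr_ge0; exact: hg.
rewrite -/(F t) ler_norml; apply/andP; split.
  have := half _ (cont0N cf); rewrite rintN// => h.
  suff : - rint f t <= F t by lra.
  by apply: h => r r0 rt; have := hf r r0 rt; rewrite ler_norml => /andP[]; rewrite /E; lra.
by apply: half => // r r0 rt; have := hf r r0 rt; rewrite ler_norml => /andP[].
Qed.

(** The Skorokhod reflection term at the upper barrier 0: [z - runmax z] is nonpositive, and the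
    maximum with 0 makes the term vanish at time 0 when [z 0 <= 0]. *)
Definition runmax z (t : R) : R := sup [set Num.max (z s) 0 | s in `[0, t]].

Lemma runmax_att z t : cont0 z -> 0 <= t ->
  (exists c, [/\ 0 <= c, c <= t & runmax z t = Num.max (z c) 0]) /\
  forall s, 0 <= s -> s <= t -> Num.max (z s) 0 <= runmax z t.
Proof.
move=> cz t0.
have cw : {within `[0, t], continuous z}.
  move/cont0P : cz; apply: continuous_subspaceW => s /=; rewrite !in_itv/= andbT.
  by move=> /andP[].
have [c cI hc] := EVT_max t0 cw.
have hc' s : 0 <= s -> s <= t -> Num.max (z s) 0 <= Num.max (z c) 0.
  move=> s0 st; have := hc s; rewrite in_itv/= s0 st => /(_ isT) h.
  by rewrite ge_max !le_max h lexx orbT.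
have rE : runmax z t = Num.max (z c) 0.
  apply/eqP; rewrite eq_le; apply/andP; split.
    apply: ge_sup; first by exists (Num.max (z c) 0); exists c.
    by move=> r [s /= sI] <-; move: sI; rewrite in_itv/= => /andP[s0 st]; exact: hc'.
  apply: ub_le_sup; last by exists c.
  exists (Num.max (z c) 0) => r [s /= sI] <-; move: sI; rewrite in_itv/=.
  by move=> /andP[s0 st]; exact: hc'.
split; last by move=> s s0 st; rewrite rE; exact: hc'.
by exists c; move: cI; rewrite in_itv/= => /andP[].
Qed.

Lemma runmax_ge z s t : cont0 z -> 0 <= s -> s <= t -> z s <= runmax z t.
Proof.
move=> cz s0 st; have [_ h] := runmax_att cz (le_trans s0 st).
by apply: le_trans (h s s0 st); rewrite le_max lexx.
Qed.

Lemma runmax_ge0 z t : cont0 z -> 0 <= t -> 0 <= runmax z t.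
Proof.
move=> cz t0; have [_ h] := runmax_att cz t0.
by apply: le_trans (h t t0 (lexx t)); rewrite le_max lexx orbT.
Qed.

Lemma runmax_le z t c : cont0 z -> 0 <= t -> 0 <= c ->
  (forall s, 0 <= s -> s <= t -> z s <= c) -> runmax z t <= c.
Proof.
move=> cz t0 c0 h; have [[a [a0 at_ ->]] _] := runmax_att cz t0.
by rewrite ge_max c0 andbT; exact: h.
Qed.

Lemma runmax_mono z s t : cont0 z -> 0 <= s -> s <= t -> runmax z s <= runmax z t.
Proof.
move=> cz s0 st; apply: runmax_le => //; first exact/runmax_ge0/(le_trans s0 st).
by move=> r r0 rs; apply: runmax_ge => //; exact: le_trans st.
Qed.

Lemma runmax_dist z z' t e : cont0 z -> cont0 z' -> 0 <= t ->
  (forall s, 0 <= s -> s <= t -> `|z s - z' s| <= e) ->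
  `|runmax z t - runmax z' t| <= e.
Proof.
move=> cz cz' t0 h.
have e0 : 0 <= e by apply: le_trans (h t t0 (lexx t)).
have half (a b : R -> R) : cont0 a -> cont0 b ->
    (forall s, 0 <= s -> s <= t -> `|a s - b s| <= e) -> runmax a t <= runmax b t + e.
  move=> ca cb hab; apply: runmax_le => //; first by rewrite addr_ge0// runmax_ge0.
  move=> s s0 st; have := runmax_ge cb s0 st; have := hab s s0 st.
  by have := ler_norm (a s - b s); lra.
have h1 := half _ _ cz cz' h.
have h2 : runmax z' t <= runmax z t + e.
  by apply: half => // s s0 st; rewrite distrC; exact: h.
by rewrite ler_norml; lra.
Qed.

Lemma cont0_runmax z : cont0 z -> cont0 (runmax z).
Proof.
move=> cz t t0 e e0.
have e40 : 0 < e / 4 by rewrite divr_gt0.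
have [d d0 hd] := cz t t0 _ e40; exists d => // s s0 std.
have key a b : 0 <= a -> a <= b -> (forall r, a <= r -> r <= b -> `|r - t| < d) ->
    runmax z b <= runmax z a + e / 2.
  move=> a0 ab hr; apply: runmax_le => //.
  - exact: le_trans ab.
  - by rewrite addr_ge0 ?runmax_ge0//; lra.
  move=> r r0 rb; have [ra|ar] := leP r a.
    by have := runmax_ge cz r0 ra; lra.
  have := hd r r0 (hr r (ltW ar) rb); have := hd a a0 (hr a (lexx a) ab).
  rewrite !ltr_norml => /andP[h1 _] /andP[_ h2].
  by have := runmax_ge cz a0 (lexx a); lra.
have [st|ts] := leP s t.
  rewrite ler0_norm ?subr_le0 ?runmax_mono//.
  suff : runmax z t <= runmax z s + e / 2 by lra.
  apply: key => // r sr rt; apply: le_lt_trans std.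
  by rewrite !ler0_norm ?subr_le0//; lra.
rewrite ger0_norm ?subr_ge0 ?runmax_mono ?(ltW ts)//.
suff : runmax z s <= runmax z t + e / 2 by lra.
apply: key => //; first exact: ltW.
move=> r tr rs; apply: le_lt_trans std.
by rewrite !ger0_norm ?subr_ge0 ?(ltW ts)//; lra.
Qed.

(** The running maximum is attained. A maximizer later than [s] lies strictly below it, which is
    possible only if the maximum is 0. *)
Lemma runmax_flat z s t : cont0 z -> 0 <= s -> s <= t ->
  (forall r, s <= r -> r <= t -> z r < runmax z r) -> runmax z s = runmax z t.
Proof.
move=> cz s0 st h; apply/eqP; rewrite eq_le runmax_mono//=.
have [[c [c0 ct cE]] _] := runmax_att cz (le_trans s0 st).
rewrite cE ge_max runmax_ge0// andbT.
have [cs|sc] := leP c s; first exact: runmax_ge.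
have := h c (ltW sc) ct; have := runmax_mono cz c0 ct; rewrite cE.
rewrite le_max => /orP[h1 h2|h1 _]; first by have := lt_le_trans h2 h1; rewrite ltxx.
have := runmax_ge0 cz s0; have := runmax_ge cz c0 (lexx c).
by have := runmax_ge0 cz c0; lra.
Qed.

End skorokhod.

Section picard.
Context (R : realType) (beta x y : R) (w : R -> R).
Hypothesis cw : cont0 w.

Let b t := x + Num.sqrt 2 * w t - beta * t.
Let F (p : (R -> R) * (R -> R)) s := - p.1 s + runmax p.1 s + p.2 s.
Let zstep (p : (R -> R) * (R -> R)) t := b t + rint (F p) t.

(** The unknowns are the unreflected path [z] and [q2]; the reflected path is [z - runmax z] and
    [L = runmax z], so [F] is the integrand [- q1 + q2]. The second component already uses the
    updated [z]. *)
Definition picard_step (p : (R -> R) * (R -> R)) : (R -> R) * (R -> R) :=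
  (zstep p, fun t => y + runmax (zstep p) t - rint p.2 t).

Let cont0_cst (c : R) : cont0 (fun=> c).
Proof. by move=> t _ e e0; exists 1 => // s _ _; rewrite subrr normr0. Qed.

Let cont0_scale (c : R) (f : R -> R) : cont0 f -> cont0 (fun t => c * f t).
Proof.
move=> cf t t0 e e0.
have c0 : 0 < `|c| + 1 by have := normr_ge0 c; lra.
have [d d0 hd] := cf t t0 _ (divr_gt0 e0 c0); exists d => // s s0 st.
rewrite -mulrBr normrM; have := hd s s0 st; rewrite ltr_pdivlMr// => h.
by apply: le_lt_trans h; rewrite mulrC ler_wpM2l// lerDl.
Qed.

Let cb : cont0 b.
Proof.
apply: cont0D; first by apply: cont0D => //; exact: cont0_scale.
apply: cont0N; apply: cont0_scale => t _ e e0; exists e => // s _.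
Qed.

Let cont0p (p : (R -> R) * (R -> R)) := cont0 p.1 /\ cont0 p.2.

Let cF p : cont0p p -> cont0 (F p).
Proof.
move=> [c1 c2]; apply: cont0D => //; apply: cont0D; first exact: cont0N.
exact: cont0_runmax.
Qed.

Let cz p : cont0p p -> cont0 (zstep p).
Proof. by move=> cp; apply: cont0D => //; apply: cont0_rint; exact: cF. Qed.

Let cstep p : cont0p p -> cont0p (picard_step p).
Proof.
move=> cp; split => /=; first exact: cz.
apply: cont0D; last by apply: cont0N; apply: cont0_rint; have [] := cp.
by apply: cont0D => //; apply: cont0_runmax; exact: cz.
Qed.

Let close (p p' : (R -> R) * (R -> R)) (K T : R) := forall t, 0 <= t -> t <= T ->
  `|p.1 t - p'.1 t| <= K * expR (8 * t) /\ `|p.2 t - p'.2 t| <= K * expR (8 * t).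

Let expR_mono (K s t : R) : 0 <= K -> s <= t -> K * expR (8 * s) <= K * expR (8 * t).
Proof. by move=> K0 st; rewrite ler_wpM2l// ler_expR ler_pM2l. Qed.

(** [F] is a sum of three terms each moved by at most the distance of [p] and [p'], so with the
    weight of rate 8 the first component and its running maximum contract by [3/8]; the integral of
    [q2] adds [1/8], for a total of [1/2]. *)
Let contract p p' K T : cont0p p -> cont0p p' -> 0 <= K -> close p p' K T ->
  close (picard_step p) (picard_step p') (K / 2) T.
Proof.
move=> cp cp' K0 h.
have [c1 c2] := cp; have [c1' c2'] := cp'.
have hz t : 0 <= t -> t <= T -> `|zstep p t - zstep p' t| <= 3 * K / 8 * expR (8 * t).
  move=> t0 tT.
  have -> : zstep p t - zstep p' t = rint (fun s => F p s + - F p' s) t.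
    rewrite rintD; [|exact: cF|by apply: cont0N; exact: cF].
    by rewrite rintN; [rewrite /zstep; ring|exact: cF].
  apply: rint_expR_le => //.
  - by apply: cont0D; [exact: cF|apply: cont0N; exact: cF].
  - by rewrite mulr_ge0.
  move=> s s0 st; have sT := le_trans st tT; have [h1 h2] := h s s0 sT.
  have h3 : `|runmax p.1 s - runmax p'.1 s| <= K * expR (8 * s).
    apply: runmax_dist => // r r0 rs; have [h3 _] := h r r0 (le_trans rs sT).
    by apply: le_trans h3 _; exact: expR_mono.
  rewrite /F; have -> : - p.1 s + runmax p.1 s + p.2 s + - (- p'.1 s + runmax p'.1 s + p'.2 s)
    = - (p.1 s - p'.1 s) + (runmax p.1 s - runmax p'.1 s) + (p.2 s - p'.2 s) by ring.
  apply: le_trans (ler_normD _ _) _; have := ler_normD (- (p.1 s - p'.1 s)) (runmax p.1 s - runmax p'.1 s).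
  by rewrite normrN; lra.
move=> t t0 tT; have E0 := expR_ge0 (8 * t).
split => /=.
  apply: le_trans (hz t t0 tT) _; rewrite ler_wpM2r//; lra.
have hm : `|runmax (zstep p) t - runmax (zstep p') t| <= 3 * K / 8 * expR (8 * t).
  apply: runmax_dist => //; [exact: cz|exact: cz|].
  move=> r r0 rt; apply: le_trans (hz r r0 (le_trans rt tT)) _.
  by apply: expR_mono => //; lra.
have hq : `|rint p.2 t - rint p'.2 t| <= K / 8 * expR (8 * t).
  have -> : rint p.2 t - rint p'.2 t = rint (fun s => p.2 s + - p'.2 s) t.
    by rewrite rintD ?rintN//; exact: cont0N.
  apply: rint_expR_le => //; first by apply: cont0D => //; exact: cont0N.
  by move=> s s0 st; have [_ h2] := h s s0 (le_trans st tT).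
have -> : y + runmax (zstep p) t - rint p.2 t - (y + runmax (zstep p') t - rint p'.2 t) =
  (runmax (zstep p) t - runmax (zstep p') t) - (rint p.2 t - rint p'.2 t) by ring.
by apply: le_trans (ler_normB _ _) _; lra.
Qed.

Let it n := iter n picard_step (fun=> 0 : R, fun=> 0 : R).

Let cit n : cont0p (it n).
Proof. by elim: n => [|n IH]; [split; exact: cont0_cst|exact: cstep]. Qed.

Let it_close T : 0 <= T -> exists2 M, 0 < M & forall n, close (it n.+1) (it n) (M * 2^-1 ^+ n) T.
Proof.
move=> T0; have [c1 c2] := cit 1.
have [M1 M10 h1] := cont0_bounded c1 T0; have [M2 M20 h2] := cont0_bounded c2 T0.
exists (M1 + M2); first by lra.
elim=> [|n IH].
  move=> t t0 tT; rewrite expr0 mulr1 !subr0.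
  have e1 : 1 <= expR (8 * t) by rewrite -expR0 ler_expR mulr_ge0.
  have e2 : M1 + M2 <= (M1 + M2) * expR (8 * t) by rewrite ler_peMr//; lra.
  by have := h1 t t0 tT; have := h2 t t0 tT; split; lra.
rewrite exprS; have -> : (M1 + M2) * (2^-1 * 2^-1 ^+ n) = ((M1 + M2) * 2^-1 ^+ n) / 2 by ring.
apply: (@contract (it n.+1) (it n)); [exact: (cit n.+1)|exact: (cit n)| |exact: IH].
by rewrite mulr_ge0 ?exprn_ge0//; lra.
Qed.

Let z t := limn (fun n => (it n).1 t).
Let q t := limn (fun n => (it n).2 t).

Let lim_close T : 0 <= T -> exists2 M, 0 < M & forall n, close (z, q) (it n) (M * 2^-1 ^+ n) T.
Proof.
move=> T0; have [M M0 hM] := it_close T0; exists (M * 2); first by rewrite mulr_gt0.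
move=> n t t0 tT; have E0 := expR_ge0 (8 * t).
have ME0 : 0 <= M * expR (8 * t) by rewrite mulr_ge0// ltW.
have h2 : (0 : R) <= 2^-1 by [].
have h21 : (2^-1 : R) < 1 by lra.
have e : 1 - 2^-1 = 2^-1 :> R by field.
split => /=.
  have [||||_ /(_ n)] := @geometric_cauchy R (fun n => (it n).1 t) (M * expR (8 * t)) 2^-1.
  - exact: ME0.
  - exact: h2.
  - exact: h21.
  - by move=> k; have [h _] := hM k t t0 tT; rewrite mulrAC.
  by rewrite e invrK => h; apply: le_trans h _; lra.
have [||||_ /(_ n)] := @geometric_cauchy R (fun n => (it n).2 t) (M * expR (8 * t)) 2^-1.
- exact: ME0.
- exact: h2.
- exact: h21.
- by move=> k; have [_ h] := hM k t t0 tT; rewrite mulrAC.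
by rewrite e invrK => h; apply: le_trans h _; lra.
Qed.

Let small (M e : R) : 0 <= M -> 0 < e -> exists n, M * 2^-1 ^+ n <= e.
Proof.
move=> M0 e0; have M1 : 0 < M + 1 by lra.
have [n hn] := exp_half_small (divr_gt0 e0 M1); exists n; rewrite exprVn.
have := hn n (leqnn n); rewrite ler_pdivlMr// => h; apply: le_trans h.
by rewrite mulrC ler_wpM2l// ?invr_ge0 ?exprn_ge0// lerDl.
Qed.

Let clim : cont0p (z, q).
Proof.
suff H : forall (f : R -> R) (f_ : nat -> R -> R), (forall n, cont0 (f_ n)) ->
    (forall T, 0 <= T -> exists2 M, 0 < M & forall n t, 0 <= t -> t <= T ->
      `|f t - f_ n t| <= M * 2^-1 ^+ n * expR (8 * t)) -> cont0 f.
  split => /=.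
    apply: (H _ (fun n => (it n).1)) => [n|T T0]; first by have [] := cit n.
    have [M M0 h] := lim_close T0; exists M => // n t t0 tT.
    by have [] := h n t t0 tT.
  apply: (H _ (fun n => (it n).2)) => [n|T T0]; first by have [] := cit n.
  have [M M0 h] := lim_close T0; exists M => // n t t0 tT.
  by have [] := h n t t0 tT.
move=> f f_ cf_ H t t0 e e0.
have t10 : 0 <= t + 1 by lra.
have [M M0 h] := H _ t10.
have e40 : 0 < e / 4 by rewrite divr_gt0.
have ME0 : 0 <= M * expR (8 * (t + 1)) by rewrite mulr_ge0 ?expR_ge0// ltW.
have [n hn] := small ME0 e40.
have hf s : 0 <= s -> s <= t + 1 -> `|f s - f_ n s| <= e / 4.
  move=> s0 st; apply: le_trans (h n s s0 st) _; apply: le_trans hn.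
  rewrite mulrAC ler_wpM2r ?exprn_ge0//; apply: expR_mono => //; exact: ltW.
have [d d0 hd] := cf_ n t t0 _ e40.
exists (Num.min d 1); first by rewrite lt_min d0 ltr01.
move=> s s0; rewrite lt_min => /andP[sd s1].
have st1 : s <= t + 1 by move: s1; rewrite ltr_norml => /andP[]; lra.
have tt1 : t <= t + 1 by lra.
have -> : f s - f t = (f s - f_ n s) + (f_ n s - f_ n t) - (f t - f_ n t) by ring.
apply: le_lt_trans (ler_normB _ _) _.
have := ler_normD (f s - f_ n s) (f_ n s - f_ n t).
by have := hf s s0 st1; have := hf t t0 tt1; have := hd s s0 sd; lra.
Qed.

Let fixpoint0 t : 0 <= t -> z t = zstep (z, q) t /\
  q t = y + runmax (zstep (z, q)) t - rint q t.
Proof.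
move=> t0; have [M M0 hM] := lim_close t0.
have E0 := expR_ge0 (8 * t).
have close0 (a c : R) : (forall n, `|a - c| <= 2 * M * expR (8 * t) * 2^-1 ^+ n) -> a = c.
  move=> h; apply/eqP; rewrite -subr_eq0 -normr_le0 leNgt; apply/negP => a0.
  have ME0 : 0 <= 2 * M * expR (8 * t) by rewrite !mulr_ge0// ltW.
  have [n hn] := small ME0 (divr_gt0 a0 (ltr0Sn R 1)).
  by have := h n; lra.
have step n : close (z, q) (it n.+1) (M * 2^-1 ^+ n) t.
  have := hM n.+1; rewrite exprS; set K := 2^-1 ^+ n => h s s0 st.
  have K0 : 0 <= K by rewrite exprn_ge0.
  have [h1 h2] := h s s0 st.
  have le1 : M * (2^-1 * K) * expR (8 * s) <= M * K * expR (8 * s).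
    by rewrite ler_wpM2r ?expR_ge0// ler_wpM2l ?(ltW M0)//; lra.
  by split; [exact: le_trans h1 le1|exact: le_trans h2 le1].
have ctr n : close (picard_step (z, q)) (it n.+1) (M * 2^-1 ^+ n / 2) t.
  apply: (@contract (z, q) (it n)); [exact: clim|exact: (cit n)| |exact: hM].
  by rewrite mulr_ge0 ?exprn_ge0// ltW.
split.
  apply: close0 => n; have [h1 _] := step n t t0 (lexx t).
  have [h2 _] := ctr n t t0 (lexx t).
  have -> : z t - zstep (z, q) t = (z t - (it n.+1).1 t) - (zstep (z, q) t - (it n.+1).1 t) by ring.
  apply: le_trans (ler_normB _ _) _; move: h1 h2 => /=.
  set K := 2^-1 ^+ n; have : 0 <= M * K * expR (8 * t) by rewrite !mulr_ge0 ?exprn_ge0// ltW.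
  by rewrite -!mulrA [expR _ * K]mulrC !mulrA; lra.
apply: close0 => n; have [_ h1] := step n t t0 (lexx t).
have [_ h2] := ctr n t t0 (lexx t).
set Q := y + _ - _ in h2 *.
have -> : q t - Q = (q t - (it n.+1).2 t) - (Q - (it n.+1).2 t) by ring.
apply: le_trans (ler_normB _ _) _; move: h1 h2 => /=; rewrite -/Q.
set K := 2^-1 ^+ n; have : 0 <= M * K * expR (8 * t) by rewrite !mulr_ge0 ?exprn_ge0// ltW.
by rewrite -!mulrA [expR _ * K]mulrC !mulrA; lra.
Qed.

Let fixpoint t : 0 <= t -> z t = zstep (z, q) t /\ q t = y + runmax z t - rint q t.
Proof.
move=> t0; have [h1 h2] := fixpoint0 t0; split => //; rewrite {1}h2.
congr (_ + _ - _); apply/eqP; rewrite -subr_eq0 -normr_le0.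
apply: runmax_dist => //; [exact: (cz clim)|by have [] := clim|].
by move=> s s0 st; have [<- _] := fixpoint0 s0; rewrite subrr normr0.
Qed.

Lemma reflected_sol_exists : x <= 0 -> w 0 = 0 ->
  exists q1 q2 L, reflected_sol beta x y w q1 q2 L.
Proof.
move=> x0 w0; have [c1 c2] := clim; rewrite /= in c1 c2.
have cL := cont0_runmax c1.
exists (fun t => z t - runmax z t), q, (runmax z).
split; last split; last split; last split; last split; last split; last split;
  last split; last split.
- move=> t t0; have [-> _] := fixpoint t0; rewrite /zstep /b; congr (_ + _ - _).
  by apply: eq_Rintegral => s _; rewrite /F /= opprB addrC [in RHS]addrC [- _ + _]addrC.
- by move=> t t0; have [_ ->] := fixpoint t0.
- by apply/cont0P; apply: cont0D => //; exact: cont0N.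
- exact/cont0P.
- have [z0 _] := fixpoint (lexx 0).
  have [[c [c0 c0' ->]] _] := runmax_att c1 (lexx 0).
  have -> : c = 0 by apply/eqP; rewrite eq_le c0 c0'.
  by rewrite z0 /zstep /b w0 rint0 !mulr0 !addr0 subr0; apply/max_idPr.
- by move=> s t; exact: runmax_mono.
- by move=> t; exact: runmax_ge0.
- move=> t t0; apply/cvgrPdist_lt => e e0; have [d d0 hd] := cL t t0 e e0.
  near=> r; rewrite distrC; apply: hd.
    by apply: le_trans t0 _; near: r; exact: nbhs_right_ge.
  rewrite ger0_norm ?subr_ge0; last by near: r; exact: nbhs_right_ge.
  by rewrite ltrBlDr addrC; near: r; apply: nbhs_right_lt; rewrite ltrDl.
- by move=> t t0; rewrite subr_le0; exact: runmax_ge.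
- move=> s t s0 st h; apply: runmax_flat => // r sr rt.
  by have := h r sr rt; rewrite subr_lt0.
Unshelve. all: by end_near. Qed.

End picard.

(** * Coupling of a stationary start with a Brownian driver *)

Lemma measurable_bigcap_preimage (R : realType) (d : measure_display)
    (T : measurableType d) (n : nat) (f : nat -> T -> R) (B : nat -> set R) :
  (forall i, measurable_fun setT (f i)) -> (forall i, measurable (B i)) ->
  measurable (\bigcap_(i in `I_n) [set w | B i (f i w)]).
Proof.
move=> mf mB; rewrite -[X in measurable X]setCK setC_bigcap.
apply: measurableC; apply: bigcup_measurable => i _; apply: measurableC.
by rewrite -[X in measurable X]setTI; exact: mf.
Qed.

Section altered_probability.
Context (R : realType) (d : measure_display) (T : measurableType d)
  (P : probability T R) (c : {nonneg R}).
Local Open Scope ereal_scope.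

(* A probability is unconstrained on non-measurable sets. *)
Definition altered (A : set T) : \bar R :=
  if `[< measurable A >] then P A else c%:num%:E.

Lemma alteredE A : measurable A -> altered A = P A.
Proof. by move=> mA; rewrite /altered asboolT. Qed.

Let altered0 : altered set0 = 0.
Proof. by rewrite alteredE// measure0. Qed.

Let altered_ge0 A : 0 <= altered A.
Proof. by rewrite /altered; case: ifP => _ //; rewrite lee_fin. Qed.

Let altered_sigma_additive : semi_sigma_additive altered.
Proof.
move=> F mF tF mU; rewrite alteredE//.
under eq_fun do under eq_bigr do rewrite alteredE//.
exact: measure_semi_sigma_additive.
Qed.

HB.instance Definition _ := isMeasure.Build _ _ _ altered
  altered0 altered_ge0 altered_sigma_additive.

Let altered_setT : altered setT = 1.
Proof. by rewrite alteredE// probability_setT. Qed.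

HB.instance Definition _ := @Measure_isProbability.Build _ _ R altered altered_setT.

End altered_probability.

Section stationary_coupling.
Context (R : realType) (beta : R) (pi : probability (R * R)%type R).
Hypothesis stat : stationary_dist beta pi.

(* Stationarity also holds for [altered P], whose value on a non-measurable
   event could be chosen to contradict it. *)
Lemma stationary_measurable (d : measure_display) (Omega : measurableType d)
    (P : probability Omega R) (W : R -> Omega -> R) (X Y : Omega -> R)
    (Q1 Q2 L : R -> Omega -> R) :
  brownian_motion P W -> measurable_fun setT X -> measurable_fun setT Y ->
  (forall A : set (R * R)%type, measurable A -> P [set w | A (X w, Y w)] = pi A) ->
  indep_init P X Y W ->
  (forall w, reflected_sol beta (X w) (Y w) (fun t => W t w)
    (fun t => Q1 t w) (fun t => Q2 t w) (fun t => L t w)) ->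
  forall t, 0 <= t -> forall A : set (R * R)%type, measurable A ->
  measurable [set w | A (Q1 t w, Q2 t w)].
Proof.
move=> BM mX mY lawXY ind sol t t0 A mA; apply: contrapT => nm.
have [mW W0 cW fdd] := BM.
have mXY : measurable_fun setT (fun w => (X w, Y w)) by exact: measurable_fun_pair.
(* The value given to non-measurable events is chosen different from [pi A], the value that
   stationarity would force. *)
have c0 : 0 <= fine (pi A) + 1 by rewrite addr_ge0// fine_ge0.
pose P' := altered P (NngNum c0).
have mXYA (B : set (R * R)) : measurable B -> measurable [set w | B (X w, Y w)].
  by move=> mB; rewrite -[X in measurable X]setTI; exact: mXY.
have BM' : brownian_motion P' W.
  split => // n s B s0 sS mB.
  rewrite /P' [LHS]alteredE; first exact: fdd.
  apply: (@measurable_bigcap_preimage R _ _ n (fun i w => W (s i.+1) w - W (s i) w)) => // i.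
  exact: measurable_funB.
have ind' : indep_init P' X Y W.
  move=> n s B D mD mB s0; rewrite /P' [LHS]alteredE; last first.
    by apply: measurableI; [exact: mXYA|apply: (@measurable_bigcap_preimage R _ _ n (fun i => W (s i)))].
  rewrite [RHS](_ : _ = P [set w | D (X w, Y w)] *
      P (\bigcap_(i in `I_n) [set w | B i (W (s i) w)]))%E; first exact: ind.
  congr (_ * _)%E; first by apply: alteredE; exact: mXYA.
  by apply: alteredE; apply: (@measurable_bigcap_preimage R _ _ n (fun i => W (s i))).
have law' (B : set (R * R)%type) : measurable B -> P' [set w | B (X w, Y w)] = pi B.
  by move=> mB; rewrite [LHS]alteredE ?lawXY//; exact: mXYA.
have [_ st] := stat.
have := st _ _ _ _ _ _ _ _ _ BM' mX mY law' ind' sol t t0 A mA.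
rewrite [LHS](_ : _ = (fine (pi A) + 1)%:E); last by rewrite /P' /= /altered asboolF.
rewrite EFinD fineK ?fin_num_measure// => /eqP.
rewrite -[pi A in X in _ == X]fineK ?fin_num_measure// -[pi A]fineK ?fin_num_measure//.
by rewrite -EFinD eqe; lra.
Qed.

Definition init_ok (p : R * R) : bool := (p.1 <= 0) && (0 < p.2).
(** A solution is required at every sample point and its existence asks for a nonpositive start.
    States outside the full-measure set [init_ok] are replaced by [(0, 1)], which leaves the law
    unchanged. *)
Definition init1 (p : R * R) : R := if init_ok p then p.1 else 0.
Definition init2 (p : R * R) : R := if init_ok p then p.2 else 1.

Lemma init1_le0 p : init1 p <= 0.
Proof. by rewrite /init1; case: ifP => // /andP[]. Qed.

Lemma init2_ge0 p : 0 <= init2 p.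
Proof. by rewrite /init2; case: ifP => // /andP[_ /ltW]. Qed.

Lemma measurable_init_ok : measurable [set p : R * R | init_ok p].
Proof.
rewrite (_ : [set p | _] = (fst @^-1` `]-oo, 0%R]%classic) `&` (snd @^-1` `]0%R, +oo[%classic)).
  by apply: measurableI; rewrite -[X in measurable X]setTI;
    [exact: measurable_fst|exact: measurable_snd].
apply/seteqP; split => p; rewrite /init_ok /= !in_itv/= andbT; first by move=> /andP.
by move=> [-> ->].
Qed.

Lemma measurable_init1 : measurable_fun setT init1.
Proof.
rewrite (_ : init1 = fun p => p.1 * \1_[set p | init_ok p] p).
  by apply: measurable_funM => //; apply: measurable_indic; exact: measurable_init_ok.
apply/funext => p; rewrite /init1 indicE; case: ifPn => h.
  by rewrite mem_set// mulr1.
by rewrite memNset ?mulr0//=; exact/negP.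
Qed.

Lemma measurable_init2 : measurable_fun setT init2.
Proof.
rewrite (_ : init2 = fun p => (p.2 - 1) * \1_[set p | init_ok p] p + 1).
  apply: measurable_funD => //; apply: measurable_funM; first exact: measurable_funB.
  by apply: measurable_indic; exact: measurable_init_ok.
apply/funext => p; rewrite /init2 indicE; case: ifPn => h.
  by rewrite mem_set// mulr1 subrK.
by rewrite memNset ?mulr0 ?add0r//=; exact/negP.
Qed.

Lemma pi_init_ok : pi [set p | init_ok p] = 1%E.
Proof.
have [<- _] := stat; congr (pi _); apply/seteqP; split => p; rewrite /init_ok /=.
  by move=> /andP.
by move=> [-> ->].
Qed.

Lemma pi_init (A : set (R * R)) : measurable A ->
  pi [set p | A (init1 p, init2 p)] = pi A.
Proof.
move=> mA.
have mi : measurable_fun setT (fun p => (init1 p, init2 p)).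
  by apply: measurable_fun_pair; [exact: measurable_init1|exact: measurable_init2].
have mA' : measurable [set p | A (init1 p, init2 p)].
  by rewrite -[X in measurable X]setTI; exact: mi.
rewrite -(prob_setI_full mA' measurable_init_ok pi_init_ok).
rewrite -(prob_setI_full mA measurable_init_ok pi_init_ok); congr (pi _).
by apply/seteqP; split => -[a b] [h1 h2]; split => //; move: h1;
  rewrite /= /init1 /init2 (h2 : init_ok (a, b)).
Qed.

Lemma brownian_scale (d : measure_display) (Omega : measurableType d)
    (P : probability Omega R) (W : R -> Omega -> R) (c : R) : 0 < c ->
  brownian_motion P W -> brownian_motion P (fun t w => Num.sqrt c * W (t / c) w).
Proof.
move=> c0 [mW W0 cW fdd]; have sc0 : 0 < Num.sqrt c by rewrite sqrtr_gt0.
split.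
- by move=> t; apply: measurable_funM => //; exact: mW.
- by move=> w; rewrite mul0r W0 mulr0.
- move=> w; apply/cont0P => t t0 e e0.
  have cw : cont0 (fun t => W t w) by exact/cont0P.
  have [d' d0 hd] := cw (t / c) (divr_ge0 t0 (ltW c0)) _ (divr_gt0 e0 sc0).
  exists (d' * c); first by rewrite mulr_gt0.
  move=> s s0 st; rewrite -mulrBr normrM (ger0_norm (ltW sc0)) mulrC -ltr_pdivlMr//.
  apply: hd; first by rewrite divr_ge0// ltW.
  by rewrite -mulrBl normrM (ger0_norm (_ : 0 <= c^-1)) ?invr_ge0 ?(ltW c0)// ltr_pdivrMr.
- move=> n s B s0 sS mB.
  have ms : measurable_fun setT (fun x : R => Num.sqrt c * x) by exact: measurable_funM.
  have mB' i : measurable [set x : R | B i (Num.sqrt c * x)].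
    by rewrite -[X in measurable X]setTI; exact: (ms measurableT _ (mB i)).
  have s0' : 0 <= s 0%N / c by rewrite divr_ge0 ?(ltW c0).
  have ci : 0 < c^-1 by rewrite invr_gt0.
  have sS' i : s i / c < s i.+1 / c by rewrite (ltr_pM2r ci).
  have h := fdd n (fun i => s i / c) (fun i => [set x | B i (Num.sqrt c * x)]) s0' sS' mB'.
  transitivity (P (\bigcap_(i in `I_n) [set w | B i (Num.sqrt c * (W (s i.+1 / c) w - W (s i / c) w))])).
    congr (P _); apply: eq_bigcapr => i _; apply/seteqP; split => w /=;
    by rewrite mulrBr.
  transitivity (\prod_(i < n) normal_prob 0 (Num.sqrt (s i.+1 / c - s i / c))
      [set x | B i (Num.sqrt c * x)%R])%E; first exact: h.
  apply: eq_bigr => i _.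
  have d1 : 0 < s i.+1 - s i by rewrite subr_gt0.
  have e1 : Num.sqrt (s i.+1 / c - s i / c) = Num.sqrt (s i.+1 - s i) / Num.sqrt c.
    by rewrite -mulrBl sqrtrM ?(ltW d1)// sqrtrV// ltW.
  have p2 : 0 < Num.sqrt (s i.+1 - s i) by rewrite sqrtr_gt0.
  have p1 : 0 < Num.sqrt (s i.+1 / c - s i / c) by rewrite e1 divr_gt0.
  have n1 := normal_prob_scale p1 (mB' i).
  have n2 := normal_prob_scale p2 (mB i).
  transitivity (normal_prob 0 1 [set x | B i (Num.sqrt c * (Num.sqrt (s i.+1 / c - s i / c) * x))]).
    exact: n1.
  transitivity (normal_prob 0 1 [set x | B i (Num.sqrt (s i.+1 - s i) * x)]); last exact: esym n2.
  have e2 z : Num.sqrt c * (Num.sqrt (s i.+1 / c - s i / c) * z) = Num.sqrt (s i.+1 - s i) * z.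
    by rewrite e1; field; rewrite gt_eqF.
  by congr (normal_prob 0 1 _); apply/seteqP; split => z /=; rewrite e2.
Qed.

Lemma stationary_coupling (d : measure_display) (Omega : measurableType d)
    (P : probability Omega R) (W : R -> Omega -> R) (c : R) : 0 < c ->
  brownian_motion P W ->
  exists Q1 Q2 : (R * R) * Omega -> R,
  [/\ measurable_fun setT (fun pw => (Q1 pw, Q2 pw)),
      (forall A : set (R * R), measurable A ->
        (pi \x P)%E [set pw | A (Q1 pw, Q2 pw)] = pi A) &
      forall p w, exists q1 q2 L,
        [/\ reflected_sol beta (init1 p) (init2 p)
              (fun t => Num.sqrt c * W (t / c) w) q1 q2 L,
            Q1 (p, w) = q1 c & Q2 (p, w) = q2 c]].
Proof.
move=> c0 BM; have BMc := brownian_scale c0 BM; have [mW W0 cW fdd] := BMc.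
set Wc := fun t w => Num.sqrt c * W (t / c) w in BMc mW W0 cW fdd *.
have ex (pw : (R * R) * Omega) : exists q : (R -> R) * (R -> R) * (R -> R),
    reflected_sol beta (init1 pw.1) (init2 pw.1) (fun t => Wc t pw.2) q.1.1 q.1.2 q.2.
  have [|||q1 [q2 [L h]]] := @reflected_sol_exists R beta (init1 pw.1) (init2 pw.1) (fun t => Wc t pw.2).
  - by apply/cont0P; exact: (cW pw.2).
  - exact: init1_le0.
  - exact: W0.
  by exists (q1, q2, L).
have /choice[q hq] := ex.
pose PP : probability ((R * R) * Omega)%type R := (pi \x P)%E.
pose X (pw : (R * R) * Omega) := init1 pw.1; pose Y (pw : (R * R) * Omega) := init2 pw.1.
have mX : measurable_fun setT X by exact: (measurableT_comp measurable_init1 measurable_fst).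
have mY : measurable_fun setT Y by exact: (measurableT_comp measurable_init2 measurable_fst).
pose V t (pw : (R * R) * Omega) := Wc t pw.2.
have PPX (A : set (R * R)) (B : set Omega) : measurable A -> measurable B ->
    PP [set pw | A pw.1 /\ B pw.2] = (pi A * P B)%E.
  by move=> mA mB; rewrite -product_measure1E.
have PP2 (B : set Omega) : measurable B -> PP [set pw | B pw.2] = P B.
  move=> mB; rewrite -[RHS]mul1e -(probability_setT pi) -PPX//; congr (PP _).
  by apply/seteqP; split => pw //= [].
have mi : measurable_fun setT (fun p => (init1 p, init2 p)).
  by apply: measurable_fun_pair; [exact: measurable_init1|exact: measurable_init2].
have mA' (A : set (R * R)) : measurable A -> measurable [set p | A (init1 p, init2 p)].
  by move=> mA; rewrite -[X in measurable X]setTI; exact: mi.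
have BMV : brownian_motion PP V.
  split.
  - by move=> t; exact: (measurableT_comp (mW t) measurable_snd).
  - by move=> pw; exact: W0.
  - by move=> pw; exact: cW.
  - move=> n s B s0 sS mB; rewrite -fdd// -PP2//.
    by apply: (@measurable_bigcap_preimage R _ _ n (fun i w => Wc (s i.+1) w - Wc (s i) w)) => // i; apply: measurable_funB; exact: mW.
have law (A : set (R * R)) : measurable A -> PP [set pw | A (X pw, Y pw)] = pi A.
  move=> mA; rewrite -(pi_init mA) -[RHS]mule1 -(probability_setT P) -PPX//; last exact: mA'.
  by congr (PP _); apply/seteqP; split => pw //= [].
have ind : indep_init PP X Y V.
  move=> n s B A mA mB s0; rewrite law//.
  have mC : measurable (\bigcap_(i in `I_n) [set w | B i (Wc (s i) w)]).
    by apply: (@measurable_bigcap_preimage R _ _ n (fun i => Wc (s i))) => // i; exact: mW.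
  have -> : PP (\bigcap_(i in `I_n) [set w | B i (V (s i) w)]) =
      P (\bigcap_(i in `I_n) [set w | B i (Wc (s i) w)]) by rewrite -PP2.
  by rewrite -(pi_init mA) -PPX//; exact: mA'.
have mQ := stationary_measurable (Q1 := fun t pw => (q pw).1.1 t)
  (Q2 := fun t pw => (q pw).1.2 t) (L := fun t pw => (q pw).2 t) BMV mX mY law ind hq (ltW c0).
exists (fun pw => (q pw).1.1 c), (fun pw => (q pw).1.2 c); split.
- by move=> _ A mA; rewrite setTI; exact: mQ.
- move=> A mA; have [_ st] := stat.
  exact: (st _ _ _ _ _ _ (fun t pw => (q pw).1.1 t) (fun t pw => (q pw).1.2 t)
    (fun t pw => (q pw).2 t) BMV mX mY law ind hq c (ltW c0) A mA).
- by move=> p w; exists (q (p, w)).1.1, (q (p, w)).1.2, (q (p, w)).2; split => //; exact: (hq (p, w)).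
Qed.

End stationary_coupling.

(** * Comparing the stationary law with itself across a fixed time *)

Section stationary_comparison.
Context (R : realType) (beta : R) (pi : probability (R * R)%type R).
Hypothesis stat : stationary_dist beta pi.
Context (d : measure_display) (Omega : measurableType d)
  (P : probability Omega R) (W : R -> Omega -> R).
Hypothesis BM : brownian_motion P W.

(** [p] and [q] are the states at times 0 and [c]. Rescaling the driver puts the whole horizon
    inside [[0, 1]], where the modulus of [W] is known. *)
Definition solves_at (c : R) (p q : R * R) (w : Omega) : Prop :=
  [/\ p.1 <= 0, 0 <= p.2 & exists q1 q2 L,
    [/\ reflected_sol beta p.1 p.2 (fun t => Num.sqrt c * W (t / c) w) q1 q2 L,
      q1 c = q.1 & q2 c = q.2]].

Let coupling (c : R) : 0 < c -> exists Q : (R * R) * Omega -> R * R,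
  [/\ measurable_fun setT Q,
      forall A : set (R * R), measurable A -> (pi \x P)%E (Q @^-1` A) = pi A &
      forall p w, solves_at c (init1 p, init2 p) (Q (p, w)) w].
Proof.
move=> c0; have [Q1 [Q2 [mQ lawQ solQ]]] := stationary_coupling stat c0 BM.
exists (fun pw => (Q1 pw, Q2 pw)); split => // p w; split.
- exact: init1_le0.
- exact: init2_ge0.
- by have [q1 [q2 [L [h -> ->]]]] := solQ p w; exists q1, q2, L.
Qed.

Let meas_init : measurable_fun setT (fun p : R * R => (init1 p, init2 p)).
Proof.
by apply: measurable_fun_pair; [exact: measurable_init1|exact: measurable_init2].
Qed.

Let measB (B : set (R * R)) : measurable B ->
  measurable [set p | B (init1 p, init2 p)].
Proof. by move=> mB; rewrite -[X in measurable X]setTI; exact: meas_init. Qed.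

Lemma stationary_le (c : R) (A B : set (R * R)) (C : set Omega) : 0 < c ->
  measurable A -> measurable B -> measurable C ->
  (forall p q w, solves_at c p q w -> A q -> B p \/ C w) ->
  (pi A <= pi B + P C)%E.
Proof.
move=> c0 mA mB mC h; have [Q [mQ lawQ solQ]] := coupling c0.
have mB' := measB mB.
rewrite -lawQ//.
have m1 : measurable ([set p | B (init1 p, init2 p)] `*` (setT : set Omega)).
  exact: measurableX.
have m2 : measurable ((setT : set (R * R)) `*` C) by exact: measurableX.
have e1 : (pi \x P)%E ([set p | B (init1 p, init2 p)] `*` (setT : set Omega)) = pi B.
  rewrite -[RHS](pi_init stat mB) -[RHS]mule1 -(probability_setT P).
  exact: (product_measure1E pi P mB' measurableT).
have e2 : (pi \x P)%E ((setT : set (R * R)) `*` C) = P C.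
  rewrite -[RHS]mul1e -(probability_setT pi).
  exact: (product_measure1E pi P measurableT mC).
rewrite -[X in (_ <= X + _)%E]e1 -[X in (_ <= _ + X)%E]e2.
apply: (@le_trans _ _ ((pi \x P)%E (([set p | B (init1 p, init2 p)] `*` setT) `|`
   (setT `*` C)))); last by apply: measureU2.
apply: le_measure; rewrite ?inE; last 1 first.
- by move=> [p w] /= /(h _ _ _ (solQ p w))[?|?]; [left|right].
- by rewrite -[X in measurable X]setTI; exact: mQ.
- exact: measurableU.
Qed.

(** The initial state and the driver live on different factors of the product space, so the events
    [B] and [C] are independent. *)
Lemma stationary_ge (c : R) (A B : set (R * R)) (C : set Omega) : 0 < c ->
  measurable A -> measurable B -> measurable C ->
  (forall p q w, solves_at c p q w -> B p -> C w -> A q) ->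
  (pi B * P C <= pi A)%E.
Proof.
move=> c0 mA mB mC h; have [Q [mQ lawQ solQ]] := coupling c0.
have mB' := measB mB.
rewrite -[leRHS]lawQ// -(pi_init stat mB).
rewrite -[leLHS](product_measure1E pi P mB' mC).
apply: le_measure; rewrite ?inE; last 1 first.
- by move=> [p w] [/= Bp Cw]; exact: (h _ _ _ (solQ p w)).
- exact: measurableX.
- by rewrite -[X in measurable X]setTI; exact: mQ.
Qed.

Lemma stationary_integral_le (c : R) (f : R * R -> \bar R)
    (g : (R * R) * Omega -> \bar R) : 0 < c ->
  measurable_fun setT f -> measurable_fun setT g ->
  (forall p, 0 <= f p)%E -> (forall pw, 0 <= g pw)%E ->
  (forall p q w, solves_at c p q w -> (f q <= g (p, w))%E) ->
  (\int[pi]_p f p <= \int[pi]_p \int[P]_w g (p, w))%E.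
Proof.
move=> c0 mf mg f0 g0 h; have [Q [mQ lawQ solQ]] := coupling c0.
pose PP := (pi \x P)%E.
have -> : (\int[pi]_p f p = \int[PP]_pw f (Q pw))%E.
  transitivity (\int[image_measure PP mQ]_p f p)%E.
    apply: eq_measure_integral => A mA _; exact: esym (lawQ A mA).
  exact: (ge0_integral_pushforward mQ PP).
pose J (pw : (R * R) * Omega) := ((init1 pw.1, init2 pw.1), pw.2).
have mJ : measurable_fun setT J.
  apply: measurable_fun_pair => //.
  exact: (measurableT_comp meas_init measurable_fst).
have mgJ : measurable_fun setT (g \o J) by exact: measurableT_comp.
apply: (@le_trans _ _ (\int[PP]_pw (g \o J) pw)%E).
  apply: ge0_le_integral => //.
  - exact: (measurableT_comp mf mQ).
  - by move=> [p w] _; exact: h.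
rewrite /PP fubini_tonelli1//; last by move=> pw; exact: g0.
pose G p := (\int[P]_w g (p, w))%E.
have mG : measurable_fun setT G.
  by apply: measurable_fun_fubini_tonelli_F.
rewrite [leRHS](_ : _ = \int[image_measure pi meas_init]_p G p)%E; last first.
  apply: eq_measure_integral => A mA _; exact: esym (pi_init stat mA).
rewrite [leRHS](ge0_integral_pushforward meas_init pi)//.
by move=> p _; exact: integral_ge0.
Qed.

End stationary_comparison.

(** * Tails of the first coordinate and lower tail of the second *)

Lemma sqrt2_mul7_le (R : realType) : Num.sqrt 2 * 7 <= 10 :> R.
Proof.
rewrite -ler_pdivlMr// -[leRHS]ger0_norm; last by rewrite divr_ge0.
by rewrite -sqrtr_sqr ler_sqrt; [lra|exact: sqr_ge0].
Qed.

Lemma measurable_fst_lt (R : realType) (a : R) : measurable [set p : R * R | p.1 < a].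
Proof.
rewrite (_ : [set p | _] = fst @^-1` `]-oo, a[%classic).
  by rewrite -[X in measurable X]setTI; exact: measurable_fst.
by apply/seteqP; split => p /=; rewrite in_itv.
Qed.

Lemma measurable_snd_gt (R : realType) (a : R) : measurable [set p : R * R | a < p.2].
Proof.
rewrite (_ : [set p | _] = snd @^-1` `]a, +oo[%classic).
  by rewrite -[X in measurable X]setTI; exact: measurable_snd.
by apply/seteqP; split => p /=; rewrite in_itv/= andbT.
Qed.

Section stationary_tails.
Context (R : realType) (beta : R) (pi : probability (R * R)%type R).
Hypothesis beta0 : 0 < beta.
Hypothesis stat : stationary_dist beta pi.
Context (d : measure_display) (Omega : measurableType d)
  (P : probability Omega R) (W : R -> Omega -> R) (A : nat -> set Omega).
Hypothesis tame : tame_brownian P W A.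

Let BM : brownian_motion P W. Proof. by case: tame. Qed.
Let mA h : measurable (A h). Proof. by case: tame. Qed.
Let PAC h : (P (~` A h) <= (4 * expR (- (h%:R ^+ 2 / 4)))%:E)%E.
Proof. by case: tame. Qed.
Let W0 w : W 0 w = 0. Proof. by case: BM. Qed.

Let modulus h w n (s t : R) : A h w -> 0 <= s -> s <= t -> t <= 1 ->
  t - s <= (2 ^+ n)^-1 -> `|W t w - W s w| <= 7 * (h + 8)%:R * (3 / 4) ^+ n.
Proof. by case: tame => _ _ _ _; exact. Qed.

Let osc h w (s t : R) : A h w -> 0 <= s -> s <= t -> t <= 1 ->
  `|W t w - W s w| <= 7 * (h + 8)%:R.
Proof.
move=> hA s0 st t1; have := @modulus h w 0 s t hA s0 st t1.
by rewrite !expr0 mulr1 invr1; apply; lra.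
Qed.

Let sqrt2_osc (a : R) (h : nat) : a <= 7 * (h + 8)%:R -> Num.sqrt 2 * a <= 10 * (h + 8)%:R.
Proof.
move=> ah; apply: (@le_trans _ _ (Num.sqrt 2 * (7 * (h + 8)%:R))).
  by rewrite ler_wpM2l ?sqrtr_ge0.
by rewrite mulrA ler_wpM2r ?sqrt2_mul7_le.
Qed.

Let path0 (c : R) w : Num.sqrt c * W (0 / c) w = 0.
Proof. by rewrite mul0r W0 mulr0. Qed.

Let F (x : R) := pi [set p : R * R | p.1 < - x].

(** On [A h] the drift and the noise contribute at most [x / 4], so [u 1 > x] forces
    [u 0 > 2 (x - x / 4) = 3 x / 2]. *)
Let F_step (x : R) (h : nat) : beta + 10 * (h + 8)%:R <= x / 4 ->
  (F x <= F (3 / 2 * x) + (4 * expR (- (h%:R ^+ 2 / 4)))%:E)%E.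
Proof.
move=> hx; have b0 := beta0; apply: le_trans (leeD2l _ (PAC h)).
apply: (stationary_le stat BM ltr01); [exact: measurable_fst_lt|exact: measurable_fst_lt|exact: measurableC|].
move=> p q w [p1 p2 [q1 [q2 [L [sol e1 e2]]]]] /= qx.
have [hA|] := pselect (A h w); last by right.
left; have e0 := reflected_q1_0 sol (path0 1 w).
have := reflected_u_contract beta0 p2 sol (m := 10 * (h + 8)%:R).
rewrite e0 e1 => ineq.
have : - q.1 <= - p.1 / 2 + beta + 10 * (h + 8)%:R.
  apply: ineq => s s0 s1; rewrite sqrtr1 !divr1 !mul1r; apply: sqrt2_osc.
  exact: (osc hA s0 s1 (lexx 1)).
lra.
Qed.

(** For [h] within 1 above [x / 80], [beta + 10 (h + 8)] is at most [beta + 90 + x / 8], which is at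
    most [x / 4] as soon as [x >= 8 beta + 720]. Moreover [h^2 / 4 >= (x / 160)^2]. *)
Let F_step' (x : R) : 8 * beta + 720 <= x ->
  (F x <= F (3 / 2 * x) + (4 * expR (- ((x / 160) ^+ 2)))%:E)%E.
Proof.
move=> hx; have b0 := beta0; have x0 : 0 <= x / 80 by lra.
set h := (Num.truncn (x / 80)).+1.
have h1 : x / 80 < h%:R by exact: truncnS_gt.
have h2 : h%:R <= x / 80 + 1.
  by rewrite /h -natr1 lerD2r; have /andP[] := truncn_itv x0.
apply: le_trans (@F_step x h _) _.
  by rewrite natrD; lra.
rewrite leeD2l// lee_fin ler_pM2l// ler_expR lerN2.
have -> : h%:R ^+ 2 / 4 = (h%:R / 2) ^+ 2 :> R by field.
by rewrite ler_sqr ?nnegrE; lra.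
Qed.

(** The constant 8 reproduces itself: the error at [3 x / 2] is at most half of the error at [x],
    because [k >= 1], and [4 + 8 / 2 = 8]. *)
Let F_iter n (x : R) : 8 * beta + 720 <= x ->
  (F x <= F ((3 / 2) ^+ n * x) + (8 * expR (- ((x / 160) ^+ 2)))%:E)%E.
Proof.
have b0 := beta0; elim: n x => [|n IH] x hx.
  by rewrite expr0 mul1r; apply: leeDl; rewrite lee_fin mulr_ge0 ?expR_ge0.
apply: le_trans (F_step' hx) _.
have hx' : 8 * beta + 720 <= 3 / 2 * x by lra.
apply: le_trans (leeD2r _ (IH _ hx')) _.
have -> : (3 / 2) ^+ n.+1 * x = (3 / 2) ^+ n * (3 / 2 * x) by rewrite exprS; ring.
rewrite -addeA; apply: leeD2l; rewrite -EFinD lee_fin.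
set k := (x / 160) ^+ 2.
have k1 : 1 <= k.
  by rewrite /k -[leLHS](expr1n _ 2) ler_sqr ?nnegrE//; lra.
have -> : - ((3 / 2 * x / 160) ^+ 2) = - k - 5 / 4 * k by rewrite /k; field.
have : expR (- k - 5 / 4 * k) <= expR (- k) * (1 / 2).
  rewrite expRD ler_pM2l ?expR_gt0// expRN mul1r lef_pV2 ?posrE ?expR_gt0//.
  by have := expR_ge1Dx (5 / 4 * k); lra.
lra.
Qed.

Let F_small (e : R) : 0 < e -> exists N : nat, (F N%:R <= e%:E)%E.
Proof.
move=> e0; pose G (n : nat) := [set p : R * R | p.1 < - n%:R].
have G0 : \bigcap_n G n = set0.
  apply/seteqP; split => // p /(_ (Num.truncn (- p.1)).+1 I) /=.
  by rewrite /G /= => h; have := truncnS_gt (- p.1); lra.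
have : (pi \o G) x @[x --> \oo] --> pi (\bigcap_n G n).
  apply: nonincreasing_cvg_mu.
  - by rewrite ltey_eq fin_num_measure//; exact: measurable_fst_lt.
  - by move=> i; exact: measurable_fst_lt.
  - by rewrite G0.
  - move=> n m nm; apply/subsetPset => p /= h; apply: lt_le_trans h _.
    by rewrite lerN2 ler_nat.
rewrite G0 measure0 => /fine_cvgP[[N _ Nfin] /cvgrPdist_le/(_ e e0)[M _ hM]].
exists (maxn N M); have := hM (maxn N M) (leq_maxr _ _).
have := Nfin (maxn N M) (leq_maxl _ _) => /= fn.
rewrite sub0r normrN => h.
by rewrite /F -(fineK fn) lee_fin; apply: le_trans h; exact: ler_norm.
Qed.

Lemma stationary_q1_upper (x : R) : 8 * beta + 720 <= x ->
  (pi [set p | (p.1 < - x)%R] <= (8 * expR (- ((x / 160) ^+ 2)))%:E)%E.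
Proof.
move=> hx; have b0 := beta0; apply/lee_addgt0Pr => e e0; rewrite addeC.
have [N hN] := F_small e0.
have [n hn] : exists n : nat, N%:R <= (3 / 2) ^+ n * x.
  exists N; have : 1 + N%:R / 2 <= (3 / 2) ^+ N :> R.
    elim: N {hN} => [|N IH]; first by rewrite expr0 mul0r addr0.
    rewrite exprS -natr1; have : 0 <= N%:R :> R by [].
    lra.
  have N0 : 0 <= N%:R :> R by [].
  move=> h; apply: (@le_trans _ _ ((1 + N%:R / 2) * x)); last by rewrite ler_pM2r//; lra.
  apply: (@le_trans _ _ ((1 + N%:R / 2) * 2)); first lra.
  by rewrite ler_pM2l; lra.
apply: le_trans (F_iter n hx) _; rewrite leeD2r//; apply: le_trans hN.
apply: le_measure; rewrite ?inE; [exact: measurable_fst_lt|exact: measurable_fst_lt|].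
by move=> p /= h; apply: lt_le_trans h _; rewrite lerN2.
Qed.

Let law1 (B : set R) : measurable B -> P [set w | B (W 1 w)] = normal_prob 0 1 B.
Proof.
move=> mB; have [mW _ _ fdd] := BM.
have := fdd 1%N (fun i => i%:R) (fun=> B) (lexx 0) _ (fun=> mB).
rewrite big_ord1 subr0 sqrtr1 => <-; last by move=> i; rewrite ltr_nat.
congr (P _); apply/seteqP; split => w /=.
  by move=> h i; case: i => //= _; rewrite W0 subr0.
by move=> /(_ 0%N isT); rewrite /= W0 subr0.
Qed.

Let mW1 (B : set R) : measurable B -> measurable [set w | B (W 1 w)].
Proof.
move=> mB; have [mW _ _ _] := BM.
by rewrite -[X in measurable X]setTI; exact: (mW 1).
Qed.

Let g0 : R := normal_pdf 0 1 0.

Let g0_ge : 1 / 3 <= g0.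
Proof.
have p2 : 0 < trigo.pi *+ 2 :> R by rewrite mulr2n addr_gt0 ?pi_gt0.
rewrite /g0 normal_pdfE ?oner_eq0// /normal_peak /normal_fun subrr expr0n/= oppr0 mul0r.
rewrite expR0 mulr1 expr1n mul1r mul1r lef_pV2 ?posrE ?sqrtr_gt0//.
rewrite -[leRHS]ger0_norm// -sqrtr_sqr ler_sqrt ?sqr_ge0//.
have := pihalf_lt2 R; lra.
Qed.

(** Over the time [c = y / beta] the drift costs [y], and a start with [u 0 <= K <= y], of
    probability at least [1/2], costs at most [y]; so a noise above [3 y] suffices. Its variance is
    [2 c], proportional to [y], which makes the Gaussian exponent linear: [a^2 = 9/2 beta y], with
    [(a + 1)^2 / 2 <= a^2 + 1]. *)
Lemma stationary_q2_lower (y : R) : 8 * beta + 720 <= y ->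
  ((1 / 6 * expR (- 1) * expR (- (9 / 2) * beta * y))%:E <= pi [set p : R * R | (y < p.2)%R])%E.
Proof.
set K := 8 * beta + 720 => Ky; have b0 := beta0.
have K0 : 0 < K by rewrite /K; lra.
have y0 : 0 < y by lra.
have c0 : 0 < y / beta by rewrite divr_gt0.
set c := y / beta in c0.
have cb : beta * c = y by rewrite /c; field; rewrite gt_eqF.
have s0 : 0 < Num.sqrt 2 * Num.sqrt c by rewrite mulr_gt0 ?sqrtr_gt0.
pose a := 3 * y / (Num.sqrt 2 * Num.sqrt c).
have a0 : 0 <= a by rewrite divr_ge0 ?(ltW s0)//; lra.
have mB : measurable (~` [set p : R * R | p.1 < - K]) by apply: measurableC; exact: measurable_fst_lt.
have pB : ((1 / 2)%:E <= pi (~` [set p : R * R | (p.1 < - K)%R]))%E.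
  rewrite probability_setC; last exact: measurable_fst_lt.
  have : (F K <= (1 / 2)%:E)%E.
    apply: le_trans (stationary_q1_upper (lexx K)) _; rewrite lee_fin.
    have k1 : 16 <= (K / 160) ^+ 2.
      have -> : 16 = 4 ^+ 2 :> R by ring.
      by rewrite ler_sqr ?nnegrE /K; lra.
    have := expR_ge1Dx ((K / 160) ^+ 2); rewrite expRN => h.
    have -> : 1 / 2 = 8 * 16^-1 :> R by field.
    by rewrite ler_pM2l// lef_pV2 ?posrE ?expR_gt0//; lra.
  rewrite /F -[pi _ in X in X -> _]fineK ?fin_num_measure//; last exact: measurable_fst_lt.
  rewrite -[pi _ in X in _ -> X]fineK ?fin_num_measure//; last exact: measurable_fst_lt.
  by rewrite -EFinB !lee_fin; lra.
have ma : measurable [set x : R | a < x] by exact: measurable_ray.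
have pC : ((1 / 3 * expR (- 1) * expR (- (9 / 2) * beta * y))%:E <= P [set w | (a < W 1 w)%R])%E.
  have := normal_prob01_gt a0; rewrite -[X in (_ <= X)%E](law1 ma); apply: le_trans.
  rewrite lee_fin -[leLHS]mulrA; apply: ler_pM => //.
  rewrite -expRD ler_expR.
  have : a ^+ 2 = 9 / 2 * beta * y.
    have s2 : (Num.sqrt 2 * Num.sqrt c) ^+ 2 = 2 * c.
      by rewrite exprMn !sqr_sqrtr ?(ltW c0).
    by rewrite /a expr_div_n s2 -cb; field; rewrite gt_eqF.
  have := sqr_ge0 (a - 1); rewrite sqrrB sqrrD expr1n mulr1; lra.
apply: le_trans (stationary_ge stat BM c0 (measurable_snd_gt y) mB (mW1 ma) _).
  rewrite [X in (X%:E <= _)%E](_ : _ = 1 / 2 * (1 / 3 * expR (- 1) * expR (- (9 / 2) * beta * y))).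
    rewrite EFinM; apply: lee_pmul => //; rewrite lee_fin ?mulr_ge0 ?expR_ge0//.
  by field.
move=> p q w [p1 p2 [q1 [q2 [L [sol e1 e2]]]]] /= nK aw.
have Kp : - K <= p.1 by rewrite leNgt; apply/negP.
have := reflected_q2_ge sol (ltW c0).
rewrite (reflected_q1_0 sol (path0 c w)) (reflected_q2_0 sol) e2 path0 subr0 cb.
rewrite divff ?gt_eqF// mulrA.
have : 3 * y < Num.sqrt 2 * Num.sqrt c * W 1 w by rewrite [ltRHS]mulrC -ltr_pdivrMr.
lra.
Qed.

(** The time [c = 1/128] is chosen so that [sqrt (2 c) = 1/8]. The event [W 1 < - 24 x] then
    contributes [- 3 x], the start at most [K <= x], and the oscillation term less than [x] for [h]
    near [100 x]. This [h] is large enough for the complement of [A h] to have probability at most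
    [4 expR (- 2 u)], negligible against the lower tail [expR (- u) / 3] of [W 1]. *)
Lemma stationary_q1_lower (K x : R) : 1 <= x -> 0 <= K <= x ->
  (pi [set p : R * R | (K < p.2)%R] <= (1 / 2)%:E)%E ->
  ((1 / 12 * expR (- (625 / 2) * x ^+ 2))%:E <= pi [set p : R * R | (p.1 < - x)%R])%E.
Proof.
move=> x1 /andP[K0 Kx] hK.
have x0 : 0 < x by lra.
pose c : R := 1 / 128; have c0 : 0 < c by rewrite /c; lra.
have sc : Num.sqrt 2 * Num.sqrt c = 1 / 8.
  rewrite -sqrtrM// (_ : 2 * c = (1 / 8) ^+ 2); last by rewrite /c; field.
  by rewrite sqrtr_sqr ger0_norm//; lra.
pose h := Num.truncn (100 * x).
have x100 : 0 <= 100 * x by lra.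
have /andP[h1] := truncn_itv x100; rewrite -/h -natr1 => h2.
have mB : measurable (~` [set p : R * R | K < p.2]) by apply: measurableC; exact: measurable_snd_gt.
have mC0 : measurable [set z : R | z < - (24 * x)].
  by rewrite (_ : [set z | _] = `]-oo, (- (24 * x))%R[%classic) //; apply/seteqP; split => z /=; rewrite in_itv.
have mC1 := mW1 mC0.
have mC : measurable ([set w | W 1 w < - (24 * x)] `&` A h) by exact: measurableI.
pose u := 625 / 2 * x ^+ 2.
have u0 : 23 <= u.
  have : 1 <= x ^+ 2 by rewrite -[leLHS](expr1n _ 2) ler_sqr ?nnegrE//; lra.
  rewrite /u; lra.
have eu : 24 * expR (- u) <= 1.
  rewrite expRN -ler_pdivlMr ?invr_gt0 ?expR_gt0// invrK mul1r.
  by have := expR_ge1Dx u; lra.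
have pC : ((1 / 6 * expR (- u))%:E <= P ([set w | (W 1 w < - (24 * x))%R] `&` A h))%E.
  have hP : (P [set w | (W 1 w < - (24 * x))%R] <=
      P ([set w | (W 1 w < - (24 * x))%R] `&` A h) + P (~` A h))%E.
    apply: (@le_trans _ _ (P (([set w | (W 1 w < - (24 * x))%R] `&` A h) `|` ~` A h))).
      apply: le_measure; rewrite ?inE//; first by apply: measurableU => //; exact: measurableC.
      by move=> w hw; have [?|?] := pselect (A h w); [left|right].
    by apply: measureU2 => //; exact: measurableC.
  have y0 : 0 <= 24 * x by lra.
  have lo : ((1 / 3 * expR (- u))%:E <= P [set w | (W 1 w < - (24 * x))%R])%E.
    have := normal_prob01_lt y0; rewrite -[X in (_ <= X)%E](law1 mC0); apply: le_trans.
    rewrite lee_fin; apply: ler_pM => //.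
    rewrite ler_expR lerN2 /u.
    have : (24 * x + 1) ^+ 2 <= (25 * x) ^+ 2 by rewrite ler_sqr ?nnegrE//; lra.
    by rewrite exprMn; lra.
  have up : (P (~` A h) <= (1 / 6 * expR (- u))%:E)%E.
    apply: le_trans (PAC h) _; rewrite lee_fin.
    apply: (@le_trans _ _ (4 * (expR (- u) * expR (- u)))).
      rewrite ler_pM2l// -expRD ler_expR.
      have : (50 * x) ^+ 2 <= h%:R ^+ 2 by rewrite ler_sqr ?nnegrE//; lra.
      by rewrite /u exprMn; lra.
    have := expR_gt0 (- u); nra.
  have fC := fin_num_measure P _ mC.
  have := le_trans lo (le_trans hP (leeD2l _ up)).
  by rewrite -(fineK fC) -EFinD !lee_fin; lra.
have pB : ((1 / 2)%:E <= pi (~` [set p : R * R | (K < p.2)%R]))%E.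
  rewrite probability_setC; last exact: measurable_snd_gt.
  move: hK; rewrite -[pi _ in X in X -> _]fineK ?fin_num_measure//; last exact: measurable_snd_gt.
  rewrite -[pi _ in X in _ -> X]fineK ?fin_num_measure//; last exact: measurable_snd_gt.
  by rewrite -EFinB !lee_fin; lra.
apply: le_trans (stationary_ge stat BM c0 (measurable_fst_lt (- x)) mB mC _).
  rewrite [X in (X%:E <= _)%E](_ : _ = 1 / 2 * (1 / 6 * expR (- u))); last first.
    by rewrite /u mulNr; field.
  by rewrite EFinM; apply: lee_pmul => //; rewrite lee_fin ?mulr_ge0 ?expR_ge0.
move=> p q w [p1 p2 [q1 [q2 [L [sol e1 e2]]]]] /= nK [wx hA].
have Kp : p.2 <= K by rewrite leNgt; apply/negP.
have c1 : c <= 1 by rewrite /c; lra.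
have := reflected_q1_le beta0 p2 sol (ltW c0) c1 (m := 1 / 8 * (7 * (h + 8)%:R)).
rewrite e1 (reflected_q2_0 sol) path0 subr0 divff ?gt_eqF// (mulrA (Num.sqrt 2) _ (W 1 w)) sc => H.
have : q.1 <= p.2 + 1 / 8 * W 1 w + c * (1 / 8 * (7 * (h + 8)%:R)).
  apply: H => r s s0 sr rc.
  rewrite -mulrBr normrM (ger0_norm (sqrtr_ge0 c)) [leLHS]mulrA sc ler_pM2l; last lra.
  apply: osc => //; first by rewrite divr_ge0// ltW.
    by rewrite ler_pM2r ?invr_gt0.
  by rewrite ler_pdivrMr// mul1r.
rewrite natrD /c; lra.
Qed.

End stationary_tails.

(** * Exponential upper tail of the second coordinate *)

Lemma integral_prob_cst (R : realType) (d : measure_display) (T : measurableType d)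
  (Q : probability T R) (c : R) : (\int[Q]_x (cst c%:E) x = c%:E)%E.
Proof.
rewrite [LHS](integral_cst Q measurableT c%:E) -[RHS]mule1; congr (_ * _)%E.
exact: probability_setT.
Qed.

Section stationary_q2_upper.
Context (R : realType) (beta : R).
Hypothesis beta0 : 0 < beta.

(** The noise costs [1600 theta^2 T] in the exponent, which has to stay below half of the drift gain
    [theta beta T]. This asks for [theta <= beta / 3200], and [60^2 = 3600]. *)
Let theta : R := beta / 60 ^+ 2.
Let K1 : R := 1 + 4 * expR 4.
(** Solves [theta beta T / 2 = 3 + ln (2 K1)]: the net drift gain outweighs the constant 3 and the
    mean [K1] of the noise factor, leaving the factor [1/2] of [contraction]. *)
Let horizon : R := 2 * (3 + ln (2 * K1)) / (theta * beta).
(** Over a gap longer than [T / 2^n], the surplus drift [N - beta] gains at least [1 / (4 (3/4)^n)].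
    The level must not depend on the random [h]: only [e] does, quadratically, with a coefficient
    that is small for large [n]. *)
Let floor_level (T : R) (n : nat) : R := beta + 2 ^+ n / (4 * (3 / 4) ^+ n * T).
Let K2 (n : nat) : R := expR (theta * floor_level horizon n + 3 + theta * beta * horizon / 2).

Let theta0 : 0 < theta. Proof. by rewrite divr_gt0// exprn_gt0. Qed.

Let K1_gt0 : 0 < K1.
Proof. by rewrite /K1; have := expR_gt0 (4 : R); lra. Qed.

Let ln2K1 : 0 <= ln (2 * K1).
Proof. by apply: ln_ge0; rewrite /K1; have := expR_gt0 (4 : R); lra. Qed.

Let horizon_gt0 : 0 < horizon.
Proof. by have l0 := ln2K1; rewrite divr_gt0 ?mulr_gt0//; lra. Qed.

Let contraction : expR (3 - theta * beta * horizon / 2) * K1 = 1 / 2.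
Proof.
have -> : theta * beta * horizon / 2 = 3 + ln (2 * K1).
  by rewrite /horizon; field; rewrite !gt_eqF.
have -> : 3 - (3 + ln (2 * K1)) = - ln (2 * K1) by ring.
by rewrite expRN lnK ?posrE ?mulr_gt0//; field; rewrite gt_eqF.
Qed.

Section tame_driver.
Context (d : measure_display) (Omega : measurableType d)
  (P : probability Omega R) (W : R -> Omega -> R) (A : nat -> set Omega).
Hypothesis tame : tame_brownian P W A.

Let BM : brownian_motion P W. Proof. by case: tame. Qed.
Let mA h : measurable (A h). Proof. by case: tame. Qed.

Let level (h : nat) (w : Omega) : \bar R :=
  (expR (h.+1%:R ^+ 2 / 16) * \1_(~` A h) w)%:E.
(** A measurable majorant of [expR (h^2 / 16)] for the least [h] with [A h w]: if that [h] is
    positive, then [A (h - 1)] fails at [w], so the term of index [h - 1] is present. *)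
Let J (w : Omega) : \bar R := (1 + \sum_(0 <= h <oo) level h w)%E.

Let level_ge0 h w : (0 <= level h w)%E.
Proof. by rewrite lee_fin mulr_ge0 ?expR_ge0// indicE. Qed.

Let measurable_level h : measurable_fun setT (level h).
Proof.
apply/measurable_EFinP; apply: measurable_funM => //.
by apply: measurable_indic; exact: measurableC.
Qed.

Let J_ge1 w : (1 <= J w)%E.
Proof. by apply: leeDl; apply: nneseries_ge0 => h _ _; exact: level_ge0. Qed.

Let J_ge0 w : (0 <= J w)%E.
Proof. by apply: le_trans (J_ge1 w); rewrite lee_fin. Qed.

Let measurable_J : measurable_fun setT J.
Proof.
apply: emeasurable_funD => //.
by apply: (@ge0_emeasurable_sum _ _ _ _ _ xpredT).
Qed.

Let J_witness w : exists2 h, A h w & ((expR (h%:R ^+ 2 / 16))%:E <= J w)%E.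
Proof.
have [_ _ exA _ _] := tame.
have exA' : exists h, `[< A h w >] by have [h hA] := exA w; exists h; exact/asboolP.
case: (ex_minnP exA') => h /asboolP hA hmin; exists h => //.
case: h hA hmin => [|h] hA hmin; first by rewrite expr0n/= mul0r expR0.
have nA : ~ A h w by move=> /asboolP /hmin; rewrite ltnn.
apply: (@le_trans _ _ (\sum_(0 <= k < h.+1) level k w)%E); last first.
  apply: (@le_trans _ _ (\sum_(0 <= k <oo) level k w)%E).
    by apply: nneseries_lim_ge => k _ _; exact: level_ge0.
  by apply: leeDr; rewrite lee_fin.
rewrite big_nat_recr//= -[leLHS]add0e; apply: leeD.
  by apply: sume_ge0 => k _; exact: level_ge0.
by rewrite lee_fin indicE mem_set// mulr1.
Qed.

(** With [2^(h+1)] bounded by [e^(h+1)], it remains that the quadratic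
    [(h+1)^2 / 16 - h^2 / 4 + h + 1] stays below 4. *)
Let level_integral h : (\int[P]_w level h w <= (4 * expR 4 / (2 ^ h.+1)%:R)%:E)%E.
Proof.
have [_ _ _ PAC _] := tame.
under eq_integral do rewrite /level EFinM.
have mI : measurable_fun setT (fun w => (\1_(~` A h) w)%:E : \bar R).
  by apply/measurable_EFinP; apply: measurable_indic; exact: measurableC.
rewrite (ge0_integralZl P measurableT mI); last 2 first.
- by move=> w _; rewrite lee_fin indicE.
- by rewrite lee_fin expR_ge0.
rewrite integral_indic//; last exact: measurableC.
rewrite setIT; apply: (@le_trans _ _ ((expR (h.+1%:R ^+ 2 / 16))%:E * (4 * expR (- (h%:R ^+ 2 / 4)))%:E)%E).
  by apply: lee_wpmul2l; [rewrite lee_fin expR_ge0|exact: PAC].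
rewrite -EFinM lee_fin mulrCA -expRD -[leRHS]mulrA ler_pM2l// natrX.
rewrite ler_pdivlMr ?exprn_gt0//.
have two : 2 <= expR 1 :> R by have := expR_ge1Dx (1 : R); lra.
apply: (@le_trans _ _ (expR (h.+1%:R ^+ 2 / 16 - h%:R ^+ 2 / 4) * expR 1 ^+ h.+1)).
  by rewrite ler_pM2l ?expR_gt0//; apply: lerXn2r => //; rewrite nnegrE ?expR_ge0.
rewrite -expRM_natr mul1r -expRD ler_expR -natr1.
have := sqr_ge0 (h%:R - 4 : R); have := sqr_ge0 (h%:R - 1 : R).
by rewrite !sqrrB sqrrD; lra.
Qed.

Let J_integral : (\int[P]_w J w <= K1%:E)%E.
Proof.
have mS : measurable_fun setT (fun w => \sum_(0 <= h <oo) level h w)%E.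
  by apply: (@ge0_emeasurable_sum _ _ _ _ _ xpredT).
have S0 w : setT w -> (0 <= \sum_(0 <= h <oo) level h w)%E.
  by move=> _; apply: nneseries_ge0 => h _ _; exact: level_ge0.
rewrite (ge0_integralD P measurableT _ _ S0 mS)//.
rewrite /K1 EFinD; apply: leeD.
  by rewrite [leLHS]integral_prob_cst.
rewrite integral_nneseries//.
have e0 : 0 <= 4 * expR 4 :> R by rewrite mulr_ge0 ?expR_ge0.
apply: le_trans (epsilon_trick0 xpredT e0).
apply: lee_nneseries => [h _ _|h _]; last exact: level_integral.
by apply: integral_ge0 => w _; exact: level_ge0.
Qed.

(** With [a = h + 8], completing the square bounds [theta X] by [a^2 / 64] plus half of the drift
    gain. The smallness of [r] bounds the other term by [1/2 + a^2 / 256], as [100 / 160^2 = 1/256].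
    Finally [a^2 <= 2 h^2 + 128] turns the sum into at most [h^2 / 16 + 3]. *)
Let q2_error (T r : R) (h : nat) (X := 10 * Num.sqrt T * (h + 8)%:R) : 0 < T -> 0 <= r ->
  theta * (T + 1) * r * (1 + T) <= (1 / 160) ^+ 2 ->
  theta * X + theta * ((T + 1) * ((1 + X ^+ 2) * r)) <=
  h%:R ^+ 2 / 16 + 3 + theta * beta * T / 2.
Proof.
move=> T0 r0 hn; have t0 := theta0; pose a : R := (h + 8)%:R.
have XE : X = 10 * Num.sqrt T * a by [].
have aE : a ^+ 2 <= 2 * h%:R ^+ 2 + 128.
  by rewrite /a natrD; have := sqr_ge0 (h%:R - 8 : R); rewrite sqrrB sqrrD; lra.
have X2 : X ^+ 2 = 100 * T * a ^+ 2.
  by rewrite XE !exprMn sqr_sqrtr ?(ltW T0)//; ring.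
have bX : theta * X <= a ^+ 2 / 64 + theta * beta * T / 2.
  have e : 100 * 16 * theta ^+ 2 * T <= theta * beta * T / 2.
    have : 0 <= beta ^+ 2 * T by rewrite mulr_ge0 ?sqr_ge0// ltW.
    by rewrite /theta; lra.
  have := sqr_ge0 (a / 8 - 40 * theta * Num.sqrt T).
  have -> : (a / 8 - 40 * theta * Num.sqrt T) ^+ 2 =
      a ^+ 2 / 64 - theta * X + 100 * 16 * theta ^+ 2 * (Num.sqrt T ^+ 2).
    by rewrite XE; field.
  by rewrite sqr_sqrtr ?(ltW T0)//; lra.
have T1 : 0 <= T + 1 by lra.
have dl0 : 0 <= theta * (T + 1) * r := mulr_ge0 (mulr_ge0 (ltW t0) T1) r0.
set dl := theta * (T + 1) * r in hn dl0.
have dT : 0 <= dl * T by rewrite mulr_ge0// ltW.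
have bE : theta * ((T + 1) * ((1 + X ^+ 2) * r)) <= 1 / 2 + a ^+ 2 / 256.
  have -> : theta * ((T + 1) * ((1 + X ^+ 2) * r)) = dl + 100 * (dl * T) * a ^+ 2.
    by rewrite X2 /dl; ring.
  have : 100 * (dl * T) * a ^+ 2 <= 1 / 256 * a ^+ 2.
    by rewrite ler_wpM2r ?sqr_ge0//; lra.
  lra.
have := sqr_ge0 (h%:R : R); lra.
Qed.

Let q2_path (T : R) (n h : nat) w p q : 0 < T ->
  theta * (T + 1) * (3 / 4) ^+ n * (1 + T) <= (1 / 160) ^+ 2 ->
  solves_at beta W T p q w -> A h w ->
  theta * q.2 <= theta * Num.max (p.2 - beta * T) (floor_level T n)
    + (h%:R ^+ 2 / 16 + 3 + theta * beta * T / 2).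
Proof.
have b0 := beta0; have t0 := theta0.
move=> T0 hn [p1 p2 [q1 [q2 [L [sol e1 e2]]]]] hA.
have [_ _ _ _ modulus] := tame.
set r := (3 / 4) ^+ n in hn *; have r0 : 0 < r by rewrite exprn_gt0//; lra.
have sT0 : 0 < Num.sqrt T by rewrite sqrtr_gt0.
set X := 10 * Num.sqrt T * (h + 8)%:R.
have X0 : 0 <= X by rewrite !mulr_ge0 ?sqrtr_ge0.
have N0 : 0 < 2 ^+ n / (4 * r * T) by rewrite divr_gt0 ?exprn_gt0 ?mulr_gt0.
have NB : floor_level T n - beta = 2 ^+ n / (4 * r * T) by rewrite /floor_level -/r; lra.
have s2 := sqrt2_mul7_le R.
have incr k s t : 0 <= s -> s <= t -> t <= T -> (t - s) / T <= (2 ^+ k)^-1 ->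
    Num.sqrt 2 * `|Num.sqrt T * W (t / T) w - Num.sqrt T * W (s / T) w| <= X * (3 / 4) ^+ k.
  move=> s0 st tT ts; have k0 : 0 <= (3 / 4) ^+ k :> R by rewrite exprn_ge0//; lra.
  have : `|W (t / T) w - W (s / T) w| <= 7 * (h + 8)%:R * (3 / 4) ^+ k.
    apply: modulus => //; first by rewrite divr_ge0// ltW.
    - by rewrite ler_pM2r ?invr_gt0.
    - by rewrite ler_pdivrMr// mul1r.
    - by rewrite -mulrBl.
  rewrite -mulrBr normrM (ger0_norm (ltW sT0)); set D := `|_| => hD.
  apply: (@le_trans _ _ (Num.sqrt 2 * (Num.sqrt T * (7 * (h + 8)%:R * (3 / 4) ^+ k)))).
    by rewrite ler_wpM2l ?sqrtr_ge0// ler_pM2l.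
  rewrite [leLHS](_ : _ = Num.sqrt 2 * 7 * (Num.sqrt T * (h + 8)%:R * (3 / 4) ^+ k)); last by ring.
  rewrite [leRHS](_ : _ = 10 * (Num.sqrt T * (h + 8)%:R * (3 / 4) ^+ k)); last by rewrite /X; ring.
  by rewrite ler_wpM2r// !mulr_ge0 ?sqrtr_ge0.
have := reflected_q2_le beta0 sol (ltW T0) (N := floor_level T n) (m := X)
  (e := (1 + X ^+ 2) * r).
rewrite (reflected_q2_0 sol) e2 => H.
have {}H : q.2 <= Num.max (p.2 - beta * T) (floor_level T n) + X + (T + 1) * ((1 + X ^+ 2) * r).
  apply: H; first by lra.
    by rewrite mulr_ge0 ?(ltW r0)// addr_ge0// sqr_ge0.
  move=> s t s0 st tT.
  have XX : Num.sqrt 2 * `|Num.sqrt T * W (t / T) w - Num.sqrt T * W (s / T) w| <= X.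
    have := incr 0%N s t s0 st tT; rewrite !expr0 mulr1 invr1; apply.
    by rewrite ler_pdivrMr// mul1r; lra.
  split => //; rewrite NB.
  (* Short gaps are covered by the modulus at level [n], long ones by the surplus drift. *)
  have [short|long] := leP ((t - s) / T) (2 ^+ n)^-1.
    apply: le_trans (incr n s t s0 st tT short) _.
    apply: (@le_trans _ _ ((1 + X ^+ 2) * r)).
      by rewrite ler_pM2r//; have := sqr_ge0 (X - 1 / 2); rewrite sqrrB; lra.
    by rewrite lerDl mulr_ge0 ?(ltW N0)//; lra.
  (* AM-GM: [X <= r X^2 + 1 / (4 r)] *)
  apply: le_trans XX _.
  have l2 : 1 / (4 * r) <= 2 ^+ n / (4 * r * T) * (t - s).
    have n2 : 0 < 2 ^+ n :> R by rewrite exprn_gt0.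
    have : 1 <= 2 ^+ n * ((t - s) / T) by rewrite mulrC -ler_pdivrMr// mul1r ltW.
    have -> : 2 ^+ n / (4 * r * T) * (t - s) = 1 / (4 * r) * (2 ^+ n * ((t - s) / T)).
      by field; rewrite !gt_eqF.
    by move=> ?; rewrite ler_peMr// divr_ge0// mulr_ge0// ltW.
  have l1 : X <= X ^+ 2 * r + 1 / (4 * r).
    have -> : X ^+ 2 * r + 1 / (4 * r) = X + r * (X - 1 / (2 * r)) ^+ 2.
      by field; rewrite gt_eqF.
    by rewrite lerDl mulr_ge0 ?sqr_ge0// ltW.
  lra.
set M := Num.max _ _ in H *.
have := q2_error h T0 (ltW r0) hn; rewrite -/X.
have : theta * q.2 <= theta * M + theta * X + theta * ((T + 1) * ((1 + X ^+ 2) * r)).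
  by rewrite -!mulrDr ler_pM2l.
lra.
Qed.

Let exp_q2_le (n : nat) w p q :
  theta * (horizon + 1) * (3 / 4) ^+ n * (1 + horizon) <= (1 / 160) ^+ 2 ->
  solves_at beta W horizon p q w ->
  ((expR (theta * q.2))%:E <=
    (expR (3 - theta * beta * horizon / 2) * expR (theta * p.2))%:E * J w + (K2 n)%:E * J w)%E.
Proof.
move=> hn sol; have [h hA hJ] := J_witness w.
have k0 : 0 <= expR (3 - theta * beta * horizon / 2) * expR (theta * p.2) by rewrite mulr_ge0 ?expR_ge0.
rewrite -ge0_muleDl ?lee_fin ?expR_ge0// -EFinD.
apply: (@le_trans _ _ ((expR (3 - theta * beta * horizon / 2) * expR (theta * p.2) + K2 n)%:E
    * (expR (h%:R ^+ 2 / 16))%:E)%E); last first.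
  by apply: lee_wpmul2l => //; rewrite lee_fin addr_ge0 ?expR_ge0.
rewrite -EFinM lee_fin.
have := q2_path horizon_gt0 hn sol hA; set M := Num.max _ _ => hq.
apply: (@le_trans _ _ (expR (theta * M + (h%:R ^+ 2 / 16 + 3 + theta * beta * horizon / 2)))).
  by rewrite ler_expR.
rewrite /K2 mulrDl -!expRD /M; case: (leP (p.2 - beta * horizon) (floor_level horizon n)) => _.
  rewrite [X in expR X <= _](_ : _ =
    theta * floor_level horizon n + 3 + theta * beta * horizon / 2 + h%:R ^+ 2 / 16); last by ring.
  by rewrite lerDr expR_ge0.
rewrite [X in expR X <= _](_ : _ =
  3 - theta * beta * horizon / 2 + theta * p.2 + h%:R ^+ 2 / 16); last by field.
by rewrite lerDl expR_ge0.
Qed.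

Section stationary.
Context (pi : probability (R * R)%type R).
Hypothesis stat : stationary_dist beta pi.

Let X (p : R * R) : R := expR (theta * p.2).

Let measurable_X : measurable_fun setT X.
Proof.
by apply: measurableT_comp => //; apply: measurable_funM.
Qed.

Let X0 p : 0 <= X p. Proof. exact: expR_ge0. Qed.

(** Only the term proportional to [X p] is kept under the truncation. For fixed [p], the mean over
    the driver of a minimum is at most the minimum of the means, and [J] has mean at most [K1]. *)
Let truncated_contraction (n : nat) (M : R) : 0 <= M ->
  theta * (horizon + 1) * (3 / 4) ^+ n * (1 + horizon) <= (1 / 160) ^+ 2 ->
  (\int[pi]_p (Num.min (X p) M)%:E <=
   \int[pi]_p (Num.min (X p / 2) M)%:E + (K2 n * K1)%:E)%E.
Proof.
move=> M0 hn; pose k := expR (3 - theta * beta * horizon / 2).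
have k0 : 0 <= k by exact: expR_ge0.
have K20 : 0 <= K2 n by exact: expR_ge0.
have mm c : measurable_fun setT (fun p => (Num.min (X p * c) M)%:E).
  apply/measurable_EFinP; apply: measurable_minr => //.
  exact: measurable_funM.
pose g (pw : (R * R) * Omega) : \bar R :=
  (mine ((k * X pw.1)%:E * J pw.2) M%:E + (K2 n)%:E * J pw.2)%E.
have mJ2 : measurable_fun setT (fun pw : (R * R) * Omega => J pw.2).
  exact: (measurableT_comp measurable_J measurable_snd).
have g1 pw : (0 <= mine ((k * X pw.1)%:E * J pw.2) M%:E)%E.
  by rewrite le_min lee_fin M0 andbT mule_ge0// lee_fin mulr_ge0.
have g2 w : (0 <= (K2 n)%:E * J w)%E by rewrite mule_ge0.
have mg : measurable_fun setT g.
  apply: emeasurable_funD; last by apply: measurable_funeM.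
  apply: measurable_mine => //; apply: emeasurable_funM => //.
  apply/measurable_EFinP; apply: measurable_funM => //.
  exact: (measurableT_comp measurable_X measurable_fst).
apply: (@le_trans _ _ (\int[pi]_p \int[P]_w g (p, w))%E).
  apply: (stationary_integral_le stat BM horizon_gt0).
  - by have := mm 1; under eq_fun do rewrite mulr1.
  - exact: mg.
  - by move=> p; rewrite lee_fin le_min X0.
  - by move=> pw; rewrite adde_ge0.
  move=> p q w sol; have := exp_q2_le hn sol.
  rewrite -/(X q) -/(X p) -/k /g /=; set a := (_ * J w)%E; set b := (_ * J w)%E => hX.
  have b0 : (0 <= b)%E by exact: g2.
  rewrite EFin_min /mine; case: (ltP a M%:E) => _.
    by apply: le_trans hX; rewrite ge_min lexx.
  apply: (@le_trans _ _ M%:E); first by rewrite ge_min lexx orbT.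
  by rewrite leeDl.
have inner p : (\int[P]_w g (p, w) <= (Num.min (X p / 2) M + K2 n * K1)%:E)%E.
  have mk : measurable_fun setT (fun w => (k * X p)%:E * J w)%E by apply: measurable_funeM.
  have mmin : measurable_fun setT (fun w => mine ((k * X p)%:E * J w) M%:E)%E.
    by apply: measurable_mine.
  rewrite [leLHS](ge0_integralD P measurableT (fun w _ => g1 (p, w)) mmin
    (fun w _ => g2 w) (measurable_funeM _ measurable_J)).
  have kX : 0 <= k * X p by rewrite mulr_ge0.
  rewrite EFinD; apply: leeD; last first.
    rewrite ge0_integralZl// EFinM; apply: lee_wpmul2l => //.
  rewrite EFin_min le_min; apply/andP; split.
    apply: (@le_trans _ _ (\int[P]_w ((k * X p)%:E * J w))%E).
      apply: ge0_le_integral; [by []|by move=> w _; exact: (g1 (p, w))|exact: mmin|exact: mk|].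
      by move=> w _; rewrite ge_min lexx.
    rewrite ge0_integralZl//; apply: (@le_trans _ _ ((k * X p)%:E * K1%:E)%E).
      by apply: lee_wpmul2l.
    by rewrite -EFinM lee_fin mulrAC contraction; lra.
  apply: (@le_trans _ _ (\int[P]_(w in setT) cst M%:E w)%E).
    apply: ge0_le_integral; [by []|by move=> w _; exact: (g1 (p, w))|exact: mmin|by []|].
    by move=> w _; rewrite ge_min lexx orbT.
  by rewrite [leLHS]integral_prob_cst.
have K12 : 0 <= K2 n * K1 by rewrite mulr_ge0// ltW.
apply: (@le_trans _ _ (\int[pi]_p ((Num.min (X p / 2) M)%:E + (K2 n * K1)%:E))%E).
  apply: ge0_le_integral => //.
  - by move=> p _; apply: integral_ge0 => w _; rewrite adde_ge0.
  - by apply: measurable_fun_fubini_tonelli_F => // pw; rewrite adde_ge0.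
  - by apply: emeasurable_funD => //; exact: mm.
rewrite [leLHS](ge0_integralD pi measurableT (f1 := fun p => (Num.min (X p / 2) M)%:E)
  (f2 := cst (K2 n * K1)%:E))//.
  apply: leeD => //.
  by rewrite [leLHS]integral_prob_cst.
by move=> p _; rewrite lee_fin le_min M0 andbT divr_ge0.
Qed.

Let measurable_strip (y z : R) : measurable [set p : R * R | y < p.2 /\ p.2 <= z].
Proof.
rewrite (_ : [set p | _] = snd @^-1` `]y, z]%classic).
  by rewrite -[X in measurable X]setTI; exact: measurable_snd.
by apply/seteqP; split => p; rewrite /= in_itv/= => /andP.
Qed.

(** With [M = expR (theta * z)] the truncation is inactive on the strip, so there the two truncated
    variables differ by [X / 2 >= expR (theta * y) / 2]. Their means are finite, so the contraction
    bounds the mean of the difference. *)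
Let q2_strip (n : nat) (y z : R) :
  theta * (horizon + 1) * (3 / 4) ^+ n * (1 + horizon) <= (1 / 160) ^+ 2 ->
  (pi [set p | (y < p.2 /\ p.2 <= z)%R] <= (2 * (K2 n * K1) * expR (- (theta * y)))%:E)%E.
Proof.
move=> hn; set S := [set p | _]; pose M := expR (theta * z).
have M0 : 0 <= M by exact: expR_ge0.
have mS : measurable S by exact: measurable_strip.
have mh : measurable_fun setT (fun p => (Num.min (X p / 2) M)%:E).
  apply/measurable_EFinP; apply: measurable_minr => //; exact: measurable_funM.
have mf : measurable_fun setT (fun p => (Num.min (X p) M)%:E).
  by apply/measurable_EFinP; apply: measurable_minr.
have h0 p : (0 <= (Num.min (X p / 2) M)%:E)%E by rewrite lee_fin le_min M0 andbT divr_ge0.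
pose a := expR (theta * y) / 2.
have a0 : 0 < a by rewrite divr_gt0 ?expR_gt0.
have mi : measurable_fun setT (fun p => a%:E * (\1_S p)%:E : \bar R)%E.
  by apply: measurable_funeM; apply/measurable_EFinP; exact: measurable_indic.
have i0 p : (0 <= a%:E * (\1_S p)%:E)%E by rewrite mule_ge0 ?lee_fin ?(ltW a0)// indicE.
have lower : (\int[pi]_p (Num.min (X p / 2) M)%:E + a%:E * pi S <=
    \int[pi]_p (Num.min (X p) M)%:E)%E.
  have -> : (a%:E * pi S = \int[pi]_p (a%:E * (\1_S p)%:E))%E.
    have mI : measurable_fun setT (fun p => (\1_S p)%:E : \bar R).
      by apply/measurable_EFinP; exact: measurable_indic.
    rewrite (ge0_integralZl pi measurableT mI); last 2 first.
    - by move=> p _; rewrite lee_fin indicE.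
    - by rewrite lee_fin ltW.
    by rewrite integral_indic// setIT.
  rewrite -(ge0_integralD pi measurableT (fun p _ => h0 p) mh (fun p _ => i0 p) mi).
  apply: ge0_le_integral => //.
  - by move=> p _; rewrite adde_ge0.
  - exact: emeasurable_funD.
  move=> p _; rewrite -EFinM -EFinD lee_fin indicE; have Xp := X0 p.
  have [|] := boolP (p \in S).
    rewrite inE => -[yp pz]; rewrite mulr1.
    have XM : X p <= M by rewrite ler_expR ler_pM2l.
    have yX : a <= X p / 2 by rewrite ler_pM2r// ler_expR ler_pM2l// ltW.
    by rewrite (min_idPl _) ?(min_idPl XM); lra.
  by rewrite mulr0 addr0 le_min !ge_min lexx orbT andbT (_ : X p / 2 <= X p) //; lra.
have fin : (\int[pi]_p (Num.min (X p / 2) M)%:E)%E \is a fin_num.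
  rewrite ge0_fin_numE; last by apply: integral_ge0.
  apply: (@le_lt_trans _ _ (\int[pi]_p cst M%:E p)%E).
    apply: ge0_le_integral => //.
    by move=> p _; rewrite lee_fin ge_min lexx orbT.
  by rewrite integral_prob_cst ltry.
have := le_trans lower (truncated_contraction M0 hn).
rewrite leeD2lE// => le1.
have fS := fin_num_measure pi _ mS.
move: le1; rewrite -(fineK fS) -EFinM !lee_fin => le1.
rewrite expRN -ler_pdivrMr ?invr_gt0 ?expR_gt0// invrK.
by move: le1; rewrite /a; lra.
Qed.

Lemma stationary_q2_upper_rate (n : nat) (y : R) :
  theta * (horizon + 1) * (3 / 4) ^+ n * (1 + horizon) <= (1 / 160) ^+ 2 ->
  (pi [set p | (y < p.2)%R] <= (2 * (K2 n * K1) * expR (- (theta * y)))%:E)%E.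
Proof.
move=> hn; pose S (k : nat) := [set p : R * R | y < p.2 /\ p.2 <= k%:R].
have U : \bigcup_k S k = [set p | y < p.2].
  apply/seteqP; split => p /=; first by move=> [k _ []].
  move=> yp; exists (Num.truncn p.2).+1 => //; split => //.
  by apply: ltW; exact: truncnS_gt.
have mS k : measurable (S k) by exact: measurable_strip.
have : (pi \o S) x @[x --> \oo] --> pi (\bigcup_k S k).
  apply: nondecreasing_cvg_mu => //; first exact: bigcup_measurable.
  move=> i j ij; apply/subsetPset => p [yp pi']; split => //.
  by apply: le_trans pi' _; rewrite ler_nat.
rewrite U; apply: cvge_le; apply: nearW => k; exact: q2_strip.
Qed.

End stationary.
End tame_driver.

Let rate_small : exists n : nat,
  theta * (horizon + 1) * (3 / 4) ^+ n * (1 + horizon) <= (1 / 160) ^+ 2.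
Proof.
have T0 := horizon_gt0; have t0 := theta0.
have c : (fun n => (3 / 4) ^+ n) @ \oo --> (0 : R).
  by apply: cvg_expr; rewrite ger0_norm; lra.
have c0 : 0 < theta * (horizon + 1) * (1 + horizon) by rewrite !mulr_gt0//; lra.
have e0 : 0 < (1 / 160) ^+ 2 / (theta * (horizon + 1) * (1 + horizon)).
  by rewrite divr_gt0// exprn_gt0//; lra.
have [n _ /(_ n (leqnn n)) /= hn] := cvgr_le _ c _ e0; exists n.
by move: hn; rewrite ler_pdivlMr// => hn; rewrite mulrAC mulrC.
Qed.

Lemma stationary_q2_upper : exists2 D : R, 0 < D &
  forall pi : probability (R * R)%type R, stationary_dist beta pi ->
  forall y, (pi [set p | (y < p.2)%R] <= (D * expR (- (beta / 60 ^+ 2 * y)))%:E)%E.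
Proof.
(* The level [n], hence the constant, is fixed from [beta] alone, before any [pi] is given. *)
have [n hn] := rate_small; have [W [A tame]] := tame_brownian_exists R.
exists (2 * (K2 n * K1)); first by rewrite !mulr_gt0 ?expR_gt0.
by move=> pi stat y; exact: (stationary_q2_upper_rate tame stat y hn).
Qed.

End stationary_q2_upper.

Theorem theorem2p1 (R : realType) :
  exists C1 C2 D1 D2 : R, [/\ 0 < C1, 0 < C2, 0 < D1 & 0 < D2] /\
  forall beta : R, 0 < beta ->
  exists Cl Cu Dl Du CR DR : R,
    [/\ 0 < Cl, 0 < Cu, 0 < Dl & 0 < Du] /\ (0 < CR /\ 0 < DR) /\
    forall pi : probability (R * R)%type R, stationary_dist beta pi ->
      (forall x : R, CR <= x ->
         ((Cl * expR (- C1 * x ^+ 2))%:E <= pi [set p : R * R | (p.1 < - x)%R])%E /\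
         (pi [set p : R * R | (p.1 < - x)%R] <= (Cu * expR (- C2 * x ^+ 2))%:E)%E) /\
      (forall y : R, DR <= y ->
         ((Dl * expR (- D1 * beta * y))%:E <= pi [set p : R * R | (y < p.2)%R])%E /\
         (pi [set p : R * R | (y < p.2)%R] <= (Du * expR (- D2 * beta * y))%:E)%E).
Proof.
exists (625 / 2), ((1 / 160) ^+ 2), (9 / 2), ((1 / 60) ^+ 2).
split; first by split; [lra|apply: exprn_gt0; lra|lra|apply: exprn_gt0; lra].
move=> beta beta0; have [D D0 hD] := stationary_q2_upper beta0.
have [W [A tame]] := tame_brownian_exists R.
have t0 : 0 < beta / 60 ^+ 2 by rewrite divr_gt0 ?exprn_gt0.
(* A level that [Q2] exceeds with probability at most [1/2]: the upper bound at [K] is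
   [D / (2 (D + 1))]. Adding 1 to [D] makes the logarithm nonnegative. *)
pose K := ln (2 * (D + 1)) / (beta / 60 ^+ 2).
have K0 : 0 <= K by rewrite divr_ge0 ?(ltW t0)//; apply: ln_ge0; lra.
exists (1 / 12), 8, (1 / 6 * expR (- 1)), D, (8 * beta + 720 + K), (8 * beta + 720).
split; first by split => //; rewrite mulr_gt0 ?expR_gt0.
split; first by split; lra.
move=> pi stat; split => [x hx|y hy].
- split; last first.
    rewrite (_ : - (1 / 160) ^+ 2 * x ^+ 2 = - ((x / 160) ^+ 2)); last by field.
    by apply: (stationary_q1_upper beta0 stat tame); lra.
  apply: (stationary_q1_lower beta0 stat tame (K := K)); [lra|by rewrite K0/=; lra|].
  apply: le_trans (hD pi stat K) _; rewrite lee_fin.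
  have -> : beta / 60 ^+ 2 * K = ln (2 * (D + 1)) by rewrite /K mulrC divfK ?gt_eqF.
  rewrite expRN lnK ?posrE; last by lra.
  by rewrite ler_pdivrMr; lra.
- split; first exact: (stationary_q2_lower beta0 stat tame).
  rewrite (_ : - (1 / 60) ^+ 2 * beta * y = - (beta / 60 ^+ 2 * y)); last by field.
  exact: hD.
Qed.
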